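(* Let $\gamma\in[0,\pi)\setminus\{\pi/2\}$. For $w\in\mathbb{C}\setminus\mathbb{R}$ one has $$R_\gamma(w)-R_{\pi/2}(w)=\frac{1}{\pi\tan\gamma+\pi\frac{s_0(w)}{s_{\pi/2}(w)}}\left\langle\hat{R}_{\pi/2}(\overline w)s_0(\cdot),\cdot\right\rangle\hat{R}_{\pi/2}(w)s_0(z).$$ Consequently, Krein's formula $$R_\gamma(w)-R_{\pi/2}(w)=\frac{1}{\lambda-q(w)}\left\langle\hat{R}_{\pi/2}(\overline w)s_0(\cdot),\cdot\right\rangle\hat{R}_{\pi/2}(w)s_0(z),\qquad w\in\mathbb{C}\setminus\mathbb{R},$$ with $$q(w):=\left\langle\hat{R}_{\pi/2}(i)s_0(\cdot),(I+wS_{\pi/2})R_{\pi/2}(w)\hat{R}_{\pi/2}(i)s_0(\cdot)\right\rangle,$$ holds true for $\lambda=\pi\tan\gamma+\pi\operatorname{Re}\left(\frac{s_0(i)}{s_{\pi/2}(i)}\right)$.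
   Context: Inner products are conjugate linear in the left argument. For an entire function $f$, $f^\#(z):=\overline{f(\overline z)}$. A Hilbert space of entire functions is a de Branges (dB) space if it has a reproducing kernel and is isometrically invariant under $f\mapsto f^\#$ and under $f(z)\mapsto \frac{z-\overline w}{z-w}f(z)$ whenever $w$ is a non-real zero of $f$. The Hermite-Biehler class consists of entire $e$ with $|e(z)|>|e(\overline z)|$ for all $z$ with $\operatorname{Im} z>0$; for such $e$, $\mathcal{B}(e)$ is the space of entire $f$ with $f/e,\,f^\#/e\in H^2(\mathbb{C}_+)$ (Hardy space of the upper half plane), with inner product $\langle f,g\rangle=\int_{\mathbb{R}}\frac{\overline{f(x)}g(x)}{|e(x)|^2}dx$. Every nonzero dB space equals some $\mathcal{B}(e)$ isometrically. Fix a nonzero dB space $\mathcal{B}=\mathcal{B}(e)$ with $e$ in the Hermite-Biehler class and without real zeros (standing assumption), with reproducing kernel $k(z,w)$, $f(w)=\langle k(\cdot,w),f\rangle$. The set $\operatorname{assoc}\mathcal{B}$ of associated functions is $z\mathcal{B}+\mathcal{B}$. Put $s_\gamma(z)=\frac{i}{2}[e^{i\gamma}e(z)-e^{-i\gamma}e^\#(z)]$, $\gamma\in[0,\pi)$; then $s_\gamma\in\operatorname{assoc}\mathcal{B}$. $S$ is the operator of multiplication by the independent variable on its maximal domain in $\mathcal{B}$; it is assumed throughout that $\operatorname{dom}(S)$ is dense. One has $k(\cdot,w)\in\ker(S^*-\overline wI)$. The canonical selfadjoint extensions of $S$ are $S_\gamma$, $\gamma\in[0,\pi)$: with any $w\in\mathbb{C}\setminus\mathbb{R}$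 (the result does not depend on $w$), $$\operatorname{dom}(S_\gamma)=\left\{g(z)=\frac{f(z)-\frac{s_\gamma(z)}{s_\gamma(w)}f(w)}{z-w}: f\in\mathcal{B}\right\},\qquad S_\gamma g(z)=zg(z)+f(w)\frac{s_\gamma(z)}{s_\gamma(w)}.$$ $R_\gamma(w):=(S_\gamma-wI)^{-1}$ for $w\notin\operatorname{spec}(S_\gamma)$. $\mathcal{B}_{+2}^{(\pi/2)}$ is $\operatorname{dom}(S_{\pi/2})$ with inner product $\langle f,g\rangle_{+2}:=\langle S_{\pi/2}f,S_{\pi/2}g\rangle+\langle f,g\rangle$; $\mathcal{B}_{-2}^{(\pi/2)}$ is its dual, realized as the completion of $\mathcal{B}$ under the norm of $\langle f,g\rangle_{-2}:=\langle f,(S_{\pi/2}^2+I)^{-1}g\rangle$. For $w\notin\operatorname{spec}(S_{\pi/2})$, $R_{\pi/2}(w)$ has a unique bounded extension $\hat{R}_{\pi/2}(w):\mathcal{B}_{-2}^{(\pi/2)}\to\mathcal{B}$. The pairing $\langle\cdot,\cdot\rangle_2:\mathcal{B}_{-2}^{(\pi/2)}\times\mathcal{B}_{+2}^{(\pi/2)}\to\mathbb{C}$ is $\langle\varphi,g\rangle_2=\langle\hat{R}_{\pi/2}(-i)\varphi,(S_{\pi/2}-iI)g\rangle$, which extends the inner product of $\mathcal{B}$. $\mathcal{F}_{+1}$ is $\operatorname{dom}(S^* )$ with the graph inner product $\langle S^*f,S^*g\rangle+\langle f,g\rangle$; its dual $\mathcal{F}_{-1}$ is the completion of $\mathcal{B}$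 in the dual norm, and $\langle\cdot,\cdot\rangle_{\mathcal{F}}:\mathcal{F}_{-1}\times\mathcal{F}_{+1}\to\mathbb{C}$ is the continuous extension of the inner product of $\mathcal{B}$, with $\langle f,\phi\rangle_{\mathcal{F}}:=\overline{\langle\phi,f\rangle_{\mathcal{F}}}$ for $f\in\mathcal{F}_{+1},\phi\in\mathcal{F}_{-1}$. The map sending $\psi\in\mathcal{F}_{-1}$ to $f(z)=\langle k(\cdot,z),\psi\rangle_{\mathcal{F}}$ is a bijection onto $\operatorname{assoc}\mathcal{B}$, by which $\mathcal{F}_{-1}$ and $\operatorname{assoc}\mathcal{B}$ are identified. An element $f\in\operatorname{assoc}\mathcal{B}$ (in particular $s_0$), corresponding to $\psi\in\mathcal{F}_{-1}$, is regarded as the element of $\mathcal{B}_{-2}^{(\pi/2)}$ given by $\langle f,h\rangle_2:=\langle\psi,h\rangle_{\mathcal{F}}$, $h\in\operatorname{dom}(S_{\pi/2})$. *)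

(* Defs.v *)
From HB Require Import structures.
From mathcomp Require Import all_boot all_order all_algebra.
From mathcomp Require Import all_classical all_reals all_analysis.
From mathcomp Require Export complex.

Set Implicit Arguments.
Unset Strict Implicit.
Unset Printing Implicit Defensive.

Import Order.TTheory GRing.Theory Num.Theory.
Import numFieldNormedType.Exports.
Import ComplexField.

Local Open Scope classical_set_scope.
Local Open Scope ring_scope.
Local Open Scope complex_scope.

Definition entire (R : realType) (f : R[i] -> R[i]) : Prop :=
  forall z : R[i], derivable (f : R[i]^o -> R[i]^o) z 1.

Definition sharp (R : realType) (f : R[i] -> R[i]) : R[i] -> R[i] :=
  fun z => (f z^*)^*.

(* An isolated singularity in a formula such as h(z)/(z-w) is meant to be
   removed, whereas in Rocq h w / (w - w) = 0; hence the multiplicative form. *)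
Definition entire_quotient (R : realType) (w : R[i]) (h g : R[i] -> R[i]) :
    Prop :=
  entire g /\ forall z, (z - w) * g z = h z.

(* The arguments [B] and [ip] are the carrier and the inner product of a space
   of functions; [ip] is only meaningful on [B], and is linear on the right. *)
Definition ip_norm (R : realType)
    (ip : (R[i] -> R[i]) -> (R[i] -> R[i]) -> R[i]) (f : R[i] -> R[i]) : R[i] :=
  sqrtC (ip f f).

Record hilbert_space_of_entire_functions (R : realType)
    (B : set (R[i] -> R[i]))
    (ip : (R[i] -> R[i]) -> (R[i] -> R[i]) -> R[i]) : Prop := {
  hs_entire : forall f, B f -> entire f ;
  hs_zero : B 0 ;
  hs_linear : forall (a : R[i]) f g, B f -> B g -> B (a *: f + g) ;
  hs_ip_linear : forall (a : R[i]) f g h, B f -> B g -> B h ->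
    ip f (a *: g + h) = a * ip f g + ip f h ;
  hs_ip_sym : forall f g, B f -> B g -> ip f g = (ip g f)^* ;
  hs_ip_ge0 : forall f, B f -> 0 <= ip f f ;
  hs_ip_def : forall f, B f -> ip f f = 0 -> f = 0 ;
  hs_complete : forall u : nat -> (R[i] -> R[i]),
    (forall n, B (u n)) ->
    (forall eps : R, 0 < eps -> exists N, forall m n, (N <= m)%N -> (N <= n)%N ->
      ip_norm ip (u m - u n) < eps%:C) ->
    exists2 f, B f & forall eps : R, 0 < eps -> exists N, forall n, (N <= n)%N ->
      ip_norm ip (u n - f) < eps%:C }.

Definition reproducing_kernel (R : realType) (B : set (R[i] -> R[i]))
    (ip : (R[i] -> R[i]) -> (R[i] -> R[i]) -> R[i]) (k : R[i] -> R[i] -> R[i]) :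
    Prop :=
  forall w, B (k^~ w) /\ forall f, B f -> f w = ip (k^~ w) f.

Record deBranges_space (R : realType) (B : set (R[i] -> R[i]))
    (ip : (R[i] -> R[i]) -> (R[i] -> R[i]) -> R[i]) : Prop := {
  dB_hilbert : hilbert_space_of_entire_functions B ip ;
  dB_kernel : exists k, reproducing_kernel B ip k ;
  dB_sharp : forall f, B f ->
    B (sharp f) /\ ip_norm ip (sharp f) = ip_norm ip f ;
  dB_division : forall f w, B f -> complex.Im w != 0 -> f w = 0 ->
    exists2 g, entire_quotient w (fun z => (z - w^*) * f z) g &
      B g /\ ip_norm ip g = ip_norm ip f }.

Definition hermite_biehler (R : realType) (e : R[i] -> R[i]) : Prop :=
  entire e /\ forall z : R[i], 0 < complex.Im z -> `|e z^*| < `|e z|.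

Definition hardy2 (R : realType) (F : R[i] -> R[i]) : Prop :=
  (forall z : R[i], 0 < complex.Im z -> derivable (F : R[i]^o -> R[i]^o) z 1) /\
  exists M : R, forall y : R, 0 < y ->
    (\int[lebesgue_measure]_x ((Normc.normc (F (x +i* y)) ^+ 2)%:E) <= M%:E)%E.

Definition complex_integral (R : realType) (f : R -> R[i]) : R[i] :=
  (\int[lebesgue_measure]_x complex.Re (f x)) +i* (\int[lebesgue_measure]_x complex.Im (f x)).

Definition space_of (R : realType) (e : R[i] -> R[i]) : set (R[i] -> R[i]) :=
  [set f | [/\ entire f, hardy2 (fun z => f z / e z) &
               hardy2 (fun z => sharp f z / e z)]].

Definition ip_of (R : realType) (e f g : R[i] -> R[i]) : R[i] :=
  complex_integral (fun x => (f x%:C)^* * g x%:C / `|e x%:C| ^+ 2).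

Definition expi (R : realType) (t : R) : R[i] := cos t +i* sin t.

Definition s_ (R : realType) (e : R[i] -> R[i]) (gamma : R) : R[i] -> R[i] :=
  fun z => 'i / 2 * (expi gamma * e z - expi (- gamma) * sharp e z).

(* A possibly unbounded operator is represented by its graph. *)
Definition graph (R : realType) := (R[i] -> R[i]) -> (R[i] -> R[i]) -> Prop.

Definition dom (R : realType) (T : graph R) : set (R[i] -> R[i]) :=
  [set f | exists g, T f g].

(* [ap T f] is T f for [f] in the domain of a single-valued graph, and 0 outside
   the domain. *)
Definition ap (R : realType) (T : graph R) (f : R[i] -> R[i]) : R[i] -> R[i] :=
  xget (0 : R[i] -> R[i]) [set g | T f g].

Definition inverse_op (R : realType) (T : graph R) : graph R :=
  fun f g => T g f.

Definition minus_scalar (R : realType) (T : graph R) (w : R[i]) : graph R :=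
  fun f g => exists2 h, T f h & g = h - w *: f.

Definition square_plus_one (R : realType) (T : graph R) : graph R :=
  fun f g => exists f1 f2, [/\ T f f1, T f1 f2 & g = f2 + f].

Definition adjoint (R : realType) (B : set (R[i] -> R[i]))
    (ip : (R[i] -> R[i]) -> (R[i] -> R[i]) -> R[i]) (T : graph R) : graph R :=
  fun g h => [/\ B g, B h & forall f f', T f f' -> ip h f = ip g f'].

Definition resolvent (R : realType) (T : graph R) (w : R[i])
    (f : R[i] -> R[i]) : R[i] -> R[i] :=
  ap (inverse_op (minus_scalar T w)) f.

Definition resolvent_set (R : realType) (B : set (R[i] -> R[i]))
    (ip : (R[i] -> R[i]) -> (R[i] -> R[i]) -> R[i]) (T : graph R) :
    set R[i] :=
  [set w | (forall f, B f ->
              exists! g, inverse_op (minus_scalar T w) f g) /\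
           exists M : R, forall f, B f ->
              ip_norm ip (resolvent T w f) <= M%:C * ip_norm ip f].

Definition spec (R : realType) (B : set (R[i] -> R[i]))
    (ip : (R[i] -> R[i]) -> (R[i] -> R[i]) -> R[i]) (T : graph R) :
    set R[i] :=
  ~` resolvent_set B ip T.

Definition mult_op (R : realType) (B : set (R[i] -> R[i])) : graph R :=
  fun f g => [/\ B f, B g & forall z, g z = z * f z].

Definition densely_defined (R : realType) (B : set (R[i] -> R[i]))
    (ip : (R[i] -> R[i]) -> (R[i] -> R[i]) -> R[i]) (T : graph R) : Prop :=
  forall f, B f -> forall eps : R, 0 < eps ->
    exists2 g, dom T g & ip_norm ip (f - g) < eps%:C.

Definition canonical_extension (R : realType) (B : set (R[i] -> R[i]))
    (e : R[i] -> R[i]) (w : R[i]) (gamma : R) : graph R :=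
  fun g h => exists2 f, B f &
    entire_quotient w (fun z => f z - s_ e gamma z / s_ e gamma w * f w) g /\
    forall z, h z = z * g z + f w * (s_ e gamma z / s_ e gamma w).

Definition graph_ip (R : realType)
    (ip : (R[i] -> R[i]) -> (R[i] -> R[i]) -> R[i]) (T : graph R)
    (f g : R[i] -> R[i]) : R[i] :=
  ip (ap T f) (ap T g) + ip f g.

(* The norm of the functional <f, .> on dom(T) with the graph inner product. *)
Definition dual_graph_norm (R : realType)
    (ip : (R[i] -> R[i]) -> (R[i] -> R[i]) -> R[i]) (T : graph R)
    (f : R[i] -> R[i]) : R[i] :=
  (sup [set Normc.normc (ip f g) |
         g in [set g | dom T g /\ ip_norm (graph_ip ip T) g <= 1]])%:C.

Definition minus2_ip (R : realType)
    (ip : (R[i] -> R[i]) -> (R[i] -> R[i]) -> R[i]) (T : graph R)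
    (f g : R[i] -> R[i]) : R[i] :=
  ip f (ap (inverse_op (square_plus_one T)) g).

(* A Banach space with a given normed space [B] as a dense subspace, up to the
   isometric embedding [iota]. *)
Record is_completion (R : realType) (B : set (R[i] -> R[i]))
    (nrm : (R[i] -> R[i]) -> R[i]) (X : completeNormedModType R[i])
    (iota : (R[i] -> R[i]) -> X) : Prop := {
  compl_linear : forall (a : R[i]) f g, B f -> B g ->
    iota (a *: f + g) = a *: iota f + iota g ;
  compl_isometric : forall f, B f -> `|iota f| = nrm f ;
  compl_dense : dense (iota @` B) }.

Record is_bounded_extension (R : realType) (B : set (R[i] -> R[i]))
    (ip : (R[i] -> R[i]) -> (R[i] -> R[i]) -> R[i])
    (X : completeNormedModType R[i]) (iota : (R[i] -> R[i]) -> X)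
    (T : (R[i] -> R[i]) -> (R[i] -> R[i])) (That : X -> (R[i] -> R[i])) :
    Prop := {
  bext_mem : forall phi, B (That phi) ;
  bext_linear : forall (a : R[i]) phi chi,
    That (a *: phi + chi) = a *: That phi + That chi ;
  bext_bounded : exists M : R, forall phi,
    ip_norm ip (That phi) <= M%:C * `|phi| ;
  bext_extends : forall f, B f -> That (iota f) = T f }.

(* For fixed g in [D], [pairing . g] is the continuous extension of <. , g> from
   the dense subspace [B] to the completion. *)
Definition extends_inner_product (R : realType) (B D : set (R[i] -> R[i]))
    (ip : (R[i] -> R[i]) -> (R[i] -> R[i]) -> R[i])
    (X : completeNormedModType R[i]) (iota : (R[i] -> R[i]) -> X)
    (pairing : X -> (R[i] -> R[i]) -> R[i]) : Prop :=
  forall g, D g ->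
    continuous (fun phi => pairing phi g : R[i]^o) /\
    forall f, B f -> pairing (iota f) g = ip f g.

(* Main.v *)
Require Import Defs.
From HB Require Import structures.
From mathcomp Require Import all_boot all_order all_algebra.
From mathcomp Require Import all_classical all_reals all_analysis.
From mathcomp Require Import complex.
From mathcomp Require Import measurable_realfun ring lra.
Import Order.TTheory GRing.Theory Num.Theory.
Import numFieldNormedType.Exports.
Local Open Scope classical_set_scope.
Local Open Scope ring_scope.
Local Open Scope complex_scope.

(** Write s for s_{pi/2}, conj w for the conjugate of w, e# for the reflection of e,
    k_w for the reproducing kernel at w, and
    W(z, u) = s(z) s_0(u) - s_0(z) s(u). The theorem rests on the identity
      (z - conj w) k_w(z) = W(z, conj w) / pi        for every non-real w   [kernelE].

    Why the identity holds. For w in the upper half-plane the function K_w defined by it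
    satisfies, on the real line,
      conj K_w(x) f(x) / |e(x)|^2 =
        (e(w) f(x) / e(x) - e#(w) f(x) / e#(x)) / (2 pi i (x - w)),
    so its pairing with f is a difference of two Cauchy integrals. The first is f(w) by the
    Cauchy formula for f / e in the Hardy space [hardy_cauchy]; the second is zero, being the
    conjugate of a Cauchy integral at a point of the lower half-plane [hardy_cauchy_null].
    These formulas come from the theorem of Goursat on rectangles: the vertical sides
    vanish in the limit because the integrals over them are dominated by an integrable
    function of the abscissa [side_bound], and the horizontal side by the Hardy bound.
    A finite set of points where a function is only continuous is carried along, which
    makes difference quotients available before anything is known on power series. With
    it, the Cauchy formula itself shows that isolated singularities are removable
    [hardy_removable], hence that K_w is entire and belongs to the space. The number pi
    comes from the integral of 1 / (x^2 + 1).

    Resolvents. The resolvent of S_gamma at w sends f to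
    (f - f(w) s_gamma / s_gamma(w)) / (z - w), independently of the base point in the
    definition of S_gamma. By the Pluecker relation for W it sends k_v to a combination of
    k_v and the kernel at conj w [kernel_resolventP], and by the division axiom it is bounded
    [resolvent_exists]. Two of these formulas give [krein_difference]:
      R_gamma(w) f - R_{pi/2}(w) f = pi cos gamma f(w) / (s_gamma(w) s(w)) k_{conj w}.

    The element s_0. Pairing s_0 with the functions R_{pi/2}(i) k_v, which are combinations of
    kernels, determines the extended resolvent at - i on s_0; the resolvent identity, extended
    by density, then gives - pi / s(w) k_{conj w} for the extended resolvent at every non-real
    w [hat_sigma]. Inserting this in the difference of the resolvents, with
    s_gamma = cos gamma s_0 + sin gamma s, is the first formula. For the second one q is computed
    from the same data [q_value]; there S_{pi/2} has to be single valued, which holds because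
    the density of the domain of S keeps s out of the space [s_pi2_notin]. *)

Set Implicit Arguments.
Unset Strict Implicit.
Unset Printing Implicit Defensive.

(** * Modulus, continuity and complex differentiability *)

(** The modulus as a real number, so that it can be integrated and compared with
    real bounds. *)
Definition nc (R : realType) (z : R[i]) : R := Normc.normc z.

Section ComplexBasics.
Variable R : realType.
(* Inside ring operations the conjugation and the imaginary unit would be read
   as those of an abstract closed field; these notations pin the concrete ones. *)
Local Notation "x ^*" := (conjc x) : ring_scope.
Local Notation "''i'" := (Complex 0 1) : ring_scope.
Implicit Types (z w h : R[i]) (a b c d x y : R) (f g G : R[i] -> R[i]).

Lemma nc_norm z : `|z| = (nc z)%:C. Proof. by []. Qed.

Lemma nc_ge0 z : 0 <= nc z.
Proof. by rewrite -ler0c -nc_norm. Qed.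

Lemma nc0 : nc (0 : R[i]) = 0. Proof. exact: Normc.normc0. Qed.

Lemma nc1 : nc (1 : R[i]) = 1. Proof. exact: Normc.normc1. Qed.

Lemma ncM z w : nc (z * w) = nc z * nc w. Proof. exact: Normc.normcM. Qed.

Lemma ncV z : nc z^-1 = (nc z)^-1. Proof. exact: Normc.normcV. Qed.

Lemma ncN z : nc (- z) = nc z.
Proof. by apply/complexI; rewrite -!nc_norm normrN. Qed.

Lemma ncD z w : nc (z + w) <= nc z + nc w. Proof. exact: le_normcD. Qed.

Lemma ncB z w : nc (z - w) <= nc z + nc w.
Proof. by rewrite -(ncN w) ncD. Qed.

Lemma nc_subC z w : nc (z - w) = nc (w - z).
Proof. by rewrite -ncN opprB. Qed.

Lemma ncJ z : nc z^* = nc z.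
Proof. by apply/complexI; rewrite -!nc_norm normcJ. Qed.

Lemma nc_eq0 z : (nc z == 0) = (z == 0).
Proof.
by apply/idP/idP => [/eqP/Normc.eq0_normc ->//|/eqP ->]; rewrite nc0.
Qed.

Lemma nc_gt0 z : (0 < nc z) = (z != 0).
Proof. by rewrite lt_neqAle nc_ge0 andbT eq_sym nc_eq0. Qed.

Lemma sqr_nc z : nc z ^+ 2 = complex.Re z ^+ 2 + complex.Im z ^+ 2.
Proof. by case: z => a b /=; rewrite sqr_sqrtr// addr_ge0// sqr_ge0. Qed.

Lemma nc_real x : nc x%:C = `|x|.
Proof. by rewrite /= expr0n/= addr0 sqrtr_sqr. Qed.

Lemma normRe_nc z : `|complex.Re z| <= nc z.
Proof.
by rewrite -ler_sqr ?nnegrE ?nc_ge0// sqr_nc real_normK ?num_real// lerDl sqr_ge0.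
Qed.

Lemma normIm_nc z : `|complex.Im z| <= nc z.
Proof.
by rewrite -ler_sqr ?nnegrE ?nc_ge0// sqr_nc real_normK ?num_real// lerDr sqr_ge0.
Qed.

Lemma nc_le_ReIm z : nc z <= `|complex.Re z| + `|complex.Im z|.
Proof.
rewrite -ler_sqr ?nnegrE ?nc_ge0 ?addr_ge0// sqr_nc sqrrD !real_normK ?num_real//.
by rewrite addrAC lerDl mulrn_wge0// mulr_ge0.
Qed.

Lemma ReD z w : complex.Re (z + w) = complex.Re z + complex.Re w.
Proof. by case: z => a b; case: w. Qed.

Lemma ImD z w : complex.Im (z + w) = complex.Im z + complex.Im w.
Proof. by case: z => a b; case: w. Qed.

Lemma ReN z : complex.Re (- z) = - complex.Re z.
Proof. by case: z. Qed.

Lemma ImN z : complex.Im (- z) = - complex.Im z.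
Proof. by case: z. Qed.

Lemma ReM z w : complex.Re (z * w) =
  complex.Re z * complex.Re w - complex.Im z * complex.Im w.
Proof. by case: z => a b; case: w. Qed.

Lemma ImM z w : complex.Im (z * w) =
  complex.Re z * complex.Im w + complex.Im z * complex.Re w.
Proof. by case: z => a b; case: w. Qed.

Lemma ImJ z : complex.Im z^* = - complex.Im z.
Proof. by case: z. Qed.

Lemma ReJ z : complex.Re z^* = complex.Re z.
Proof. by case: z. Qed.

Lemma conjM z w : (z * w)^* = z^* * w^*. Proof. exact: rmorphM. Qed.

Lemma conjD z w : (z + w)^* = z^* + w^*. Proof. exact: rmorphD. Qed.

Lemma conjB z w : (z - w)^* = z^* - w^*. Proof. exact: rmorphB. Qed.

Lemma conjN z : (- z)^* = - z^*. Proof. exact: rmorphN. Qed.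

Lemma conjV z : (z^-1)^* = (z^*)^-1. Proof. exact: conjc_inv. Qed.

(** The definitions of the inner product and of division by z - w use the
    conjugation of the abstract closed field. *)
Lemma NconjE z : Num.conj z = z^*. Proof. by []. Qed.

Lemma eqC z w :
  complex.Re z = complex.Re w -> complex.Im z = complex.Im w -> z = w.
Proof. by case: z => a b; case: w => c d /= -> ->. Qed.

(** Continuity and differentiability in epsilon-delta form: the estimates below
    need the radius explicitly. *)
Definition ccont f z := forall eps : R, 0 < eps ->
  exists2 del : R, 0 < del & forall w, nc (w - z) < del -> nc (f w - f z) < eps.

Definition cderiv f z (d : R[i]) := forall eps : R, 0 < eps ->
  exists2 del : R, 0 < del &
    forall w, nc (w - z) < del ->
      nc (f w - f z - d * (w - z)) <= eps * nc (w - z).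

Definition cdiff f z := exists d : R[i], cderiv f z d.

Lemma cdiffP f z : derivable (f : R[i]^o -> R[i]^o) z 1 <-> cdiff f z.
Proof.
split => [df|[d fd]].
  pose D : R[i] := 'D_1 (f : R[i]^o -> R[i]^o) z; exists D => eps eps0.
  move: (df); rewrite /derivable => /cvgrPdist_le /(_ eps%:C).
  rewrite ltcR => /(_ eps0).
  rewrite near_withinE => -[[del di] /=]; rewrite ltcE/= => /andP[/eqP di0 del0] H.
  exists del => // w wz.
  have [->|nwz] := eqVneq w z; first by rewrite !subrr mulr0 !subr0 nc0 mulr0.
  have h0 : w - z != 0 by rewrite subr_eq0.
  have /= := H (w - z); rewrite sub0r normrN di0 => /(_ _ h0).
  rewrite ltcR => /(_ wz).
  have -> : @GRing.scale R[i] R[i]^o (w - z) 1 = w - z by exact: mulr1.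
  rewrite subrK.
  move=> Hle.
  have {}Hle : (nc (D - (w - z)^-1 * (f w - f z)))%:C <= eps%:C := Hle.
  rewrite lecR in Hle.
  have -> : f w - f z - D * (w - z) =
    - ((w - z) * (D - (w - z)^-1 * (f w - f z))).
    by field.
  by rewrite ncN ncM mulrC ler_wpM2r// nc_ge0.
apply/cvg_ex; exists d; apply/cvgrPdist_le => -[eps ei].
rewrite ltcE/= => /andP[/eqP -> eps0].
have [del del0 H] := fd _ eps0.
rewrite near_withinE; exists del%:C; first by rewrite /= ltcR.
move=> h /=; rewrite sub0r normrN nc_norm ltcR => hdel h0.
have := H (h + z); rewrite addrK => /(_ hdel).
have -> : @GRing.scale R[i] R[i]^o h 1 = h by exact: mulr1.
rewrite nc_norm lecR /= => Hle.
rewrite -(ler_pM2r (_ : 0 < nc h)) ?nc_gt0//; apply: le_trans Hle.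
rewrite -ncM -ncN mulrBl opprB mulrAC mulVf// mul1r.
by [].
Qed.

Lemma cdiff_ccont f z : cdiff f z -> ccont f z.
Proof.
move=> [d fd] eps eps0; have [del del0 H] := fd 1 ltr01.
have D0 : 0 < 1 + nc d by rewrite ltr_pwDl// nc_ge0.
exists (Num.min del (eps / (1 + nc d))); first by rewrite lt_min del0 divr_gt0.
move=> w; rewrite lt_min => /andP[wdel weps].
have -> : f w - f z = (f w - f z - d * (w - z)) + d * (w - z) by rewrite subrK.
apply: (le_lt_trans (ncD _ _)); apply: (le_lt_trans (lerD (H _ wdel) (lexx _))).
by rewrite ncM -mulrDl mulrC -ltr_pdivlMr.
Qed.

Lemma ccont_cst (a : R[i]) z : ccont (fun=> a) z.
Proof. by move=> eps eps0; exists 1 => // w _; rewrite subrr nc0. Qed.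

Lemma ccontD f g z : ccont f z -> ccont g z -> ccont (fun w => f w + g w) z.
Proof.
move=> fz gz eps eps0; have e20 : 0 < eps / 2 by rewrite divr_gt0.
have [d1 d10 H1] := fz _ e20; have [d2 d20 H2] := gz _ e20.
exists (Num.min d1 d2); first by rewrite lt_min d10.
move=> w; rewrite lt_min => /andP[w1 w2].
rewrite opprD addrACA (le_lt_trans (ncD _ _))//.
by rewrite [ltRHS]splitr ltrD ?H1 ?H2.
Qed.

Lemma ccontM f g z : ccont f z -> ccont g z -> ccont (fun w => f w * g w) z.
Proof.
move=> fz gz eps eps0; set D := 1 + nc (f z) + nc (g z).
have D0 : 0 < D by rewrite /D -addrA ltr_pwDl// addr_ge0// nc_ge0.
set eta := Num.min 1 (eps / D).
have eta0 : 0 < eta by rewrite lt_min ltr01 divr_gt0.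
have [d1 d10 H1] := fz _ eta0; have [d2 d20 H2] := gz _ eta0.
exists (Num.min d1 d2); first by rewrite lt_min d10.
move=> w; rewrite lt_min => /andP[/H1 w1 /H2 w2].
have -> : f w * g w - f z * g z = (f w - f z) * (g w - g z) +
  f z * (g w - g z) + (f w - f z) * g z by ring.
apply: (@lt_le_trans _ _ (eta * D)); last first.
  by rewrite -ler_pdivlMr// ge_min lexx orbT.
rewrite (le_lt_trans (ncD _ _))// (le_lt_trans (lerD (ncD _ _) (lexx _)))//.
rewrite !ncM /D !mulrDr mulr1 -!addrA.
have le1 : eta <= 1 by rewrite ge_min lexx.
have p1 : nc (f w - f z) * nc (g w - g z) < eta.
  rewrite -[ltRHS]mulr1 ltr_pM// ?nc_ge0//; exact: lt_le_trans w2 le1.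
apply: ltr_leD => //; apply: lerD.
- by rewrite mulrC ler_wpM2r ?nc_ge0// ltW.
- by rewrite ler_wpM2r ?nc_ge0// ltW.
Qed.

Lemma punctured_point z (del : R) : 0 < del ->
  exists2 w, nc (w - z) < del & w != z.
Proof.
move=> del0; have d20 : 0 < del / 2 by rewrite divr_gt0.
exists (z + (del / 2)%:C).
  by rewrite addrAC subrr add0r nc_real gtr0_norm// ltr_pdivrMr// ltr_pMr// ltr1n.
by rewrite -subr_eq0 addrAC subrr add0r -nc_eq0 nc_real normr_eq0 gt_eqF.
Qed.

(** Two continuous functions that agree at points arbitrarily close to z agree at
    z; this fills in the values at removable singularities and on the real line. *)
Lemma ccont_dense_eq f g z : ccont f z -> ccont g z ->
  (forall del : R, 0 < del -> exists2 w, nc (w - z) < del & f w = g w) ->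
  f z = g z.
Proof.
move=> cf cg H; apply/eqP; rewrite -subr_eq0 -nc_eq0 -normr_le0.
rewrite ger0_norm ?nc_ge0//.
apply/ler_addgt0Pr => eps eps0; rewrite add0r.
have e20 : 0 < eps / 2 by rewrite divr_gt0.
have [d1 d10 H1] := cf _ e20; have [d2 d20 H2] := cg _ e20.
have [|w] := H (Num.min d1 d2); first by rewrite lt_min d10.
rewrite lt_min => /andP[w1 w2] E.
have -> : f z - g z = (g w - g z) - (f w - f z) by rewrite E; ring.
rewrite (le_trans (ncB _ _))// [leRHS]splitr lerD// ltW//; [exact: H2|exact: H1].
Qed.

Lemma cdiff_cst (a : R[i]) z : cdiff (fun=> a) z.
Proof. by apply/cdiffP; exact: derivable_cst. Qed.

Lemma cdiff_id z : cdiff id z.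
Proof. by apply/cdiffP; exact: derivable_id. Qed.

Lemma cdiffD f g z : cdiff f z -> cdiff g z -> cdiff (fun w => f w + g w) z.
Proof. by move=> /cdiffP fz /cdiffP gz; apply/cdiffP; exact: derivableD. Qed.

Lemma cdiffN f z : cdiff f z -> cdiff (fun w => - f w) z.
Proof. by move=> /cdiffP fz; apply/cdiffP; exact: derivableN. Qed.

Lemma cdiffB f g z : cdiff f z -> cdiff g z -> cdiff (fun w => f w - g w) z.
Proof. by move=> fz gz; apply: cdiffD => //; exact: cdiffN. Qed.

Lemma cdiffM f g z : cdiff f z -> cdiff g z -> cdiff (fun w => f w * g w) z.
Proof.
move=> [df fz] [dg gz]; exists (df * g z + f z * dg) => eps eps0.
set D := 1 + (nc (g z) + (nc df + nc (f z))).
have D0 : 0 < D by rewrite ltr_pwDl// !addr_ge0// nc_ge0.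
set eta := Num.min 1 (eps / D).
have eta0 : 0 < eta by rewrite lt_min ltr01 divr_gt0.
have [d1 d10 H1] := fz _ eta0; have [d2 d20 H2] := gz _ eta0.
have [d3 d30 H3] := cdiff_ccont (ex_intro _ dg gz) eta0.
exists (Num.min d1 (Num.min d2 d3)); first by rewrite !lt_min d10 d20.
move=> w; rewrite !lt_min => /and3P[/H1 w1 /H2 w2 /H3 w3].
have -> : f w * g w - f z * g z - (df * g z + f z * dg) * (w - z) =
  (f w - f z - df * (w - z)) * (g w - g z) +
  (f w - f z - df * (w - z)) * g z +
  df * (w - z) * (g w - g z) + f z * (g w - g z - dg * (w - z)) by ring.
apply: (@le_trans _ _ (eta * D * nc (w - z))); last first.
  by rewrite ler_wpM2r ?nc_ge0// -ler_pdivlMr// ge_min lexx orbT.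
rewrite (le_trans (ncD _ _))// (le_trans (lerD (ncD _ _) (lexx _)))//.
rewrite (le_trans (lerD (lerD (ncD _ _) (lexx _)) (lexx _)))//.
have le1 : eta <= 1 by rewrite ge_min lexx.
have h0 := nc_ge0 (w - z); have g0 := nc_ge0 (g w - g z).
have a0 := nc_ge0 (f w - f z - df * (w - z)).
have b0 := nc_ge0 (g w - g z - dg * (w - z)).
have gz0 := nc_ge0 (g z); have fz0 := nc_ge0 (f z); have df0 := nc_ge0 df.
rewrite !ncM /D; have {}w3 := ltW w3.
have t1 : nc (f w - f z - df * (w - z)) * nc (g w - g z) <= eta * nc (w - z) * 1.
  by rewrite ler_pM// (le_trans w3).
have t2 := ler_wpM2r gz0 w1.
have t3 := ler_wpM2l (mulr_ge0 df0 h0) w3.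
have t4 := ler_wpM2l fz0 w2.
apply: (le_trans (lerD (lerD (lerD t1 t2) t3) t4)).
by rewrite le_eqVlt; apply/orP; left; apply/eqP; ring.
Qed.

Lemma cdiffV f z : f z != 0 -> cdiff f z -> cdiff (fun w => (f w)^-1) z.
Proof.
move=> f0 fz; have fc := cdiff_ccont fz; case: fz => df fz.
exists (- df / f z ^+ 2) => eps eps0.
have n0 : 0 < nc (f z) by rewrite nc_gt0.
set D := (1 + (nc (f z) + nc df)) * 2 / nc (f z) ^+ 3.
have D1 : 0 < 1 + (nc (f z) + nc df) by rewrite ltr_pwDl// !addr_ge0// nc_ge0.
have D0 : 0 < D by rewrite divr_gt0 ?exprn_gt0// mulr_gt0.
have eta0 : 0 < eps / D by rewrite divr_gt0.
have [d1 d10 H1] := fz _ eta0; have [d2 d20 H2] := fc _ eta0.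
have n20 : 0 < nc (f z) / 2 by rewrite divr_gt0.
have [d3 d30 H3] := fc _ n20.
exists (Num.min d1 (Num.min d2 d3)); first by rewrite !lt_min d10 d20.
move=> w; rewrite !lt_min => /and3P[/H1 w1 /H2 w2 /H3 w3].
have fw : nc (f z) / 2 <= nc (f w).
  have := ncB (f w) (f w - f z); rewrite subKr => H.
  rewrite -(lerD2r (nc (f z) / 2)) -splitr (le_trans H)// lerD2l.
  exact: ltW.
have fw0 : f w != 0 by rewrite -nc_gt0 (lt_le_trans _ fw).
have -> : (f w)^-1 - (f z)^-1 - - df / f z ^+ 2 * (w - z) =
  (- (f w - f z - df * (w - z)) * f z + df * (w - z) * (f w - f z))
   / (f w * f z ^+ 2).
  by field; rewrite f0.
rewrite ncM ncV ler_pdivrMr; last by rewrite nc_gt0 mulf_neq0// expf_neq0.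
apply: (le_trans (ncD _ _)); rewrite !ncM ncN.
have h0 := nc_ge0 (w - z); have fz0 := nc_ge0 (f z); have df0 := nc_ge0 df.
have t1 := ler_wpM2r fz0 w1.
have t2 := ler_wpM2l (mulr_ge0 df0 h0) (ltW w2).
apply: (le_trans (lerD t1 t2)).
have -> : eps / D * nc (w - z) * nc (f z) + nc df * nc (w - z) * (eps / D) =
  eps * nc (w - z) * ((nc (f z) + nc df) / D) by ring.
rewrite ler_wpM2l ?mulr_ge0 ?(ltW eps0)//.
apply: (@le_trans _ _ (nc (f z) / 2 * nc (f z) ^+ 2)); last first.
  by rewrite expr2 ler_wpM2r ?mulr_ge0.
rewrite ler_pdivrMr// /D.
have -> : nc (f z) / 2 * nc (f z) ^+ 2 *
   ((1 + (nc (f z) + nc df)) * 2 / nc (f z) ^+ 3) = 1 + (nc (f z) + nc df).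
  by field; rewrite gt_eqF.
by rewrite lerDr.
Qed.

Lemma cdiff_eq f g z r : 0 < r -> (forall w, nc (w - z) < r -> f w = g w) ->
  cdiff f z -> cdiff g z.
Proof.
move=> r0 fg [d fd]; exists d => eps /fd[del del0 H].
exists (Num.min r del); first by rewrite lt_min r0.
move=> w; rewrite lt_min => /andP[wr wdel].
by rewrite -fg// -(fg z) ?H// subrr nc0.
Qed.

Lemma ccont_eq f g z r : 0 < r -> (forall w, nc (w - z) < r -> f w = g w) ->
  ccont f z -> ccont g z.
Proof.
move=> r0 fg fd eps /fd[del del0 H].
exists (Num.min r del); first by rewrite lt_min r0.
move=> w; rewrite lt_min => /andP[wr wdel].
by rewrite -fg// -(fg z) ?H// subrr nc0.
Qed.

Lemma sharpK f : sharp (sharp f) = f.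
Proof. by apply/funext => z; rewrite /sharp !conjcK. Qed.

Lemma cdiff_sharp f z : cdiff f z^* -> cdiff (sharp f) z.
Proof.
move=> [d fd]; exists d^* => eps /fd[del del0 H]; exists del => // w wz.
have E : nc (w^* - z^*) = nc (w - z) by rewrite -rmorphB ncJ.
rewrite /sharp (_ : _ - _ - _ = (f w^* - f z^* - d * (w^* - z^*))^*).
  by rewrite ncJ -E H// E.
by rewrite !rmorphB rmorphM rmorphB /= !conjcK.
Qed.

(** Along a curve that moves no faster than its parameter, a continuous complex
    function has continuous real and imaginary parts. *)
Lemma ccont_line G (f : R -> R[i]) (x : R) :
  (forall x', nc (f x' - f x) <= `|x' - x|) -> ccont G (f x) ->
  {for x, continuous (fun x' => complex.Re (G (f x')))} /\
  {for x, continuous (fun x' => complex.Im (G (f x')))}.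
Proof.
move=> fx Gx; split; apply/cvgrPdist_lt => eps /Gx[del del0 H];
  exists del => //= y /=; rewrite distrC => xy.
- rewrite -ReN -ReD (le_lt_trans (normRe_nc _))// nc_subC H//.
  exact: le_lt_trans (fx _) xy.
- rewrite -ImN -ImD (le_lt_trans (normIm_nc _))// nc_subC H//.
  exact: le_lt_trans (fx _) xy.
Qed.

Lemma nc_hline (x x' c : R) : nc ((x' +i* c) - (x +i* c)) <= `|x' - x|.
Proof. by rewrite /= subrr expr0n/= addr0 sqrtr_sqr. Qed.

Lemma nc_vline (x x' c : R) : nc ((c +i* x') - (c +i* x)) <= `|x' - x|.
Proof. by rewrite /= subrr expr0n/= add0r sqrtr_sqr. Qed.

End ComplexBasics.

(** * The theorem of Goursat on rectangles *)

Section Goursat.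
Variable R : realType.
Local Notation "x ^*" := (conjc x) : ring_scope.
Local Notation "''i'" := (Complex 0 1) : ring_scope.
Implicit Types (z w : R[i]) (a b c d x y : R) (G : R[i] -> R[i]).
Local Notation mu := (@lebesgue_measure R).

Definition seg_int (f : R -> R) (a b : R) : R := \int[mu]_(x in `[a, b]) f x.

Definition cont_on (f : R -> R) a b :=
  forall x, a <= x <= b -> {for x, continuous f}.

Lemma cont_on_integrable f a b : cont_on f a b ->
  mu.-integrable `[a, b] (EFin \o f).
Proof.
move=> cf; apply: continuous_compact_integrable; first exact: segment_compact.
apply: continuous_in_subspaceT => x; rewrite inE/= in_itv/= => abx.
exact: cf.
Qed.

Lemma seg_int_split f a m b : a <= m -> m <= b -> cont_on f a b ->
  seg_int f a b = seg_int f a m + seg_int f m b.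
Proof.
move=> am mb cf; have intf := cont_on_integrable cf.
apply/eqP; rewrite addrC -subr_eq /seg_int.
rewrite Rintegral_itvB ?bnd_simp//.
rewrite Rintegral_itv_obnd_cbnd//.
apply: integrableS intf => //.
by apply: subset_itvr; rewrite bnd_simp.
Qed.

Lemma seg_intxx f a : seg_int f a a = 0.
Proof. by rewrite /seg_int set_itv1 Rintegral_set1. Qed.

Lemma seg_int_cst (k : R) a b : a <= b -> seg_int (fun=> k) a b = k * (b - a).
Proof.
move=> ab; rewrite /seg_int Rintegral_cst//=. rewrite lebesgue_measure_itv/= lte_fin.
have [//|ba] := ltP a b.
by rewrite (le_anti (introT andP (conj ab ba))) subrr.
Qed.

Lemma seg_int_near f (k eta : R) a b : a <= b -> cont_on f a b ->
  (forall x, a <= x <= b -> `|f x - k| <= eta) ->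
  `|seg_int f a b - k * (b - a)| <= eta * (b - a).
Proof.
move=> ab cf H.
have ck : cont_on (fun=> k) a b by move=> x _; exact: cst_continuous.
rewrite -(seg_int_cst _ ab) -(seg_int_cst _ ab) /seg_int.
have ik := cont_on_integrable ck; have iff := cont_on_integrable cf.
rewrite -RintegralB//; apply: (le_trans (le_normr_Rintegral _ _)) => //.
  exact: (integrableB _ iff ik).
apply: le_Rintegral => //.
- apply: integrable_norm.
  exact: (integrableB _ iff ik).
- apply: cont_on_integrable => x _; exact: cst_continuous.
Qed.

Definition in_rect a b c d z :=
  (a <= complex.Re z <= b) && (c <= complex.Im z <= d).

(** The real part of the contour integral over the boundary of the rectangle.
    Applied to i G it gives the imaginary part, so the real part is enough. *)
Definition rect_int G a b c d : R :=
  seg_int (fun x => complex.Re (G (x +i* c))) a b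
  - seg_int (fun x => complex.Re (G (x +i* d))) a b
  - (seg_int (fun y => complex.Im (G (b +i* y))) c d
     - seg_int (fun y => complex.Im (G (a +i* y))) c d).

Definition cont_rect G a b c d := forall z, in_rect a b c d z -> ccont G z.

Lemma in_rect_sub a b c d a' b' c' d' z :
  a <= a' -> b' <= b -> c <= c' -> d' <= d ->
  in_rect a' b' c' d' z -> in_rect a b c d z.
Proof.
move=> aa bb cc dd /andP[/andP[h1 h2] /andP[h3 h4]].
rewrite /in_rect (le_trans aa h1) (le_trans h2 bb).
by rewrite (le_trans cc h3) (le_trans h4 dd).
Qed.

Lemma cont_rect_hline G a b c d y : cont_rect G a b c d -> c <= y <= d ->
  cont_on (fun x => complex.Re (G (x +i* y))) a b.
Proof.
move=> cG cyd x axb; apply: (proj1 (@ccont_line _ G (fun t => t +i* y) x _ _)).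
  by move=> x'; exact: nc_hline.
by apply: cG; rewrite /in_rect axb cyd.
Qed.

Lemma cont_rect_vline G a b c d x : cont_rect G a b c d -> a <= x <= b ->
  cont_on (fun y => complex.Im (G (x +i* y))) c d.
Proof.
move=> cG axb y cyd; apply: (proj2 (@ccont_line _ G (fun t => x +i* t) y _ _)).
  by move=> x'; exact: nc_vline.
by apply: cG; rewrite /in_rect axb cyd.
Qed.

Lemma rect_int_splith G a m b c d : a <= m -> m <= b -> c <= d ->
  cont_rect G a b c d ->
  rect_int G a b c d = rect_int G a m c d + rect_int G m b c d.
Proof.
move=> am mb cd cG; rewrite /rect_int.
rewrite !(seg_int_split am mb); last 2 first.
- by apply: (cont_rect_hline cG); rewrite cd lexx.
- by apply: (cont_rect_hline cG); rewrite cd lexx.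
by ring.
Qed.

Lemma rect_int_splitv G a b c m d : a <= b -> c <= m -> m <= d ->
  cont_rect G a b c d ->
  rect_int G a b c d = rect_int G a b c m + rect_int G a b m d.
Proof.
move=> ab cm md cG; rewrite /rect_int.
rewrite !(seg_int_split cm md); last 2 first.
- by apply: (cont_rect_vline cG); rewrite ab lexx.
- by apply: (cont_rect_vline cG); rewrite ab lexx.
by ring.
Qed.

Lemma cont_rect_sub G a b c d a' b' c' d' :
  a <= a' -> b' <= b -> c <= c' -> d' <= d ->
  cont_rect G a b c d -> cont_rect G a' b' c' d'.
Proof. by move=> aa bb cc dd cG z hz; apply/cG/(in_rect_sub aa bb cc dd). Qed.

(** A contour integral does not see the affine function p + q z, so it is as
    small as the distance from G to that function allows. *)
Lemma rect_int_near G (p q : R[i]) (eta : R) a b c d : a <= b -> c <= d ->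
  cont_rect G a b c d ->
  (forall z, in_rect a b c d z -> nc (G z - (p + q * z)) <= eta) ->
  `|rect_int G a b c d| <= 2 * eta * ((b - a) + (d - c)).
Proof.
move=> ab cd cG H; pose L z := p + q * z.
have hor y : c <= y <= d -> forall x, a <= x <= b ->
    `|complex.Re (G (x +i* y)) - complex.Re (L (x +i* y))| <= eta.
  move=> cyd x axb; rewrite -ReN -ReD (le_trans (normRe_nc _))// H//.
  by rewrite /in_rect axb cyd.
have ver x : a <= x <= b -> forall y, c <= y <= d ->
    `|complex.Im (G (x +i* y)) - complex.Im (L (x +i* y))| <= eta.
  move=> axb y cyd; rewrite -ImN -ImD (le_trans (normIm_nc _))// H//.
  by rewrite /in_rect axb cyd.
have ca : c <= c <= d by rewrite lexx.
have da : c <= d <= d by rewrite lexx andbT.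
have aa : a <= a <= b by rewrite lexx.
have ba : a <= b <= b by rewrite lexx andbT.
have cL : cont_rect L a b c d.
  by move=> z _; apply: ccontD; [exact: ccont_cst|apply: ccontM;
    [exact: ccont_cst|exact/cdiff_ccont/cdiff_id]].
have subint f g u v : u <= v -> cont_on f u v -> cont_on g u v ->
    (forall x, u <= x <= v -> `|f x - g x| <= eta) ->
    `|seg_int f u v - seg_int g u v| <= eta * (v - u).
  move=> uv cf cg fg; have := @seg_int_near (f \- g) 0 eta u v uv.
  rewrite mul0r subr0 /seg_int RintegralB//; try exact: cont_on_integrable.
  apply=> x uxv; first by apply: cvgB; [exact: cf|exact: cg].
  by rewrite subr0 fg.
have L0 : rect_int L a b c d = 0.
  rewrite /rect_int /L.
  have -> : (fun y => complex.Im (p + q * (b +i* y))) =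
            (fun y => complex.Im q * (b - a) + complex.Im (p + q * (a +i* y))).
    by apply/funext => y; rewrite !(ImD, ImM)/=; ring.
  have -> : (fun x => complex.Re (p + q * (x +i* c))) =
            (fun x => complex.Im q * (d - c) + complex.Re (p + q * (x +i* d))).
    by apply/funext => y; rewrite !(ReD, ReM)/=; ring.
  have addc f k u v : u <= v -> cont_on f u v ->
      seg_int (fun x => k + f x) u v = k * (v - u) + seg_int f u v.
    move=> uv cf; rewrite -seg_int_cst// /seg_int RintegralD//.
    - by apply: cont_on_integrable => x _; exact: cst_continuous.
    - exact: cont_on_integrable.
  rewrite addc//; last exact: (cont_rect_hline cL).
  rewrite addc//; last exact: (cont_rect_vline cL).
  by ring.
have -> : rect_int G a b c d = rect_int G a b c d - rect_int L a b c d.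
  by rewrite L0 subr0.
rewrite /rect_int.
have h1 := subint _ _ _ _ ab (cont_rect_hline cG ca) (cont_rect_hline cL ca) (hor _ ca).
have h2 := subint _ _ _ _ ab (cont_rect_hline cG da) (cont_rect_hline cL da) (hor _ da).
have h3 := subint _ _ _ _ cd (cont_rect_vline cG aa) (cont_rect_vline cL aa) (ver _ aa).
have h4 := subint _ _ _ _ cd (cont_rect_vline cG ba) (cont_rect_vline cL ba) (ver _ ba).
move: h1 h2 h3 h4; rewrite !ler_norml => /andP[? ?] /andP[? ?] /andP[? ?] /andP[? ?].
apply/andP; split; lra.
Qed.

(** A rectangle obtained after n bisections that still carries its share of the
    contour integral. *)
Definition quarter_bad G (w h e0 : R) n (p : R * R) :=
  e0 / 4 ^+ n <= `|rect_int G p.1 (p.1 + w / 2 ^+ n) p.2 (p.2 + h / 2 ^+ n)|.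

(** The four quarters add up to the rectangle, so one of them carries at least a
    quarter of the integral. *)
Lemma quarter_step G (w h e0 : R) n (p : R * R) : 0 <= w -> 0 <= h ->
  cont_rect G p.1 (p.1 + w / 2 ^+ n) p.2 (p.2 + h / 2 ^+ n) ->
  quarter_bad G w h e0 n p ->
  exists2 q : R * R, quarter_bad G w h e0 n.+1 q &
    [/\ p.1 <= q.1, q.1 + w / 2 ^+ n.+1 <= p.1 + w / 2 ^+ n,
        p.2 <= q.2 & q.2 + h / 2 ^+ n.+1 <= p.2 + h / 2 ^+ n].
Proof.
case: p => a c /= w0 h0 cG bad.
have pn : 0 < 2 ^+ n.+1 :> R by rewrite exprn_gt0.
have wE : w / 2 ^+ n = w / 2 ^+ n.+1 + w / 2 ^+ n.+1.
  by rewrite exprS; field; rewrite expf_neq0.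
have hE : h / 2 ^+ n = h / 2 ^+ n.+1 + h / 2 ^+ n.+1.
  by rewrite exprS; field; rewrite expf_neq0.
have eE : e0 / 4 ^+ n = (e0 / 4 ^+ n.+1) *+ 4.
  by rewrite exprS; field; rewrite expf_neq0.
set W := w / 2 ^+ n.+1 in wE *; set H := h / 2 ^+ n.+1 in hE *.
have W0 : 0 <= W by rewrite divr_ge0// ltW.
have H0 : 0 <= H by rewrite divr_ge0// ltW.
have [aW aW2 cH cH2] : [/\ a <= a + W, a + W <= a + w / 2 ^+ n, c <= c + H &
    c + H <= c + h / 2 ^+ n] by rewrite wE hE; split; lra.
have aw : a <= a + w / 2 ^+ n by rewrite (le_trans aW).
have ch : c <= c + h / 2 ^+ n by rewrite (le_trans cH).
have E : rect_int G a (a + w / 2 ^+ n) c (c + h / 2 ^+ n) =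
   (rect_int G a (a + W) c (c + H) +
    rect_int G a (a + W) (c + H) (c + H + H)) +
   (rect_int G (a + W) (a + W + W) c (c + H) +
    rect_int G (a + W) (a + W + W) (c + H) (c + H + H)).
  rewrite (rect_int_splith aW aW2 ch cG).
  rewrite (rect_int_splitv aW cH cH2); last first.
    by apply: (cont_rect_sub _ _ _ _ cG) => //.
  rewrite (rect_int_splitv aW2 cH cH2); last first.
    by apply: (cont_rect_sub _ _ _ _ cG) => //.
  by rewrite wE hE !addrA.
have [b1|g1] := leP (e0 / 4 ^+ n.+1) `|rect_int G a (a + W) c (c + H)|.
  by exists (a, c) => //=; split.
have [b2|g2] := leP (e0 / 4 ^+ n.+1) `|rect_int G a (a + W) (c + H) (c + H + H)|.
  by exists (a, c + H) => //=; split => //; rewrite hE; lra.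
have [b3|g3] := leP (e0 / 4 ^+ n.+1) `|rect_int G (a + W) (a + W + W) c (c + H)|.
  by exists (a + W, c) => //=; split => //; rewrite wE; lra.
have [b4|g4] := leP (e0 / 4 ^+ n.+1)
    `|rect_int G (a + W) (a + W + W) (c + H) (c + H + H)|.
  by exists (a + W, c + H) => //=; split => //; rewrite ?wE ?hE; lra.
suff : `|rect_int G a (a + w / 2 ^+ n) c (c + h / 2 ^+ n)| < e0 / 4 ^+ n.
  by rewrite ltNge; move: bad; rewrite /quarter_bad /= => ->.
rewrite E eE -[X in _ < X]/(_ *+ (1 + 1 + (1 + 1))) !mulrnDr !mulr1n.
apply: (le_lt_trans (ler_normD _ _)); apply: ltrD;
  by apply: (le_lt_trans (ler_normD _ _)); apply: ltrD.
Qed.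

Lemma nested_point (u : nat -> R) (l : R) : 0 <= l ->
  (forall n, u n <= u n.+1) ->
  (forall n, u n.+1 + l / 2 ^+ n.+1 <= u n + l / 2 ^+ n) ->
  exists x, forall n, u n <= x <= u n + l / 2 ^+ n.
Proof.
move=> l0 u_nd u_ni.
have p2 n : 0 <= l / 2 ^+ n by rewrite divr_ge0// exprn_ge0.
have nd m n : (m <= n)%N -> u m <= u n.
  move=> /subnK <-; elim: (n - m)%N => [//|k IH].
  by rewrite addSn (le_trans IH).
have ni m n : (m <= n)%N -> u n + l / 2 ^+ n <= u m + l / 2 ^+ m.
  move=> /subnK <-; elim: (n - m)%N => [//|k IH].
  by rewrite addSn (le_trans (u_ni _)).
have ub n m : u m <= u n + l / 2 ^+ n.
  have [mn|nm] := leqP m n; first by rewrite (le_trans (nd _ _ mn))// lerDl.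
  by rewrite (le_trans _ (ni _ _ (ltnW nm)))// lerDl.
exists (sup (range u)) => n; apply/andP; split.
  by apply: ub_le_sup; [exists (u 0%N + l / 2 ^+ 0) => _ [m _ <-]|exists n].
by apply: ge_sup; [exists (u 0%N), 0%N|move=> _ [m _ <-]].
Qed.

(** Bisection: if the integral were not zero, nested rectangles carrying at least
    4^-n of it would shrink to a point, where the affine approximation of G makes
    the integral o(4^-n). *)
Theorem goursat G a b c d : a <= b -> c <= d ->
  (forall z, in_rect a b c d z -> cdiff G z) -> rect_int G a b c d = 0.
Proof.
move=> ab cd dG; apply: contrapT => /eqP J0.
pose e0 := `|rect_int G a b c d|.
have e00 : 0 < e0 by rewrite normr_gt0.
pose w := b - a; pose h := d - c.
have w0 : 0 <= w by rewrite subr_ge0.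
have h0 : 0 <= h by rewrite subr_ge0.
have cG : cont_rect G a b c d by move=> z /dG; exact: cdiff_ccont.
pose inside n (p : R * R) := [/\ a <= p.1, p.1 + w / 2 ^+ n <= b,
  c <= p.2 & p.2 + h / 2 ^+ n <= d].
have step n (p : R * R) : exists q : R * R, inside n p /\ quarter_bad G w h e0 n p ->
    [/\ inside n.+1 q, quarter_bad G w h e0 n.+1 q &
    [/\ p.1 <= q.1, q.1 + w / 2 ^+ n.+1 <= p.1 + w / 2 ^+ n,
        p.2 <= q.2 & q.2 + h / 2 ^+ n.+1 <= p.2 + h / 2 ^+ n]].
  have [[[i1 i2 i3 i4] bad]|nb] := pselect (inside n p /\ quarter_bad G w h e0 n p);
    last by exists p.
  have [q qb [q1 q2 q3 q4]] := quarter_step w0 h0 (cont_rect_sub i1 i2 i3 i4 cG) bad.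
  exists q => _; split => //; split.
  - exact: le_trans q1.
  - exact: le_trans i2.
  - exact: le_trans q3.
  - exact: le_trans i4.
have [f fP] : exists f : nat -> R * R -> R * R, forall n p,
    inside n p /\ quarter_bad G w h e0 n p ->
    [/\ inside n.+1 (f n p), quarter_bad G w h e0 n.+1 (f n p) &
    [/\ p.1 <= (f n p).1, (f n p).1 + w / 2 ^+ n.+1 <= p.1 + w / 2 ^+ n,
        p.2 <= (f n p).2 & (f n p).2 + h / 2 ^+ n.+1 <= p.2 + h / 2 ^+ n]].
  have := choice (fun np : nat * (R * R) => step np.1 np.2).
  by move=> [f fP]; exists (fun n p => f (n, p)) => n p; exact: (fP (n, p)).
pose u := fix u n := if n is m.+1 then f m (u m) else (a, c).
have uP n : inside n (u n) /\ quarter_bad G w h e0 n (u n).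
  elim: n => [|n IH]; last by have [] := fP n _ IH.
  rewrite /inside /quarter_bad /= !expr0 !divr1 /w /h !subrKC.
  by split => //; split.
have uS n : [/\ (u n).1 <= (u n.+1).1,
    (u n.+1).1 + w / 2 ^+ n.+1 <= (u n).1 + w / 2 ^+ n,
    (u n).2 <= (u n.+1).2 & (u n.+1).2 + h / 2 ^+ n.+1 <= (u n).2 + h / 2 ^+ n].
  by have [] := fP n _ (uP n).
have [x xP] := @nested_point (fun n => (u n).1) w w0
  (fun n => let: And4 p _ _ _ := uS n in p) (fun n => let: And4 _ p _ _ := uS n in p).
have [y yP] := @nested_point (fun n => (u n).2) h h0
  (fun n => let: And4 _ _ p _ := uS n in p) (fun n => let: And4 _ _ _ p := uS n in p).
have /dG [D GD] : in_rect a b c d (x +i* y).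
  have := xP 0%N; have := yP 0%N; rewrite /= !expr0 !divr1 /w /h !subrKC.
  by rewrite /in_rect /= => -> ->.
pose S := w + h; have S0 : 0 <= S by rewrite addr_ge0.
pose eps := e0 / (4 * (1 + S ^+ 2)).
have S1 : 0 < 1 + S ^+ 2 by rewrite ltr_pwDl// sqr_ge0.
have eps0 : 0 < eps by rewrite divr_gt0// mulr_gt0.
have [del del0 H] := GD _ eps0.
have [n nP] : exists n, S / 2 ^+ n < del.
  have [n nP] : exists n : nat, S / del < n%:R.
    exists (Num.trunc (S / del)).+1; exact: truncnS_gt.
  exists n; rewrite ltr_pdivrMr ?exprn_gt0// mulrC -ltr_pdivrMr//.
  apply: (lt_trans nP); rewrite -natrX ltr_nat; exact: ltn_expl.
have [[i1 i2 i3 i4] bad] := uP n.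
have wn : 0 <= w / 2 ^+ n by rewrite divr_ge0// exprn_ge0.
have hn : 0 <= h / 2 ^+ n by rewrite divr_ge0// exprn_ge0.
have near z : in_rect (u n).1 ((u n).1 + w / 2 ^+ n) (u n).2
    ((u n).2 + h / 2 ^+ n) z ->
    nc (G z - ((G (x +i* y) - D * (x +i* y)) + D * z)) <= eps * (S / 2 ^+ n).
  move=> /andP[/andP[z1 z2] /andP[z3 z4]].
  have zx : nc (z - (x +i* y)) <= S / 2 ^+ n.
    rewrite (le_trans (nc_le_ReIm _))// mulrDl.
    have /andP[x1 x2] := xP n; have /andP[y1 y2] := yP n.
    by apply: lerD; rewrite ?(ReD, ImD, ReN, ImN)/= ler_norml; apply/andP; split; lra.
  have -> : G z - (G (x +i* y) - D * (x +i* y) + D * z) =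
    G z - G (x +i* y) - D * (z - (x +i* y)) by ring.
  apply: (le_trans (H _ (le_lt_trans zx nP))).
  by rewrite ler_wpM2l// ltW.
have := rect_int_near _ _ (cont_rect_sub i1 i2 i3 i4 cG) near.
rewrite !lerDl => /(_ wn hn) J.
have := le_trans bad J.
have -> : 2 * (eps * (S / 2 ^+ n)) * ((u n).1 + w / 2 ^+ n - (u n).1 +
    ((u n).2 + h / 2 ^+ n - (u n).2)) = 2 * eps * S ^+ 2 / 4 ^+ n.
  have -> : (4 : R) = 2 ^+ 2 by rewrite expr2; ring.
  by rewrite -exprM mulnC exprM /S; field; rewrite expf_neq0.
rewrite ler_pM2r ?invr_gt0 ?exprn_gt0// /eps.
have -> : 2 * (e0 / (4 * (1 + S ^+ 2))) * S ^+ 2 =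
   e0 * (S ^+ 2 / (2 * (1 + S ^+ 2))) by field; rewrite gt_eqF.
rewrite -[X in X <= _]mulr1 ler_pM2l// ler_pdivlMr ?mulr_gt0// mul1r.
by have := sqr_ge0 S; lra.
Qed.

Lemma rect_int_hnull G a c d : rect_int G a a c d = 0.
Proof. by rewrite /rect_int !seg_intxx !subrr. Qed.

Lemma rect_int_vnull G a b c : rect_int G a b c c = 0.
Proof. by rewrite /rect_int !seg_intxx !subrr. Qed.

(** At finitely many points continuity is enough: a point p is cut out by a
    small square, whose contour integral is at most its perimeter times a local
    bound of the oscillation of G. The square is intersected with the rectangle, so
    that p may lie on the boundary; some of the surrounding pieces are then
    degenerate. *)
Theorem goursat_exceptional (P : seq R[i]) G a b c d : a <= b -> c <= d ->
  cont_rect G a b c d ->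
  (forall z, in_rect a b c d z -> z \notin P -> cdiff G z) ->
  rect_int G a b c d = 0.
Proof.
elim: P a b c d => [|p P IH] a b c d ab cd cG dG.
  by apply: goursat => // z /dG; apply.
have [pQ|pQ] := boolP (in_rect a b c d p); last first.
  apply: IH => // z zQ zP; apply: dG => //; rewrite inE negb_or zP andbT.
  by apply: contraNneq pQ => <-.
have sub a' b' c' d' : a <= a' -> a' <= b' -> b' <= b -> c <= c' -> c' <= d' ->
    d' <= d -> ~~ in_rect a' b' c' d' p -> rect_int G a' b' c' d' = 0.
  move=> aa ab' bb cc cd' dd np; apply: IH => //.
    exact: (cont_rect_sub aa bb cc dd cG).
  move=> z zQ zP; apply: dG; first exact: (in_rect_sub aa bb cc dd zQ).
  by rewrite inE negb_or zP andbT; apply: contraNneq np => <-.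
apply/eqP; rewrite -normr_le0; apply/ler_addgt0Pr => eps eps0; rewrite add0r.
have [del del0 H] := cG _ pQ _ ltr01.
move: (pQ) => /andP[/andP[ap pb] /andP[cp pd]].
(* the first bound keeps the square inside the disc of radius del; since the
   oscillation is below 1 there and the sides are at most 2 r, the integral is at
   most 2 * (2 r + 2 r), which the second bound makes less than eps *)
set r := Num.min (del / 4) (eps / 16).
have r0 : 0 < r by rewrite lt_min !divr_gt0.
have rdel : r <= del / 4 by rewrite ge_min lexx.
have reps : r <= eps / 16 by rewrite ge_min lexx orbT.
pose a' := Num.max a (complex.Re p - r); pose b' := Num.min b (complex.Re p + r).
pose c' := Num.max c (complex.Im p - r); pose d' := Num.min d (complex.Im p + r).
have aa : a <= a' by rewrite le_max lexx.
have bb : b' <= b by rewrite ge_min lexx.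
have cc : c <= c' by rewrite le_max lexx.
have dd : d' <= d by rewrite ge_min lexx.
have a'p : a' <= complex.Re p by rewrite ge_max ap lerBlDr lerDl ltW.
have pb' : complex.Re p <= b' by rewrite le_min pb lerDl ltW.
have c'p : c' <= complex.Im p by rewrite ge_max cp lerBlDr lerDl ltW.
have pd' : complex.Im p <= d' by rewrite le_min pd lerDl ltW.
have ab' : a' <= b' by exact: le_trans pb'.
have cd' : c' <= d' by exact: le_trans pd'.
rewrite (rect_int_splith aa (le_trans ab' bb) cd cG).
have left0 : rect_int G a a' c d = 0.
  have [a'E|a'E] := leP (complex.Re p - r) a.
    by rewrite /a' max_l// rect_int_hnull.
  apply: sub => //; first exact: le_trans bb.
  by rewrite /in_rect /a' (max_r (ltW a'E)) lerBrDr gerDl (lt_geF r0)/= ?andbF.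
rewrite left0 add0r.
rewrite (rect_int_splith ab' bb cd (cont_rect_sub aa _ _ _ cG))//.
have right0 : rect_int G b' b c d = 0.
  have [b'E|b'E] := leP b (complex.Re p + r).
    by rewrite /b' min_l// rect_int_hnull.
  apply: sub => //; first exact: le_trans ab'.
  by rewrite /in_rect /b' (min_r (ltW b'E)) gerDl (lt_geF r0).
rewrite right0 addr0.
have cG' : cont_rect G a' b' c d by apply: (cont_rect_sub aa bb _ _ cG).
rewrite (rect_int_splitv ab' cc (le_trans cd' dd) cG').
have bot0 : rect_int G a' b' c c' = 0.
  have [c'E|c'E] := leP (complex.Im p - r) c.
    by rewrite /c' max_l// rect_int_vnull.
  apply: sub => //; first exact: le_trans dd.
  by rewrite /in_rect /c' (max_r (ltW c'E)) lerBrDr gerDl (lt_geF r0)/= ?andbF.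
rewrite bot0 add0r.
rewrite (rect_int_splitv ab' cd' dd (cont_rect_sub _ _ cc _ cG'))//.
have top0 : rect_int G a' b' d' d = 0.
  have [d'E|d'E] := leP d (complex.Im p + r).
    by rewrite /d' min_l// rect_int_vnull.
  apply: sub => //; first exact: le_trans cd'.
  by rewrite /in_rect /d' (min_r (ltW d'E)) gerDl (lt_geF r0)/= andbF.
rewrite top0 addr0.
have cG'' := cont_rect_sub aa bb cc dd cG.
have a'r : complex.Re p - r <= a' by rewrite le_max lexx orbT.
have b'r : b' <= complex.Re p + r by rewrite ge_min lexx orbT.
have c'r : complex.Im p - r <= c' by rewrite le_max lexx orbT.
have d'r : d' <= complex.Im p + r by rewrite ge_min lexx orbT.
have near z : in_rect a' b' c' d' z -> nc (G z - (G p + 0 * z)) <= 1.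
  move=> /andP[/andP[z1 z2] /andP[z3 z4]]; rewrite mul0r addr0 ltW// H//.
  rewrite (le_lt_trans (nc_le_ReIm _))// ReD ImD ReN ImN.
  have h1 : `|complex.Re z - complex.Re p| <= r by rewrite ler_norml; apply/andP; split; lra.
  have h2 : `|complex.Im z - complex.Im p| <= r by rewrite ler_norml; apply/andP; split; lra.
  lra.
apply: (le_trans (rect_int_near ab' cd' cG'' near)); lra.
Qed.

End Goursat.

(** * Integrals of complex functions over the real line *)

Section LineIntegrals.
Variable R : realType.
Local Notation "x ^*" := (conjc x) : ring_scope.
Local Notation "''i'" := (Complex 0 1) : ring_scope.
Implicit Types (z w : R[i]) (a b c d x y : R) (g h : R -> R[i]).
Local Notation mu := (@lebesgue_measure R).

(** An open set of the plane is a countable union of rational boxes, hence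
    measurable for the product sigma-algebra. *)
Lemma open_measurable2 (U : set (R * R)) :
  (forall p, U p -> exists2 r : R, 0 < r &
     forall q, `|q.1 - p.1| < r -> `|q.2 - p.2| < r -> U q) ->
  measurable (U : set (measurableTypeR R * measurableTypeR R)%type).
Proof.
move=> oU.
pose box (a b c d : rat) : set (R * R) :=
  `]ratr a, ratr b[ `*` `]ratr c, ratr d[.
have -> : U = \bigcup_a \bigcup_b \bigcup_c \bigcup_d
    (if `[< box a b c d `<=` U >] then box a b c d else set0).
  apply/seteqP; split => [[x y] /oU[r r0 H]|p].
    have lo t : t - r < t by rewrite ltrBlDr ltrDl.
    have hi t : t < t + r by rewrite ltrDl.
    have [a] := rat_in_itvoo (lo x); have [b] := rat_in_itvoo (hi x).
    have [c] := rat_in_itvoo (lo y); have [d] := rat_in_itvoo (hi y).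
    rewrite !in_itv/= => /andP[d1 d2] /andP[c1 c2] /andP[b1 b2] /andP[a1 a2].
    exists a => //; exists b => //; exists c => //; exists d => //.
    rewrite asboolT; first by split => /=; rewrite in_itv/= ?a2 ?c2.
    move=> [s t] [/=]; rewrite !in_itv/= => /andP[s1 s2] /andP[t1 t2].
    by apply: H; rewrite /= ltr_norml; apply/andP; split; lra.
  move=> [a _ [b _ [c _ [d _]]]]; case: ifPn => // /asboolP; exact.
apply: bigcupT_measurable_rat => a; apply: bigcupT_measurable_rat => b.
apply: bigcupT_measurable_rat => c; apply: bigcupT_measurable_rat => d.
by case: ifPn => // _; apply: measurableX; exact: measurable_itv.
Qed.

Lemma ccont_measurable2 (G : R[i] -> R[i]) : (forall z, ccont G z) ->
  measurable_fun setT
    (fun p : measurableTypeR R * measurableTypeR R => nc (G (p.1 +i* p.2))).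
Proof.
move=> cG; apply: (measurability _ (measurable_realfun.RGenOInfty.measurableE R)).
move=> _ [_ [a ->] <-]; rewrite setTI; apply: open_measurable2 => p /=.
rewrite in_itv/= andbT => ap; have e0 : 0 < nc (G (p.1 +i* p.2)) - a by rewrite subr_gt0.
have [del del0 H] := cG (p.1 +i* p.2) _ e0.
exists (del / 2); first by rewrite divr_gt0.
move=> q q1 q2; rewrite in_itv/= andbT.
have : nc (G (q.1 +i* q.2) - G (p.1 +i* p.2)) < nc (G (p.1 +i* p.2)) - a.
  apply: H; apply: (le_lt_trans (nc_le_ReIm _)).
  by rewrite !(ReD, ImD, ReN, ImN)/= [ltRHS]splitr ltrD.
have := ncB (G (q.1 +i* q.2)) (G (q.1 +i* q.2) - G (p.1 +i* p.2)).
by rewrite subKr; lra.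
Qed.

Lemma EFin_Rintegral (f : R -> R) : mu.-integrable setT (EFin \o f) ->
  (\int[mu]_x (f x)%:E)%E = (\int[mu]_x f x)%:E.
Proof. by move=> fi; rewrite /Rintegral fineK//; exact: integrable_fin_num. Qed.

Definition ccts g := continuous (fun x => complex.Re (g x)) /\
  continuous (fun x => complex.Im (g x)).

Definition line_integrable g :=
  mu.-integrable setT (fun x => (complex.Re (g x))%:E) /\
  mu.-integrable setT (fun x => (complex.Im (g x))%:E).

Local Notation CI := (@complex_integral R).

Lemma CI_add g h : line_integrable g -> line_integrable h ->
  line_integrable (fun x => g x + h x) /\
  CI (fun x => g x + h x) = CI g + CI h.
Proof.
move=> [g1 g2] [h1 h2]; rewrite /line_integrable.
under [X in mu.-integrable _ X /\ _]eq_fun do rewrite ReD EFinD.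
under [X in _ /\ mu.-integrable _ X]eq_fun do rewrite ImD EFinD.
split; first by split; exact: integrableD.
rewrite /complex_integral.
under eq_Rintegral do rewrite ReD.
under [X in _ +i* X]eq_Rintegral do rewrite ImD.
by rewrite !RintegralD.
Qed.

Lemma CI_realE g (f1 f2 : R -> R) :
  mu.-integrable setT (EFin \o f1) -> mu.-integrable setT (EFin \o f2) ->
  (forall x, g x = f1 x +i* f2 x) ->
  line_integrable g /\ CI g = (\int[mu]_x f1 x) +i* (\int[mu]_x f2 x).
Proof.
move=> i1 i2 /funext ->; split => //; split => //.
Qed.

Lemma CI_scale (a : R[i]) g : line_integrable g ->
  line_integrable (fun x => a * g x) /\ CI (fun x => a * g x) = a * CI g.
Proof.
move=> [g1 g2]; case: a => u v.
have z1 (k : R) (f : R -> R) : mu.-integrable setT (EFin \o f) ->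
    mu.-integrable setT (EFin \o (fun x => k * f x)).
  move=> /(integrableZl measurableT k); apply: eq_integrable => //.
have := @CI_realE (fun x => (u +i* v) * g x)
  (fun x => u * complex.Re (g x) - v * complex.Im (g x))
  (fun x => u * complex.Im (g x) + v * complex.Re (g x)).
case.
- have := integrableB measurableT (z1 u _ g1) (z1 v _ g2).
  by apply: eq_integrable.
- have := integrableD measurableT (z1 u _ g2) (z1 v _ g1).
  by apply: eq_integrable.
- by move=> x; case: (g x).
move=> li ->; split => //; rewrite RintegralB ?RintegralD ?RintegralZl//;
  try exact: z1.
Qed.

Lemma CI_sub g h : line_integrable g -> line_integrable h ->
  line_integrable (fun x => g x - h x) /\
  CI (fun x => g x - h x) = CI g - CI h.
Proof.
move=> lg lh; have [lh' E'] := CI_scale (-1) lh.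
have [l E] := CI_add lg lh'.
have F : (fun x => g x - h x) = (fun x => g x + -1 * h x).
  by apply/funext => x; rewrite mulN1r.
by rewrite F; split => //; rewrite E E' mulN1r.
Qed.

Lemma CI_conj g : line_integrable g ->
  line_integrable (fun x => (g x)^*) /\ CI (fun x => (g x)^*) = (CI g)^*.
Proof.
move=> [g1 g2].
have := @CI_realE (fun x => (g x)^*) (fun x => complex.Re (g x))
  (fun x => - complex.Im (g x)).
case => //.
- by have := integrableN g2; apply: eq_integrable.
- by move=> x; case: (g x).
move=> li ->; split => //; congr (_ +i* _).
under eq_Rintegral do rewrite -mulN1r.
by rewrite RintegralZl// mulN1r.
Qed.

Lemma CI_bound g (A : R -> R) : ccts g -> mu.-integrable setT (EFin \o A) ->
  (forall x, nc (g x) <= A x) ->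
  line_integrable g /\ nc (CI g) <= 2 * \int[mu]_x A x.
Proof.
move=> [cR cI] iA gA.
have dom (f : R -> R) : continuous f -> (forall x, `|f x| <= nc (g x)) ->
    mu.-integrable setT (EFin \o f) /\ `|\int[mu]_x f x| <= \int[mu]_x A x.
  move=> cf fg.
  have if' : mu.-integrable setT (EFin \o f).
    apply: (le_integrable measurableT _ _ iA).
      by apply/measurable_EFinP; exact: continuous_measurable_fun.
    move=> x _ /=; rewrite lee_fin (le_trans (fg x))// (le_trans (gA x))//.
    exact: ler_norm.
  split => //; apply: (le_trans (le_normr_Rintegral measurableT if')).
  apply: le_Rintegral => //; first exact: integrable_norm.
  by move=> x _; rewrite (le_trans (fg x)).
have [iR bR] := dom _ cR (fun x => normRe_nc (g x)).
have [iI bI] := dom _ cI (fun x => normIm_nc (g x)).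
split => //; apply: (le_trans (nc_le_ReIm _)) => /=.
by rewrite mulr_natl mulr2n lerD.
Qed.

Definition sq_integrable g :=
  mu.-integrable setT (EFin \o (fun x => nc (g x) ^+ 2)).

Definition sq_int g : R := \int[mu]_x (nc (g x) ^+ 2).

Lemma continuous_sq_nc g : ccts g -> continuous (fun x => nc (g x) ^+ 2).
Proof.
move=> [cR cI].
have -> : (fun x => nc (g x) ^+ 2) = (fun x => complex.Re (g x) * complex.Re (g x)
    + complex.Im (g x) * complex.Im (g x)).
  by apply/funext => x; rewrite sqr_nc !expr2.
by move=> x; apply: cvgD; apply: cvgM; [exact: cR|exact: cR|exact: cI|exact: cI].
Qed.

Lemma sq_integrable_le g (M : R) : ccts g ->
  (\int[mu]_x (nc (g x) ^+ 2)%:E <= M%:E)%E ->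
  sq_integrable g /\ sq_int g <= M.
Proof.
move=> cg leM.
have mg : measurable_fun setT (EFin \o (fun x => nc (g x) ^+ 2)).
  apply/measurable_EFinP; apply: continuous_measurable_fun.
  exact: continuous_sq_nc.
have ig : sq_integrable g.
  apply/integrableP; split => //.
  apply: le_lt_trans (ltry M); apply: le_trans leM.
  by under eq_integral do rewrite /= ger0_norm ?sqr_ge0//.
split => //; rewrite -lee_fin /sq_int /Rintegral fineK//.
by apply: integrable_fin_num.
Qed.

Lemma ccts_mul g h : ccts g -> ccts h -> ccts (fun x => g x * h x).
Proof.
move=> [g1 g2] [h1 h2]; split => x.
- under eq_fun do rewrite ReM.
  by apply: cvgB; apply: cvgM; [exact: g1|exact: h1|exact: g2|exact: h2].
- under eq_fun do rewrite ImM.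
  by apply: cvgD; apply: cvgM; [exact: g1|exact: h2|exact: g2|exact: h1].
Qed.

(** The inequality of Cauchy and Schwarz before optimizing in t. The factor 2 that
    comes from estimating real and imaginary parts separately cancels the one in
    2 |g h| <= t |g|^2 + |h|^2 / t. *)
Lemma CI_mul g h (t : R) : ccts g -> ccts h -> sq_integrable g ->
  sq_integrable h -> 0 < t ->
  line_integrable (fun x => g x * h x) /\
  nc (CI (fun x => g x * h x)) <= t * sq_int g + t^-1 * sq_int h.
Proof.
move=> cg ch ig ih t0.
pose A x := (t / 2) * nc (g x) ^+ 2 + (t^-1 / 2) * nc (h x) ^+ 2.
have i1 : mu.-integrable setT (EFin \o (fun x => (t / 2) * nc (g x) ^+ 2)).
  by have := integrableZl measurableT (t / 2) ig; apply: eq_integrable.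
have i2 : mu.-integrable setT (EFin \o (fun x => (t^-1 / 2) * nc (h x) ^+ 2)).
  by have := integrableZl measurableT (t^-1 / 2) ih; apply: eq_integrable.
have iA : mu.-integrable setT (EFin \o A).
  by have := integrableD measurableT i1 i2; apply: eq_integrable.
have [|li le] := CI_bound (ccts_mul cg ch) iA.
  move=> x; rewrite ncM /A -subr_ge0.
  have -> : t / 2 * nc (g x) ^+ 2 + t^-1 / 2 * nc (h x) ^+ 2 - nc (g x) * nc (h x)
    = t^-1 / 2 * (t * nc (g x) - nc (h x)) ^+ 2 by field; rewrite gt_eqF.
  by rewrite mulr_ge0 ?sqr_ge0// divr_ge0// invr_ge0 ltW.
split => //; apply: (le_trans le).
rewrite /A RintegralD// !RintegralZl// /sq_int.
by rewrite le_eqVlt; apply/orP; left; apply/eqP; field; rewrite gt_eqF.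
Qed.

(** The only integral that is computed: it is where pi enters the kernel. *)
Lemma poisson_integral (p q : R) : 0 < q ->
  (\int[mu]_x (((x - p) ^+ 2 + q ^+ 2)^-1)%:E = (pi / q)%:E)%E.
Proof.
move=> q0.
have E0 : (\int[mu]_x ((1 + x ^+ 2)^-1)%:E = pi%:E)%E.
  rewrite ge0_symfun_integralT; last 3 first.
  - by move=> x; rewrite invr_ge0 addr_ge0// sqr_ge0.
  - exact: continuous_oneDsqrV.
  - by move=> x /=; rewrite sqrrN.
  rewrite -set_itvcy integral0y_oneDsqr -EFinM; congr (_%:E).
  by rewrite mulrC divfK.
pose F (x : R) := (x - p) / q.
have FE : F = q^-1 *: (id - cst p).
  by apply/funext => x; rewrite /F mulrC.
have dF (x : R) : is_derive x 1 F q^-1.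
  by rewrite FE; apply: is_derive_eq; rewrite subr0; exact: mulr1.
have dFE : derive1 F = cst q^-1.
  by apply/funext => x; rewrite derive1E; exact: derive_val.
have qV : 0 < q^-1 by rewrite invr_gt0.
have := @increasing_ge0_integration_by_substitutionT R F (fun x => (1 + x ^+ 2)^-1).
rewrite dFE => sub.
have {sub}E1 : (\int[mu]_x ((1 + x ^+ 2)^-1)%:E =
    \int[mu]_x ((1 + (F x) ^+ 2)^-1 * q^-1)%:E)%E.
  apply: sub.
  - by move=> x y xy; rewrite /F ltr_pM2r// ltrD2r.
  - by move=> x; exact: cvg_cst.
  - by apply/cvg_ex; exists q^-1; exact: cvg_cst.
  - by apply/cvg_ex; exists q^-1; exact: cvg_cst.
  - by move=> x; exact: ex_derive.
  - apply/cvgrNyPle => A; near=> x; rewrite /F ler_pdivrMr// lerBlDr.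
    by near: x; apply: nbhs_ninfty_le; exact: num_real.
  - apply/cvgryPge => A; near=> x; rewrite /F ler_pdivlMr// lerBrDr.
    by near: x; apply: nbhs_pinfty_ge; exact: num_real.
  - exact: continuous_oneDsqrV.
  - by move=> x; rewrite invr_ge0 addr_ge0// sqr_ge0.
have -> : (\int[mu]_x (((x - p) ^+ 2 + q ^+ 2)^-1)%:E =
    \int[mu]_x (q^-1%:E * ((1 + (F x) ^+ 2)^-1 * q^-1)%:E))%E.
  apply: eq_integral => x _; rewrite -EFinM; congr (_%:E); rewrite /F.
  by rewrite -!invfM; congr (_^-1); field; rewrite gt_eqF.
have mF : measurable_fun setT (fun x => ((1 + F x ^+ 2)^-1 * q^-1)%:E).
  apply/measurable_EFinP; apply: continuous_measurable_fun => x.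
  apply: cvgM; last exact: cvg_cst.
  apply: (@continuous_comp _ _ _ F (fun y => (1 + y ^+ 2)^-1)).
    by apply/differentiable_continuous/derivable1_diffP; exact: ex_derive.
  exact: continuous_oneDsqrV.
rewrite ge0_integralZl//; last 2 first.
- by move=> x _; rewrite lee_fin divr_ge0 ?(ltW q0)// invr_ge0 addr_ge0// sqr_ge0.
- by rewrite lee_fin ltW.
by rewrite -E1 E0 -EFinM mulrC.
Unshelve. all: by end_near. Qed.

End LineIntegrals.

(** * The Cauchy theorem in the Hardy space of the upper half-plane *)

Section HalfPlane.
Variable R : realType.
Local Notation "x ^*" := (conjc x) : ring_scope.
Local Notation "''i'" := (Complex 0 1) : ring_scope.
Implicit Types (z w v : R[i]) (a b c d x y : R) (F : R[i] -> R[i]).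
Local Notation mu := (@lebesgue_measure R).
Local Notation CI := (@complex_integral R).

(** Functions of the Hardy space that extend continuously to the real line, with
    a finite set P of points where only continuity is known. Allowing P is what makes
    difference quotients stay in the class. *)
Record hardy_bounded (P : seq R[i]) F (M : R) : Prop := {
  hb_cont : forall z, 0 <= complex.Im z -> ccont F z ;
  hb_diff : forall z, 0 <= complex.Im z -> z \notin P -> cdiff F z ;
  hb_sq : forall y, 0 <= y -> sq_integrable (fun x => F (x +i* y)) /\
    sq_int (fun x => F (x +i* y)) <= M }.

Lemma ccts_line F y : (forall z, complex.Im z = y -> ccont F z) ->
  ccts (fun x => F (x +i* y)).
Proof.
move=> cF; split=> x.
- apply: (proj1 (@ccont_line _ F (fun t => t +i* y) x _ _)); last exact: cF.
  by move=> x'; exact: nc_hline.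
- apply: (proj2 (@ccont_line _ F (fun t => t +i* y) x _ _)); last exact: cF.
  by move=> x'; exact: nc_hline.
Qed.

Lemma cdiff_sub_inv v z : z != v -> cdiff (fun w => (w - v)^-1) z.
Proof.
move=> zv; apply: cdiffV; first by rewrite subr_eq0.
by apply: cdiffB; [exact: cdiff_id|exact: cdiff_cst].
Qed.

Lemma neq_of_Im v z : complex.Im v < complex.Im z -> z != v.
Proof. by apply: contraTneq => ->; rewrite ltxx. Qed.

Lemma cauchy_kernel v y : complex.Im v != y ->
  [/\ ccts (fun x => ((x +i* y) - v)^-1),
      sq_integrable (fun x => ((x +i* y) - v)^-1) &
      sq_int (fun x => ((x +i* y) - v)^-1) = pi / `|y - complex.Im v| ].
Proof.
move=> vy.
have cc : ccts (fun x => ((x +i* y) - v)^-1).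
  apply: (@ccts_line (fun z => (z - v)^-1)) => z zy.
  apply/cdiff_ccont/cdiff_sub_inv.
  by apply: contraNneq vy => <-; rewrite zy.
have q0 : 0 < `|y - complex.Im v| by rewrite normr_gt0 subr_eq0 eq_sym.
have E : (\int[mu]_x (nc ((x +i* y) - v)^-1 ^+ 2)%:E = (pi / `|y - complex.Im v|)%:E)%E.
  rewrite -(poisson_integral (complex.Re v) q0); apply: eq_integral => x _.
  congr (_%:E); rewrite ncV exprVn sqr_nc real_normK ?num_real//.
  by case: (v).
have le : (\int[mu]_x (nc ((x +i* y) - v)^-1 ^+ 2)%:E <= (pi / `|y - complex.Im v|)%:E)%E.
  by rewrite E.
have [i _] := sq_integrable_le cc le.
by split => //; rewrite /sq_int /Rintegral E.
Qed.

(** An integrable function takes small values arbitrarily far out on both sides. *)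
Lemma small_value (s : R -> \bar R) (eps N : R) :
  measurable_fun setT s -> (forall x, 0 <= s x)%E ->
  (\int[mu]_x s x < +oo)%E -> 0 < eps ->
  (exists2 x, N <= x & (s x <= eps%:E)%E) /\
  (exists2 x, x <= N & (s x <= eps%:E)%E).
Proof.
move=> ms s0 soo eps0.
have key (D : set R) : measurable D -> mu D = +oo%E ->
    exists2 x, D x & (s x <= eps%:E)%E.
  move=> mD Doo; apply: contrapT => H.
  have {}H x : D x -> (eps%:E <= s x)%E.
    move=> Dx; rewrite leNgt; apply/negP => se; apply: H; exists x => //.
    exact: ltW.
  have : (+oo <= \int[mu]_x s x)%E.
    apply: (@le_trans _ _ (\int[mu]_(x in D) s x)%E); last first.
      by apply: ge0_subset_integral.
    apply: (@le_trans _ _ (\int[mu]_(x in D) (cst eps%:E) x)%E); last first.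
      apply: ge0_le_integral => //.
      - by move=> x _; rewrite lee_fin ltW.
      - exact: (measurable_funS measurableT).
    have -> : (\int[mu]_(x in D) (cst eps%:E) x = eps%:E * mu D)%E by exact: integral_cst.
    by rewrite Doo gt0_muley// lte_fin.
  by rewrite leNgt soo.
split.
- have [|x] := key `[N, +oo[%classic (measurable_itv _).
    by rewrite lebesgue_measure_itv/= ltry.
  by rewrite /= in_itv/= andbT => Nx sx; exists x.
- have [|x] := key `]-oo, N]%classic (measurable_itv _).
    by rewrite lebesgue_measure_itv/= ltNyr.
  by rewrite /= in_itv/= => Nx sx; exists x.
Qed.

Lemma seg_int_cvg (f : R -> R) (a b : nat -> R) :
  mu.-integrable setT (EFin \o f) ->
  (forall n, a n <= - n%:R) -> (forall n, n%:R <= b n) ->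
  seg_int f (a n) (b n) @[n --> \oo] --> \int[mu]_x f x.
Proof.
move=> intf an bn.
have mf : measurable_fun setT (EFin \o f) := measurable_int mu intf.
pose D n : set R := `[a n, b n]%classic.
have [] := @dominated_convergence _ _ R mu setT measurableT
  (fun n => EFin \o (f \_ (D n))) (EFin \o f) (fun x => `|(f x)%:E|%E).
- move=> n; apply/measurable_EFinP.
  apply/(measurable_restrictT f (measurable_itv `[a n, b n])).
  by apply: measurable_funTS; apply/measurable_EFinP.
- exact: mf.
- apply: aeW => x _; apply: cvg_near_cst.
  have [N Nx] : exists N : nat, `|x| < N%:R.
    exists (Num.trunc `|x|).+1; exact: truncnS_gt.
  exists N => // n /= Nn; rewrite /patch mem_set//= /D /= in_itv/=.
  have xn : `|x| <= n%:R by rewrite (le_trans (ltW Nx))// ler_nat.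
  move: xn; rewrite ler_norml => /andP[x1 x2].
  by rewrite (le_trans (an n) x1) (le_trans x2 (bn n)).
- by apply: integrable_abse.
- apply: aeW => x n _ /=; rewrite lee_fin /patch; case: ifPn => // _.
  by rewrite normr0.
move=> _ _ cvgI; rewrite /seg_int.
apply: fine_cvg.
rewrite -EFin_Rintegral//; under eq_fun do rewrite integral_mkcond restrict_EFin.
exact: cvgI.
Qed.

(** The retraction onto the closed upper half-plane; composing with it makes a
    function continuous on the whole plane. *)
Definition clamp z : R[i] := complex.Re z +i* Num.max (complex.Im z) 0.

Lemma Im_clamp z : 0 <= complex.Im (clamp z).
Proof. by rewrite /= le_max lexx orbT. Qed.

Lemma nc_clamp z w : nc (clamp z - clamp w) <= nc (z - w).
Proof.
rewrite -ler_sqr ?nnegrE ?nc_ge0// !sqr_nc /clamp !(ReD, ImD, ReN, ImN)/= lerD2l.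
rewrite -[leLHS]real_normK ?num_real// -[leRHS]real_normK ?num_real//.
rewrite ler_sqr ?nnegrE// maxEle [Num.max (complex.Im w) _]maxEle.
case: (leP (complex.Im z) 0); case: (leP (complex.Im w) 0) => h1 h2.
- by rewrite subrr normr0.
- by rewrite !ler0_norm; lra.
- by rewrite !ger0_norm; lra.
- by [].
Qed.

Lemma ccont_clamp F : (forall z, 0 <= complex.Im z -> ccont F z) ->
  forall z, ccont (fun z => F (clamp z)) z.
Proof.
move=> cF z eps /(cF _ (Im_clamp z))[del del0 H].
by exists del => // w wz; apply: H; exact: le_lt_trans (nc_clamp _ _) wz.
Qed.

Lemma hardy_line P F M v y t : hardy_bounded P F M -> complex.Im v < 0 ->
  0 <= y -> 0 < t ->
  line_integrable (fun x => F (x +i* y) * (x +i* y - v)^-1) /\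
  nc (CI (fun x => F (x +i* y) * (x +i* y - v)^-1)) <=
    t * M + t^-1 * (pi / (y - complex.Im v)).
Proof.
move=> hF v0 y0 t0; have vy : complex.Im v != y by rewrite lt_eqF// (lt_le_trans v0).
have [k1 k2 k3] := cauchy_kernel vy; have [f1 f2] := hb_sq hF y0.
have f0 : ccts (fun x => F (x +i* y)).
  by apply: ccts_line => z zy; apply: (hb_cont hF); rewrite zy.
have [li le] := CI_mul f0 k1 f1 k2 t0; split => //.
apply: (le_trans le); rewrite k3 ger0_norm; last by lra.
by rewrite lerD2r ler_pM2l.
Qed.

(** The integral of F / (z - v) over a vertical segment at abscissa x is dominated
    by an integrable function of x: integrate first over horizontal lines, where
    the bound is uniform, and exchange the integrals. *)
Lemma side_bound P F M v Y : hardy_bounded P F M -> complex.Im v < 0 -> 0 < Y ->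
  exists s : R -> \bar R, [/\ measurable_fun setT s, (forall x, 0 <= s x)%E,
    (\int[mu]_x s x < +oo)%E &
    forall x, (`|seg_int (fun y => complex.Im (F (x +i* y) * (x +i* y - v)^-1)) 0 Y|%:E
      <= s x)%E].
Proof.
move=> hF v0 Y0; pose G z := F z * (z - v)^-1.
have cG z : 0 <= complex.Im z -> ccont G z.
  move=> z0; apply: ccontM; first exact: (hb_cont hF).
  by apply/cdiff_ccont/cdiff_sub_inv/neq_of_Im; exact: lt_le_trans z0.
pose f (p : measurableTypeR R * measurableTypeR R) : \bar R :=
  (nc (G (clamp (p.1 +i* p.2))) * \1_(`[0, Y]%classic) p.2)%:E.
have mf : measurable_fun setT f.
  apply/measurable_EFinP; apply: measurable_funM.
    exact: (ccont_measurable2 (ccont_clamp cG)).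
  have m1 : measurable_fun setT (\1_(`[0, Y]%classic) : measurableTypeR R -> R).
    by apply: measurable_indic; exact: measurable_itv.
  exact: (measurableT_comp m1 measurable_snd).
have f0 p : (0 <= f p)%E by rewrite lee_fin mulr_ge0// nc_ge0.
exists (fun x => \int[mu]_y f (x, y))%E; split.
- exact: measurable_fun_fubini_tonelli_F.
- by move=> x; apply: integral_ge0.
- rewrite fubini_tonelli//.
  pose C := M + pi / - complex.Im v.
  apply: (@le_lt_trans _ _ (\int[mu]_(y in `[0%R, Y]) (cst C%:E) y)%E); last first.
    rewrite integral_cst; last exact: measurable_itv.
    rewrite [X in (_ * X)%E](_ : _ = Y%:E) ?ltry//.
    by have := @lebesgue_measure_itv R `[0, Y]; rewrite /= lte_fin Y0 oppr0 addr0; apply.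
  rewrite [leRHS]integral_mkcond; apply: ge0_le_integral => //.
  + by move=> y _; apply: integral_ge0.
  + exact: measurable_fun_fubini_tonelli_G.
  + apply/(measurable_restrictT _ (measurable_itv `[0, Y])).
    exact: measurable_cst.
  move=> y _; rewrite /patch; case: ifPn => [|yY]; last first.
    rewrite integral0_eq// => x _; rewrite /f indicE (negbTE yY) mulr0//.
  rewrite inE/= in_itv/= => /andP[y0 yY].
  have vy : complex.Im v != y by rewrite lt_eqF// (lt_le_trans v0).
  have [k1 k2 k3] := cauchy_kernel vy; have [f1 f2] := hb_sq hF y0.
  have ifk : mu.-integrable setT (EFin \o
      (fun x => nc (F (x +i* y)) ^+ 2 + nc ((x +i* y - v)^-1) ^+ 2)).
    by have := integrableD measurableT f1 k2; apply: eq_integrable.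
  apply: (@le_trans _ _ (\int[mu]_x (nc (F (x +i* y)) ^+ 2 + nc ((x +i* y - v)^-1) ^+ 2)%:E)%E).
    apply: ge0_le_integral => //.
    - exact: (measurable_fun_pair1 y mf).
    - exact: (measurable_int mu ifk).
    move=> x _; rewrite lee_fin indicE mem_set ?mulr1; last first.
      by rewrite /= in_itv/= y0.
    have -> : clamp (x +i* y) = x +i* y by rewrite /clamp /= max_l.
    rewrite /G ncM; set p := nc (F _); set q := nc (_^-1).
    by have := sqr_ge0 (p - q); have := sqr_ge0 (p + q); rewrite !expr2; lra.
  rewrite EFin_Rintegral// lee_fin RintegralD//.
  rewrite lerD//; rewrite -/(sq_int _) k3 ger0_norm; last by lra.
  rewrite ler_wpM2l ?pi_ge0// lef_pV2 ?posrE; lra.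
move=> x.
have cvl : cont_on (fun y => complex.Im (G (x +i* y))) 0 Y.
  apply: (@cont_rect_vline _ G x x 0 Y); last by rewrite lexx.
  by move=> z /andP[_ /andP[z0 _]]; exact: cG.
have ivl := cont_on_integrable cvl.
rewrite /seg_int EFin_normr_Rintegral//.
apply: (le_trans (le_abse_integral _ _ _)) => //; first exact: (measurable_int mu ivl).
rewrite [leLHS]integral_mkcond; apply: ge0_le_integral => //.
- by move=> y _; apply: erestrict_ge0.
- apply/(measurable_restrictT _ (measurable_itv `[0, Y])).
  by apply: measurableT_comp => //; exact: (measurable_int mu ivl).
- exact: (measurable_fun_pair2 x mf).
move=> y _; rewrite /patch; case: ifPn => // yY.
rewrite /= lee_fin indicE yY mulr1.
move: yY; rewrite inE/= in_itv/= => /andP[y0 yY].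
have -> : clamp (x +i* y) = x +i* y by rewrite /clamp /= max_l.
exact: normIm_nc.
Qed.

(** Goursat on rectangles whose vertical sides are pushed to infinity along
    abscissas where they are small: the integral over a horizontal line does not
    depend on its height. *)
Lemma hardy_shift_Re P F M v Y : hardy_bounded P F M -> complex.Im v < 0 -> 0 < Y ->
  complex.Re (CI (fun x => F (x +i* 0) * (x +i* 0 - v)^-1)) =
  complex.Re (CI (fun x => F (x +i* Y) * (x +i* Y - v)^-1)).
Proof.
move=> hF v0 Y0; pose G z := F z * (z - v)^-1.
have zv z : 0 <= complex.Im z -> z != v.
  by move=> z0; apply: neq_of_Im; exact: lt_le_trans z0.
have cG z : 0 <= complex.Im z -> ccont G z.
  move=> z0; apply: ccontM; first exact: (hb_cont hF).
  exact/cdiff_ccont/cdiff_sub_inv/zv.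
have dG z : 0 <= complex.Im z -> z \notin P -> cdiff G z.
  move=> z0 zP; apply: cdiffM; first exact: (hb_diff hF).
  exact/cdiff_sub_inv/zv.
have [s [ms s0 soo sV]] := side_bound hF v0 Y0.
have eps0 n : 0 < n.+1%:R^-1 :> R by rewrite invr_gt0.
have Hb n : exists b, n%:R <= b /\ (s b <= n.+1%:R^-1%:E)%E.
  by have [[x x1 x2] _] := small_value n%:R ms s0 soo (eps0 n); exists x.
have Ha n : exists a, a <= - n%:R /\ (s a <= n.+1%:R^-1%:E)%E.
  by have [_ [x x1 x2]] := small_value (- n%:R) ms s0 soo (eps0 n); exists x.
have [b bP] := choice Hb; have [a aP] := choice Ha.
have [[i0 _] _] := hardy_line hF v0 (lexx 0) ltr01.
have [[iY _] _] := hardy_line hF v0 (ltW Y0) ltr01.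
have ab n : a n <= b n.
  have [a1 _] := aP n; have [b1 _] := bP n.
  by have := ler0n R n; lra.
have V n x : (s x <= n.+1%:R^-1%:E)%E ->
    `|seg_int (fun y => complex.Im (G (x +i* y))) 0 Y| <= n.+1%:R^-1.
  by move=> sx; rewrite -lee_fin (le_trans (sV x)).
have c0 := seg_int_cvg i0 (fun n => proj1 (aP n)) (fun n => proj1 (bP n)).
have cY := seg_int_cvg iY (fun n => proj1 (aP n)) (fun n => proj1 (bP n)).
have c1 := cvgB c0 cY.
apply/eqP; rewrite -subr_eq0; apply/eqP.
rewrite -[LHS](cvg_lim (@Rhausdorff R) (c1 _)); apply: (cvg_lim (@Rhausdorff R)).
apply/(@cvgrPdist_lt _ R^o) => eps e0; near=> n.
rewrite sub0r normrN /=.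
have J := @goursat_exceptional R P G (a n) (b n) 0 Y (ab n) (ltW Y0).
have {}J : rect_int G (a n) (b n) 0 Y = 0.
  apply: J => z /andP[_ /andP[z0 _]]; first exact: cG.
  exact: dG.
move: J; rewrite /rect_int.
have Va := V n _ (proj2 (aP n)); have Vb := V n _ (proj2 (bP n)).
move: Va Vb; set va := seg_int _ 0 Y; set vb := seg_int _ 0 Y => Va Vb.
set u1 := seg_int _ (a n) (b n); set u2 := seg_int _ (a n) (b n) => J.
suff : `|u1 - u2| < eps by [].
apply: (@le_lt_trans _ _ (n.+1%:R^-1 + n.+1%:R^-1)).
  have -> : u1 - u2 = vb - va by lra.
  by rewrite (le_trans (ler_normB _ _))// lerD.
have : n.+1%:R^-1 < eps / 2.
  by near: n; exact: near_infty_natSinv_lt (PosNum (divr_gt0 e0 (ltr0n _ 2))).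
by move=> h; rewrite [ltRHS]splitr ltrD.
Unshelve. all: by end_near. Qed.

Lemma hardy_boundedZ P F M (a : R[i]) : hardy_bounded P F M -> nc a = 1 ->
  hardy_bounded P (fun z => a * F z) M.
Proof.
move=> [h1 h2 h3] a1; split.
- by move=> z z0; apply: ccontM; [exact: ccont_cst|exact: h1].
- by move=> z z0 zP; apply: cdiffM; [exact: cdiff_cst|exact: h2].
- move=> y y0; rewrite /sq_integrable /sq_int.
  have E : (fun x => nc (a * F (x +i* y)) ^+ 2) = (fun x => nc (F (x +i* y)) ^+ 2).
    by apply/funext => x; rewrite ncM a1 mul1r.
  by rewrite E; exact: h3.
Qed.

Lemma hardy_shift P F M v Y : hardy_bounded P F M -> complex.Im v < 0 -> 0 < Y ->
  CI (fun x => F (x +i* 0) * (x +i* 0 - v)^-1) =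
  CI (fun x => F (x +i* Y) * (x +i* Y - v)^-1).
Proof.
move=> hF v0 Y0; apply: eqC; first exact: (hardy_shift_Re hF).
have i1 : nc ('i : R[i]) = 1 by rewrite /nc/= expr0n/= add0r expr1n sqrtr1.
have := hardy_shift_Re (hardy_boundedZ hF i1) v0 Y0.
have [l0 _] := hardy_line hF v0 (lexx 0) ltr01.
have [lY _] := hardy_line hF v0 (ltW Y0) ltr01.
have E y : (fun x => 'i * F (x +i* y) * (x +i* y - v)^-1) =
    (fun x => 'i * (F (x +i* y) * (x +i* y - v)^-1)).
  by apply/funext => x; rewrite mulrA.
rewrite !E.
rewrite (proj2 (CI_scale 'i l0)) (proj2 (CI_scale 'i lY)) !ReM /=.
by rewrite !mul0r !mul1r !sub0r => /oppr_inj.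
Qed.

(** The integral over the real line equals the one at height Y, which is
    O(1 / sqrt Y). *)
Theorem hardy_cauchy_null P F M v : hardy_bounded P F M -> complex.Im v < 0 ->
  CI (fun x => F (x +i* 0) * (x +i* 0 - v)^-1) = 0.
Proof.
move=> hF v0; apply/eqP; rewrite -nc_eq0 -normr_le0 ger0_norm ?nc_ge0//.
have M0 : 0 <= M.
  have [_] := hb_sq hF (lexx 0); apply: le_trans.
  by apply: Rintegral_ge0 => x _; exact: sqr_ge0.
apply/ler_addgt0Pr => eps eps0; rewrite add0r.
pose t := eps / (2 * (M + 1)).
have M1 : 0 < M + 1 by rewrite ltr_wpDl.
have t0 : 0 < t by rewrite divr_gt0// mulr_gt0.
pose Y := 2 * t^-1 * pi / eps.
have Y0 : 0 < Y by rewrite divr_gt0// !mulr_gt0 ?invr_gt0 ?pi_gt0.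
have [_ le] := hardy_line hF v0 (ltW Y0) t0.
rewrite (hardy_shift hF v0 Y0) (le_trans le)//.
have -> : eps = t * (M + 1) + t^-1 * (pi / Y).
  have e1 : eps != 0 by rewrite gt_eqF.
  have e2 : M + 1 != 0 by rewrite gt_eqF.
  have e3 : pi != 0 :> R by rewrite gt_eqF// pi_gt0.
  have e4 : t != 0 by rewrite gt_eqF.
  have E0 (p : R) : p != 0 -> p / (2 * t^-1 * p / eps) = eps * t / 2.
    by move=> p0; field; rewrite e1 p0 e4.
  have E1 := E0 _ e3; rewrite -/Y in E1.
  have E2 : t * (M + 1) = eps / 2 by rewrite /t; field; rewrite ?e2.
  by rewrite E1 E2; field.
apply: lerD; first by rewrite ler_pM2l//; lra.
rewrite ler_pM2l ?invr_gt0// ler_pM2l ?pi_gt0// lef_pV2 ?posrE//; lra.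
Qed.

End HalfPlane.

(** * Difference quotients and the Cauchy formula *)

Section DiffQuot.
Variable R : realType.
Local Notation "x ^*" := (conjc x) : ring_scope.
Local Notation "''i'" := (Complex 0 1) : ring_scope.
Implicit Types (z w v p : R[i]) (a b c x y : R) (F : R[i] -> R[i]).
Local Notation mu := (@lebesgue_measure R).
Local Notation CI := (@complex_integral R).

(** The quotient (F z - F w) / (z - w) with the value d at w; d is meant to be the
    derivative of F at w. *)
Definition diff_quot F w (d : R[i]) z := if z == w then d else (F z - F w) / (z - w).

Lemma punctured_nbhs w z : z != w ->
  forall u, nc (u - z) < nc (z - w) -> u != w.
Proof. by move=> zw u; apply: contraTneq => ->; rewrite nc_subC ltxx. Qed.

Lemma diff_quot_cdiff F w d z : z != w -> cdiff F z -> cdiff (diff_quot F w d) z.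
Proof.
move=> zw dF; have r0 : 0 < nc (z - w) by rewrite nc_gt0 subr_eq0.
apply: (cdiff_eq r0 (f := fun u => (F u - F w) * (u - w)^-1)).
  by move=> u /(punctured_nbhs zw) uw; rewrite /diff_quot (negbTE uw).
apply: cdiffM; last exact: cdiff_sub_inv.
by apply: cdiffB => //; exact: cdiff_cst.
Qed.

Lemma diff_quot_ccont F w d z : cderiv F w d -> ccont F z -> ccont (diff_quot F w d) z.
Proof.
move=> dF cF; have [->|zw] := eqVneq z w.
  move=> eps eps0; have e20 : 0 < eps / 2 by rewrite divr_gt0.
  have [del del0 H] := dF _ e20; exists del => // u uw.
  rewrite /diff_quot eqxx; case: eqVneq => [_|nuw]; first by rewrite subrr nc0.
  have h0 : u - w != 0 by rewrite subr_eq0.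
  have -> : (F u - F w) / (u - w) - d = (F u - F w - d * (u - w)) / (u - w).
    by field.
  rewrite ncM ncV ltr_pdivrMr ?nc_gt0//; apply: le_lt_trans (H _ uw) _.
  by rewrite ltr_pM2r ?nc_gt0// ltr_pdivrMr// ltr_pMr// ltr1n.
have r0 : 0 < nc (z - w) by rewrite nc_gt0 subr_eq0.
apply: (ccont_eq r0 (f := fun u => (F u - F w) * (u - w)^-1)).
  by move=> u /(punctured_nbhs zw) uw; rewrite /diff_quot (negbTE uw).
apply: ccontM; last exact/cdiff_ccont/cdiff_sub_inv.
by apply: ccontD => //; exact: ccont_cst.
Qed.

(** Near w the quotient is bounded; away from w it is |F z| + |F w| divided by a
    quantity comparable with |z + i|. *)
Lemma diff_quot_bound F w d : 0 < complex.Im w -> cderiv F w d ->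
  exists2 A : R, 0 <= A & forall z, 0 <= complex.Im z ->
    nc (diff_quot F w d z) ^+ 2 <= A * ((nc (F z) ^+ 2 + 1) * nc (z - - 'i)^-1 ^+ 2).
Proof.
move=> w0 dF; have [r r0 H] := dF _ ltr01.
pose C := nc d + 1; pose K := nc (w - - 'i) + r; pose L := 1 + nc (w - - 'i) / r.
have C0 : 0 <= C by rewrite addr_ge0// nc_ge0.
have K0 : 0 <= K by rewrite addr_ge0 ?nc_ge0// ltW.
have L0 : 0 <= L by rewrite addr_ge0// divr_ge0 ?nc_ge0// ltW.
exists (C ^+ 2 * K ^+ 2 + 2 * L ^+ 2 * (1 + nc (F w) ^+ 2)).
  by rewrite addr_ge0 ?mulr_ge0 ?sqr_ge0// addr_ge0// sqr_ge0.
move=> z z0.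
have zi : z != - 'i.
  by apply: neq_of_Im; rewrite ImN /= (lt_le_trans _ z0)// oppr_lt0.
have n0 : 0 < nc (z - - 'i) by rewrite nc_gt0 subr_eq0.
have tri : nc (z - - 'i) <= nc (z - w) + nc (w - - 'i).
  by rewrite (le_trans _ (ncD _ _))// addrA subrK.
have sq1 (t : R) : 0 <= t ^+ 2 + 1 by rewrite addr_ge0// sqr_ge0.
have pos1 : 0 <= C ^+ 2 * K ^+ 2 * (nc (F z) ^+ 2 + 1).
  by apply: mulr_ge0 => //; apply: mulr_ge0; exact: sqr_ge0.
have pos2 : 0 <= 2 * L ^+ 2 * (1 + nc (F w) ^+ 2) * (nc (F z) ^+ 2 + 1).
  apply: mulr_ge0 => //; rewrite [1 + _]addrC; apply: mulr_ge0 => //.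
  by rewrite pmulr_rge0// sqr_ge0.
rewrite ncV exprVn mulrA ler_pdivlMr ?exprn_gt0// -exprMn mulrDl.
have [zr|rz] := ltP (nc (z - w)) r.
  have dC : nc (diff_quot F w d z) <= C.
    rewrite /diff_quot; case: eqVneq => [_|zw]; first by rewrite lerDl.
    have h0 : z - w != 0 by rewrite subr_eq0.
    have -> : (F z - F w) / (z - w) = d + (F z - F w - d * (z - w)) / (z - w).
      by field.
    apply: (le_trans (ncD _ _)); rewrite lerD2l ncM ncV ler_pdivrMr ?nc_gt0//.
    exact: H.
  have zK : nc (z - - 'i) <= K by apply: (le_trans tri); rewrite /K; lra.
  apply: (@le_trans _ _ (C ^+ 2 * K ^+ 2 * (nc (F z) ^+ 2 + 1))).
    rewrite mulrDr mulr1 -exprMn ler_wpDl//.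
      by apply: mulr_ge0; exact: sqr_ge0.
    rewrite ler_sqr ?nnegrE ?mulr_ge0 ?nc_ge0//.
    by rewrite ler_pM ?nc_ge0.
  by rewrite lerDl; exact: pos2.
have zw : z != w.
  by apply: contraTneq rz => ->; rewrite subrr nc0 -ltNge.
have d0 : 0 < nc (z - w) by rewrite nc_gt0 subr_eq0.
have zL : nc (z - - 'i) <= nc (z - w) * L.
  apply: (le_trans tri); rewrite /L mulrDr mulr1 lerD2l mulrCA ler_peMr ?nc_ge0//.
  by rewrite ler_pdivlMr// mul1r.
rewrite /diff_quot (negbTE zw) ncM ncV.
apply: (@le_trans _ _ (2 * L ^+ 2 * (1 + nc (F w) ^+ 2) * (nc (F z) ^+ 2 + 1)));
  last by rewrite lerDr; exact: pos1.
apply: (@le_trans _ _ (((nc (F z) + nc (F w)) * L) ^+ 2)).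
  rewrite ler_sqr ?nnegrE; last 2 first.
  - by rewrite mulr_ge0 ?nc_ge0// mulr_ge0 ?nc_ge0// invr_ge0 nc_ge0.
  - by apply: mulr_ge0 => //; apply: addr_ge0; exact: nc_ge0.
  rewrite -mulrA ler_pM ?nc_ge0 ?mulr_ge0 ?invr_ge0 ?nc_ge0 ?ncB//.
  by rewrite mulrC ler_pdivrMr// mulrC.
have := sqr_ge0 (nc (F z) - nc (F w)); have := sqr_ge0 (nc (F z)).
have := sqr_ge0 (nc (F w)); have := sqr_ge0 (nc (F z) * nc (F w)).
have := sqr_ge0 L.
rewrite !exprMn; move: (nc (F z)) (nc (F w)) => s t.
move: (L ^+ 2) => l l0 h1 h2 h3 h4.
have -> : (s + t) ^+ 2 * l = l * (s + t) ^+ 2 by ring.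
have -> : 2 * l * (1 + t ^+ 2) * (s ^+ 2 + 1) = l * (2 * (1 + t ^+ 2) * (s ^+ 2 + 1)) by ring.
apply: ler_wpM2l => //.
have : 0 <= s ^+ 2 * t ^+ 2 by [].
by nra.
Qed.

Lemma sq_integrable_dom (g h : R -> R[i]) (K : R) : ccts h ->
  (forall x, nc (h x) ^+ 2 <= K * nc (g x) ^+ 2) -> sq_integrable g ->
  sq_integrable h /\ sq_int h <= K * sq_int g.
Proof.
move=> ch hg ig.
have iK : mu.-integrable setT (EFin \o (fun x => K * nc (g x) ^+ 2)).
  by have := integrableZl measurableT K ig; apply: eq_integrable.
have ih : sq_integrable h.
  apply: (le_integrable measurableT _ _ iK).
    by apply/measurable_EFinP; apply: continuous_measurable_fun; exact: continuous_sq_nc.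
  move=> x _ /=; rewrite lee_fin ger0_norm ?sqr_ge0// (le_trans (hg x))//.
  exact: ler_norm.
split => //; rewrite /sq_int -RintegralZl//; apply: le_Rintegral => //.
Qed.

(** The hypothesis covers both square integrable and bounded F, since 1 / (z + i)
    is square integrable on horizontal lines. *)
Lemma diff_quot_hardy P F w d (M : R) : 0 < complex.Im w -> cderiv F w d ->
  (forall z, 0 <= complex.Im z -> ccont F z) ->
  (forall z, 0 <= complex.Im z -> z \notin P -> cdiff F z) ->
  (forall y, 0 <= y -> (\int[mu]_x (((nc (F (x +i* y)) ^+ 2 + 1)
     * nc ((x +i* y) - - 'i)^-1 ^+ 2)%:E) <= M%:E)%E) ->
  exists M' : R, hardy_bounded (w :: P) (diff_quot F w d) M'.
Proof.
move=> w0 dF cF cdF le; have [A A0 H] := diff_quot_bound w0 dF.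
exists (A * M); split.
- by move=> z z0; apply: diff_quot_ccont => //; exact: cF.
- move=> z z0; rewrite inE negb_or => /andP[zw zP].
  by apply: diff_quot_cdiff => //; exact: cdF.
- move=> y y0; apply: sq_integrable_le.
    by apply: ccts_line => z zy; apply: diff_quot_ccont => //; apply: cF; rewrite zy.
  have cl : ccts (fun x => F (x +i* y)).
    by apply: ccts_line => z zy; apply: cF; rewrite zy.
  have iy : complex.Im (- 'i : R[i]) != y by rewrite ImN/= lt_eqF// (lt_le_trans _ y0)// oppr_lt0.
  have [k1 k2 k3] := cauchy_kernel iy.
  have m1 : measurable_fun setT (EFin \o (fun x => (nc (F (x +i* y)) ^+ 2 + 1)
     * nc ((x +i* y) - - 'i)^-1 ^+ 2)).
    apply/measurable_EFinP; apply: continuous_measurable_fun => x.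
    apply: cvgM; last exact: (continuous_sq_nc k1).
    by apply: cvgD; [exact: (continuous_sq_nc cl)|exact: cvg_cst].
  have p0 x : 0 <= (nc (F (x +i* y)) ^+ 2 + 1) * nc ((x +i* y) - - 'i)^-1 ^+ 2.
    by apply: mulr_ge0; [rewrite addr_ge0// sqr_ge0|exact: sqr_ge0].
  apply: (@le_trans _ _ (\int[mu]_x (A%:E * ((nc (F (x +i* y)) ^+ 2 + 1)
     * nc ((x +i* y) - - 'i)^-1 ^+ 2)%:E)%E)%E).
    apply: ge0_le_integral => //.
    + by move=> x _; rewrite lee_fin sqr_ge0.
    + apply/measurable_EFinP; apply: continuous_measurable_fun.
      apply: continuous_sq_nc; apply: ccts_line => z zy.
      by apply: diff_quot_ccont => //; apply: cF; rewrite zy.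
    + exact: measurable_funeM.
    + by move=> x _; rewrite -EFinM lee_fin; exact: H.
  rewrite ge0_integralZl ?lee_fin//; last by move=> x _; rewrite lee_fin p0.
  by rewrite EFinM lee_wpmul2l ?lee_fin//; exact: le.
Qed.

Lemma hardy_bounded_add P Q F (G : R[i] -> R[i]) (a : R[i]) M N :
  hardy_bounded P F M -> hardy_bounded Q G N ->
  exists M', hardy_bounded (P ++ Q) (fun z => F z + a * G z) M'.
Proof.
move=> hF hG; exists (2 * (M + nc a ^+ 2 * N)).
have cFG z : 0 <= complex.Im z -> ccont (fun z => F z + a * G z) z.
  move=> z0; apply: ccontD; first exact: (hb_cont hF).
  by apply: ccontM; [exact: ccont_cst|exact: (hb_cont hG)].
split => //.
- move=> z z0; rewrite mem_cat negb_or => /andP[zP zQ]; apply: cdiffD.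
    exact: (hb_diff hF).
  by apply: cdiffM; [exact: cdiff_cst|exact: (hb_diff hG)].
move=> y y0; have [f1 f2] := hb_sq hF y0; have [g1 g2] := hb_sq hG y0.
have cl : ccts (fun x => F (x +i* y) + a * G (x +i* y)).
  by apply: (@ccts_line _ (fun z => F z + a * G z)) => z zy; apply: cFG; rewrite zy.
have i1 : mu.-integrable setT (EFin \o (fun x => 2 * nc (F (x +i* y)) ^+ 2)).
  by have := integrableZl measurableT 2 f1; apply: eq_integrable.
have i2 : mu.-integrable setT (EFin \o (fun x => (2 * nc a ^+ 2) * nc (G (x +i* y)) ^+ 2)).
  by have := integrableZl measurableT (2 * nc a ^+ 2) g1; apply: eq_integrable.
have iA : mu.-integrable setT (EFin \o (fun x => 2 * nc (F (x +i* y)) ^+ 2 +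
    (2 * nc a ^+ 2) * nc (G (x +i* y)) ^+ 2)).
  by have := integrableD measurableT i1 i2; apply: eq_integrable.
have dom x : nc (F (x +i* y) + a * G (x +i* y)) ^+ 2 <= 2 * nc (F (x +i* y)) ^+ 2 +
    (2 * nc a ^+ 2) * nc (G (x +i* y)) ^+ 2.
  apply: (@le_trans _ _ ((nc (F (x +i* y)) + nc a * nc (G (x +i* y))) ^+ 2)).
    rewrite ler_sqr ?nnegrE ?nc_ge0 ?addr_ge0 ?mulr_ge0 ?nc_ge0//.
    by rewrite -ncM ncD.
  set p := nc (F _); set q := nc a; set r := nc (G _).
  rewrite -subr_ge0.
  have -> : 2 * p ^+ 2 + 2 * q ^+ 2 * r ^+ 2 - (p + q * r) ^+ 2 = (p - q * r) ^+ 2 by ring.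
  exact: sqr_ge0.
have iH : sq_integrable (fun x => F (x +i* y) + a * G (x +i* y)).
  apply: (le_integrable measurableT _ _ iA).
    by apply/measurable_EFinP; apply: continuous_measurable_fun; exact: continuous_sq_nc.
  move=> x _ /=; rewrite lee_fin ger0_norm ?sqr_ge0// (le_trans (dom x))//.
  exact: ler_norm.
split => //; apply: (@le_trans _ _ (\int[mu]_x (2 * nc (F (x +i* y)) ^+ 2 +
    (2 * nc a ^+ 2) * nc (G (x +i* y)) ^+ 2))).
  by apply: le_Rintegral.
rewrite RintegralD// !RintegralZl// mulrDr mulrA.
by apply: lerD; [rewrite ler_pM2l|rewrite ler_wpM2l// mulr_ge0// sqr_ge0].
Qed.

Lemma CI_ge0 (k : R -> R) (c : R) : continuous k ->
  (forall x, 0 <= k x) -> (\int[mu]_x (k x)%:E = c%:E)%E ->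
  line_integrable (fun x => (k x)%:C) /\ CI (fun x => (k x)%:C) = c%:C.
Proof.
move=> ck k0 E.
have ik : mu.-integrable setT (EFin \o k).
  apply/integrableP; split.
    by apply/measurable_EFinP; exact: continuous_measurable_fun.
  under eq_integral do rewrite /= ger0_norm//.
  by rewrite E ltry.
have [//|//|l ->] := @CI_realE R (fun x => (k x)%:C) k (fun=> 0) ik.
  exact: integrable0.
split => //; congr (_ +i* _); first by rewrite /Rintegral E.
by rewrite /Rintegral integral0.
Qed.

Lemma cauchy_kernel_sq w : 0 < complex.Im w ->
  line_integrable (fun x => ((x +i* 0 - w) * (x +i* 0 - w^*))^-1) /\
  CI (fun x => ((x +i* 0 - w) * (x +i* 0 - w^*))^-1) = (pi / complex.Im w)%:C.
Proof.
move=> w0; pose k x := ((x - complex.Re w) ^+ 2 + complex.Im w ^+ 2)^-1.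
have E : (fun x => ((x +i* 0 - w) * (x +i* 0 - w^*))^-1) = (fun x => (k x)%:C).
  apply/funext => x; rewrite /k fmorphV /=; congr (_^-1).
  by case: (w) => u v; apply: eqC => /=; ring.
rewrite E; apply: CI_ge0.
- move=> x; apply: cvgV.
    by rewrite gt_eqF// ltr_wpDl ?sqr_ge0// exprn_gt0.
  apply: cvgD; last exact: cvg_cst.
  by rewrite /=; apply: cvgM; apply: cvgB; (exact: cvg_id || exact: cvg_cst).
- by move=> x; rewrite invr_ge0 addr_ge0// sqr_ge0.
- exact: poisson_integral.
Qed.

Lemma hardy_kernel_integrable P F M w : hardy_bounded P F M -> 0 < complex.Im w ->
  line_integrable (fun x => F (x +i* 0) * (x +i* 0 - w)^-1).
Proof.
move=> hF w0; have wy : complex.Im w != 0 by rewrite gt_eqF.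
have [k1 k2 k3] := cauchy_kernel wy; have [f1 f2] := hb_sq hF (lexx 0).
have f0 : ccts (fun x => F (x +i* 0)).
  by apply: ccts_line => z zy; apply: (hb_cont hF); rewrite zy.
by have [] := CI_mul f0 k1 f1 k2 ltr01.
Qed.

(** With c the conjugate of w, the function G = F + (w - c) (F - F w) / (z - w) is
    again in the class, so the integral of G / (x - c) vanishes. It equals the integral
    of F / (x - w) minus F w times that of (w - c) / |x - w|^2, which is 2 pi i. *)
Theorem hardy_cauchy P F M w : hardy_bounded P F M -> 0 < complex.Im w ->
  w \notin P ->
  CI (fun x => F (x +i* 0) * (x +i* 0 - w)^-1) = (2 * pi)%:C * 'i * F w.
Proof.
move=> hF w0 wP.
have [d dF] : cdiff F w by apply: (hb_diff hF) => //; exact: ltW.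
have [||M1 h1] := @diff_quot_hardy P F w d (M + pi) w0 dF (hb_cont hF).
- by move=> z; exact: (hb_diff hF).
- move=> y y0; have iy : complex.Im (- 'i : R[i]) != y.
    by rewrite ImN/= lt_eqF// (lt_le_trans _ y0)// oppr_lt0.
  have [k1 k2 k3] := cauchy_kernel iy; have [f1 f2] := hb_sq hF y0.
  have iA : mu.-integrable setT (EFin \o (fun x => nc (F (x +i* y)) ^+ 2 +
      nc ((x +i* y) - - 'i)^-1 ^+ 2)).
    by have := integrableD measurableT f1 k2; apply: eq_integrable.
  apply: (@le_trans _ _ (\int[mu]_x (nc (F (x +i* y)) ^+ 2 +
      nc ((x +i* y) - - 'i)^-1 ^+ 2)%:E)%E).
    apply: ge0_le_integral => //.
    + move=> x _; rewrite lee_fin; apply: mulr_ge0; last exact: sqr_ge0.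
      by rewrite addr_ge0// sqr_ge0.
    + apply/measurable_EFinP; apply: continuous_measurable_fun => x.
      apply: cvgM; last exact: (continuous_sq_nc k1).
      apply: cvgD; last exact: cvg_cst.
      apply: (@continuous_sq_nc _ (fun x => F (x +i* y))).
      by apply: ccts_line => z zy; apply: (hb_cont hF); rewrite zy.
    + exact: (measurable_int mu iA).
    move=> x _; rewrite lee_fin mulrDl mul1r lerD2r ler_piMr ?sqr_ge0//.
    rewrite ncV exprVn invf_le1; last first.
      rewrite exprn_gt0// nc_gt0 subr_eq0; apply: neq_of_Im.
      by rewrite ImN/= (lt_le_trans _ y0)// oppr_lt0.
    rewrite sqr_nc (le_trans _ (_ : complex.Im (x +i* y - - 'i) ^+ 2 <= _))//=.
      by rewrite opprK; have := sqr_ge0 y; nra.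
    by rewrite lerDr sqr_ge0.
  rewrite EFin_Rintegral// lee_fin RintegralD// lerD// -/(sq_int _) k3 ImN/= opprK.
  rewrite ger0_norm ?addr_ge0// ler_pdivrMr ?ltr_wpDl//.
  by rewrite ler_peMr ?pi_ge0// lerDr.
have [M2 h2] := hardy_bounded_add (w - w^*) hF h1.
have wJ : complex.Im w^* < 0 by rewrite ImJ oppr_lt0.
have := hardy_cauchy_null h2 wJ.
have [ck kE] := cauchy_kernel_sq w0.
have [lk lE] := CI_scale (F w * (w - w^*)) ck.
have E : (fun x => (F (x +i* 0) + (w - w^*) * diff_quot F w d (x +i* 0)) * (x +i* 0 - w^*)^-1)
  = (fun x => F (x +i* 0) * (x +i* 0 - w)^-1 -
      F w * (w - w^*) * ((x +i* 0 - w) * (x +i* 0 - w^*))^-1).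
  apply/funext => x.
  have xw : x +i* 0 != w.
    by rewrite eq_sym; apply: neq_of_Im.
  have xwJ : x +i* 0 != w^* by apply: neq_of_Im; rewrite ImJ oppr_lt0.
  have n1 : x +i* 0 - w != 0 by rewrite subr_eq0.
  have n2 : x +i* 0 - w^* != 0 by rewrite subr_eq0.
  rewrite /diff_quot (negbTE xw); move: (x +i* 0) (w^*) n1 n2 => z c n1 n2.
  by field; rewrite n1 n2.
rewrite E (proj2 (CI_sub (hardy_kernel_integrable hF w0) lk)) lE kE.
move=> /eqP; rewrite subr_eq0 => /eqP ->.
have -> : w - w^* = (2 * complex.Im w)%:C * 'i.
  by case: (w) => u v; apply: eqC => /=; ring.
have wn : complex.Im w != 0 by rewrite gt_eqF.
have -> : (2 * pi : R) = 2 * complex.Im w * (pi / complex.Im w).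
  by move: (pi : R) => q; field.
by rewrite rmorphM /=; ring.
Qed.

End DiffQuot.

(** * Removable singularities and boundary values *)

Section Removable.
Variable R : realType.
Local Notation "x ^*" := (conjc x) : ring_scope.
Local Notation "''i'" := (Complex 0 1) : ring_scope.
Implicit Types (z w v p : R[i]) (a b c x y : R) (F : R[i] -> R[i]).
Local Notation mu := (@lebesgue_measure R).
Local Notation CI := (@complex_integral R).

Lemma isolating_radius (P : seq R[i]) p : exists2 r : R, 0 < r &
  forall w, nc (w - p) < r -> w != p -> w \notin P.
Proof.
elim: P => [|q P [r r0 IH]]; first by exists 1.
have [->|qp] := eqVneq q p.
  by exists r => // w wr wp; rewrite inE negb_or wp IH.
exists (Num.min r (nc (q - p))); first by rewrite lt_min r0 nc_gt0 subr_eq0.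
move=> w; rewrite lt_min => /andP[wr wq] wp; rewrite inE negb_or IH// andbT.
by apply: contraTneq wq => ->; rewrite ltxx.
Qed.

(** The difference quotient of 1 / (x - w) at p differs from 1 / (x - p)^2 by
    (w - p) / ((x - p)^2 (x - w)), which is square integrable in x uniformly for w
    near p. *)
Lemma cauchy_transform_cdiff P F M p : hardy_bounded P F M -> 0 < complex.Im p ->
  cdiff (fun w => CI (fun x => F (x +i* 0) * (x +i* 0 - w)^-1)) p.
Proof.
move=> hF p0; have [f1 f2] := hb_sq hF (lexx 0).
have f0 : ccts (fun x => F (x +i* 0)).
  by apply: ccts_line => z zy; apply: (hb_cont hF); rewrite zy.
pose m := complex.Im p.
have py : complex.Im p != 0 by rewrite gt_eqF.
have [kp1 kp2 kp3] := cauchy_kernel py.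
have Im_le w x : `|complex.Im w| <= nc (x +i* 0 - w).
  by rewrite (le_trans _ (normIm_nc _))// ImD ImN /= add0r normrN.
have xn x w : complex.Im w != 0 -> x +i* 0 - w != 0.
  by move=> w0; rewrite -nc_gt0 (lt_le_trans _ (Im_le w x))// normr_gt0.
have dom (h : R -> R[i]) (K : R) : 0 <= K -> ccts h ->
    (forall x, nc (h x) <= K * nc (x +i* 0 - p)^-1) ->
    sq_integrable h /\ sq_int h <= K ^+ 2 * (pi / m).
  move=> K0 ch hk; rewrite (_ : pi / m = sq_int (fun x => (x +i* 0 - p)^-1)); last first.
    by rewrite kp3 sub0r normrN gtr0_norm.
  apply: sq_integrable_dom => // x.
  by rewrite -exprMn ler_sqr ?nnegrE ?nc_ge0// mulr_ge0 ?nc_ge0.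
have ck w : complex.Im w != 0 -> ccts (fun x => (x +i* 0 - w)^-1).
  by move=> /cauchy_kernel[].
have m0 : 0 < m := p0.
have mV0 : 0 < m^-1 by rewrite invr_gt0.
have le_m x : nc (x +i* 0 - p)^-1 <= m^-1.
  rewrite ncV lef_pV2 ?posrE ?nc_gt0 ?xn//.
  by rewrite (le_trans _ (Im_le p x))// gtr0_norm.
have s1 : sq_integrable (fun x => (x +i* 0 - p)^-1 * (x +i* 0 - p)^-1).
  apply: (proj1 (dom _ _ (ltW mV0) (ccts_mul kp1 kp1) _)) => x.
  by rewrite ncM ler_wpM2r ?nc_ge0.
pose K := m^-1 * (2 * m^-1).
have K0 : 0 <= K by rewrite !mulr_ge0// ltW.
have h w : nc (w - p) < m / 2 -> complex.Im w != 0 /\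
    sq_integrable (fun x => (x +i* 0 - p)^-1 * (x +i* 0 - p)^-1 * (x +i* 0 - w)^-1) /\
    sq_int (fun x => (x +i* 0 - p)^-1 * (x +i* 0 - p)^-1 * (x +i* 0 - w)^-1) <= K ^+ 2 * (pi / m).
  move=> wp; have w0 : m / 2 < complex.Im w.
    have := le_lt_trans (normIm_nc _) wp; rewrite ImD ImN ltr_norml -/m => /andP[h1 _].
    lra.
  have wn : complex.Im w != 0 by rewrite gt_eqF// (lt_trans _ w0)// divr_gt0.
  split => //; apply: dom => //.
    by apply: ccts_mul (ccts_mul kp1 kp1) (ck _ wn).
  move=> x; rewrite !ncM mulrAC; apply: ler_wpM2r; first exact: nc_ge0.
  apply: ler_pM; rewrite ?nc_ge0// ncV.
  rewrite -[2]invrK -invfM lef_pV2 ?posrE ?nc_gt0 ?xn// ?mulr_gt0 ?invr_gt0//.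
  rewrite mulrC (le_trans (ltW w0))// (le_trans _ (Im_le w x))//.
  exact: ler_norm.
pose C := sq_int (fun x => F (x +i* 0)) + K ^+ 2 * (pi / m) + 1.
have C0 : 0 < C.
  rewrite ltr_wpDl// addr_ge0//.
    by apply: Rintegral_ge0 => x _; exact: sqr_ge0.
  by apply: mulr_ge0; [exact: sqr_ge0|rewrite divr_ge0 ?pi_ge0// ltW].
exists (CI (fun x => F (x +i* 0) * ((x +i* 0 - p)^-1 * (x +i* 0 - p)^-1))) => eps eps0.
exists (Num.min (m / 2) (eps / C)); first by rewrite lt_min !divr_gt0.
move=> w; rewrite lt_min => /andP[/h[wn [hs hC]] weps].
have [kw1 kw2 _] := cauchy_kernel wn.
have [lw _] := CI_mul f0 kw1 f1 kw2 ltr01.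
have [lp _] := CI_mul f0 kp1 f1 kp2 ltr01.
have [l2 _] := CI_mul f0 (ccts_mul kp1 kp1) f1 s1 ltr01.
have [l3 b3] := CI_mul f0 (ccts_mul (ccts_mul kp1 kp1) (ck _ wn)) f1 hs ltr01.
have [l2' E2] := CI_scale (w - p) l2.
have [l3' E3] := CI_scale ((w - p) ^+ 2) l3.
have [l4 E4] := CI_sub lw lp.
have [l5 E5] := CI_sub l4 l2'.
rewrite [_ * (w - p)]mulrC -E2 -E4 -E5.
have -> : (fun x => F (x +i* 0) * (x +i* 0 - w)^-1 - F (x +i* 0) * (x +i* 0 - p)^-1 -
    (w - p) * (F (x +i* 0) * ((x +i* 0 - p)^-1 * (x +i* 0 - p)^-1))) =
  (fun x => (w - p) ^+ 2 * (F (x +i* 0) * ((x +i* 0 - p)^-1 * (x +i* 0 - p)^-1 * (x +i* 0 - w)^-1))).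
  apply/funext => x; have := xn x w wn; have := xn x p py.
  by move: (x +i* 0) => z n1 n2; field; rewrite n1 n2.
rewrite E3 expr2 !ncM mulrAC; apply: ler_wpM2r; first exact: nc_ge0.
apply: (@le_trans _ _ (nc (w - p) * C)).
  rewrite ler_wpM2l ?nc_ge0// (le_trans b3)// /C invr1 !mul1r.
  by rewrite -addrA lerD2l (le_trans hC)// lerDl.
by rewrite -ler_pdivlMr// ltW.
Qed.

(** Away from the exceptional points F is its own Cauchy integral, by continuity
    also at p, and Cauchy integrals are differentiable. *)
Theorem hardy_removable P F M p : hardy_bounded P F M -> 0 < complex.Im p -> cdiff F p.
Proof.
move=> hF p0; pose T w := ((2 * pi)%:C * 'i)^-1 * CI (fun x => F (x +i* 0) * (x +i* 0 - w)^-1).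
have dT : cdiff T p.
  by apply: cdiffM; [exact: cdiff_cst|exact: (cauchy_transform_cdiff hF)].
have [r r0 rP] := isolating_radius P p.
pose r' := Num.min r (complex.Im p).
have r'0 : 0 < r' by rewrite lt_min r0.
have c0 : (2 * pi)%:C * 'i != 0 :> R[i].
  rewrite mulf_neq0//; last by rewrite eq_complex/= oner_eq0 andbF.
  by rewrite eq_complex/= eqxx andbT mulf_neq0// gt_eqF// pi_gt0.
have FT w : nc (w - p) < r' -> w != p -> F w = T w.
  rewrite lt_min => /andP[wr wi] wp; rewrite /T (hardy_cauchy hF).
  - by rewrite mulKf.
  - have := le_lt_trans (normIm_nc _) wi; rewrite ImD ImN ltr_norml => /andP[h1 _].
    lra.
  - exact: rP.
have Fp : F p = T p.
  apply: (ccont_dense_eq (hb_cont hF (ltW p0)) (cdiff_ccont dT)) => del del0.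
  have m0 : 0 < Num.min r' del by rewrite lt_min r'0.
  have [w] := punctured_point p m0; rewrite lt_min => /andP[wr wd] wp.
  by exists w => //; exact: FT.
apply: (cdiff_eq r'0 _ dT) => w wr.
by have [->|wp] := eqVneq w p; [rewrite Fp|rewrite FT].
Qed.

(** The bound on the real line itself follows from those above it by the lemma of
    Fatou. *)
Lemma hardy_bounded_of_hardy2 F : (forall z, 0 <= complex.Im z -> cdiff F z) -> hardy2 F ->
  exists M, hardy_bounded [::] F M.
Proof.
move=> dF [_ [M HM]].
have cF z : 0 <= complex.Im z -> ccont F z by move=> /dF; exact: cdiff_ccont.
exists M; split => // [z z0 _|y y0]; first exact: dF.
apply: sq_integrable_le; first by apply: ccts_line => z zy; apply: cF; rewrite zy.
move: y0; rewrite le_eqVlt => /predU1P[<-|]; last exact: HM.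
have mf (n : nat) : measurable_fun setT (fun x => (nc (F (x +i* n.+1%:R^-1)) ^+ 2)%:E).
  apply/measurable_EFinP; apply: continuous_measurable_fun.
  apply: (@continuous_sq_nc _ (fun x => F (x +i* n.+1%:R^-1))).
  by apply: ccts_line => z zy; apply: cF; rewrite zy invr_ge0.
have f0 (n : nat) (x : R) : setT x -> (0 <= (nc (F (x +i* n.+1%:R^-1)) ^+ 2)%:E)%E.
  by move=> _; rewrite lee_fin sqr_ge0.
have := fatou mu measurableT mf f0.
have lim x : limn_einf (fun n => (nc (F (x +i* n.+1%:R^-1)) ^+ 2)%:E) = (nc (F (x +i* 0)) ^+ 2)%:E.
  have c : (nc (F (x +i* n.+1%:R^-1)) ^+ 2)%:E @[n --> \oo] --> (nc (F (x +i* 0)) ^+ 2)%:E.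
    apply: cvg_EFin; first exact: nearW.
    rewrite /comp /=.
    have cF2 : {for 0, continuous (fun y => nc (F (x +i* Num.max y 0)) ^+ 2)}.
      apply: (@continuous_sq_nc _ (fun y => F (clamp (x +i* y)))).
      split=> s; [apply: (proj1 (@ccont_line _ (fun z => F (clamp z)) (fun t => x +i* t) s _ _))
                 |apply: (proj2 (@ccont_line _ (fun z => F (clamp z)) (fun t => x +i* t) s _ _))].
      + by move=> s'; exact: nc_vline.
      + exact: (ccont_clamp cF).
      + by move=> s'; exact: nc_vline.
      + exact: (ccont_clamp cF).
    have := cvg_comp _ _ (@cvg_harmonic R) cF2.
    rewrite maxxx; apply: cvg_trans; apply: near_eq_cvg.
    apply: nearW => n /=; rewrite max_l// ?invr_ge0//.
  by rewrite (cvg_limn_einf_sup c).1.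
under eq_integral do rewrite lim.
move=> /le_trans; apply.
rewrite limn_einf_lim; apply: lime_le; first exact: is_cvg_einfs.
apply: nearW => n.
apply: (@le_trans _ _ (\int[mu]_x (nc (F (x +i* n.+1%:R^-1)) ^+ 2)%:E)%E).
  by apply: ereal_inf_lbound; exists n => //=.
by apply: HM; rewrite invr_gt0.
Qed.

End Removable.

(** * The candidate for the reproducing kernel *)

Section KernelFormula.
Variable R : realType.
Local Notation "x ^*" := (conjc x) : ring_scope.
Local Notation "''i'" := (Complex 0 1) : ring_scope.
Variable e : R[i] -> R[i].
Hypothesis HBe : hermite_biehler e.
Hypothesis e_real : forall x : R, e x%:C != 0.
Implicit Types (z w v p : R[i]) (a b c x y : R) (f g F : R[i] -> R[i]).
Local Notation mu := (@lebesgue_measure R).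
Local Notation CI := (@complex_integral R).

Lemma entire_cdiff f z : entire f -> cdiff f z.
Proof. by move=> /(_ z) /cdiffP. Qed.

Lemma sharp_real f x : sharp f x%:C = (f x%:C)^*.
Proof. by rewrite /sharp conjc_real. Qed.

Lemma HB_lt z : 0 < complex.Im z -> nc (e z^*) < nc (e z).
Proof. by move=> /(proj2 HBe); rewrite !nc_norm ltcR. Qed.

Lemma real_of_Im0 z : complex.Im z = 0 -> z = (complex.Re z)%:C.
Proof. by case: z => a b /= ->. Qed.

Lemma HB_neq0 z : 0 <= complex.Im z -> e z != 0.
Proof.
rewrite le_eqVlt => /predU1P[/esym/real_of_Im0 ->|/HB_lt zlt]; first exact: e_real.
by rewrite -nc_gt0 (le_lt_trans _ zlt)// nc_ge0.
Qed.

Lemma sharp_le z : 0 <= complex.Im z -> nc (sharp e z) <= nc (e z).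
Proof.
rewrite /sharp ncJ le_eqVlt => /predU1P[/esym/real_of_Im0 ->|/HB_lt/ltW//].
by rewrite conjc_real.
Qed.

Lemma sharp_entire_cdiff f z : entire f -> cdiff (sharp f) z.
Proof. by move=> ef; apply: cdiff_sharp; exact: entire_cdiff. Qed.

Let e_cdiff z : cdiff e z := entire_cdiff z (proj1 HBe).
Let esh_cdiff z : cdiff (sharp e) z := sharp_entire_cdiff z (proj1 HBe).

Lemma quot_cdiff f z : 0 <= complex.Im z -> cdiff f z -> cdiff (fun u => f u / e u) z.
Proof.
by move=> z0 df; apply: cdiffM => //; apply: cdiffV => //; exact: HB_neq0.
Qed.

Lemma space_hardy_bounded f : space_of e f ->
  exists M, hardy_bounded [::] (fun z => f z / e z) M.
Proof.
move=> [ef hf _]; apply: hardy_bounded_of_hardy2 => // z z0.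
by apply: quot_cdiff => //; exact: entire_cdiff.
Qed.

Lemma space_hardy_bounded_sharp f : space_of e f ->
  exists M, hardy_bounded [::] (fun z => sharp f z / e z) M.
Proof.
move=> [ef _ hf]; apply: hardy_bounded_of_hardy2 => // z z0.
by apply: quot_cdiff => //; exact: sharp_entire_cdiff.
Qed.

Lemma hardy2_of_bounded P F (M : R) : (forall z, 0 < complex.Im z -> cdiff F z) ->
  hardy_bounded P F M -> hardy2 F.
Proof.
move=> dF hF; split; first by move=> z z0; apply/cdiffP; exact: dF.
exists M => y y0; have [i le] := hb_sq hF (ltW y0).
have -> : (\int[mu]_x ((Normc.normc (F (x +i* y)) ^+ 2)%:E) =
    (sq_int (fun x => F (x +i* y)))%:E)%E.
  by rewrite /sq_int /Rintegral fineK//; exact: integrable_fin_num.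
by rewrite lee_fin.
Qed.

Section AtPoint.
Variable w : R[i].
Hypothesis w0 : 0 < complex.Im w.

Let c0 : R[i] := 'i / (2 * pi)%:C.
Let ratio z := sharp e z / e z.

Lemma ratio_le1 z : 0 <= complex.Im z -> nc (ratio z) <= 1.
Proof.
move=> z0; rewrite /ratio ncM ncV ler_pdivrMr ?nc_gt0 ?HB_neq0// mul1r.
exact: sharp_le.
Qed.

Lemma ratio_cdiff z : 0 <= complex.Im z -> cdiff ratio z.
Proof. by move=> z0; apply: quot_cdiff. Qed.

(** The ratio of the reflection of e to e is bounded by 1 in the upper half-plane, so its
    difference quotient is square integrable on horizontal lines. *)
Lemma ratio_diff_quot_hardy d : cderiv ratio w d ->
  exists M, hardy_bounded [:: w] (diff_quot ratio w d) M.
Proof.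
move=> dB; apply: (@diff_quot_hardy _ [::] ratio w d (2 * pi)) => //.
- by move=> z z0; exact/cdiff_ccont/ratio_cdiff.
- by move=> z z0 _; exact: ratio_cdiff.
move=> y y0; have iy : complex.Im (- 'i : R[i]) != y.
  by rewrite ImN/= lt_eqF// (lt_le_trans _ y0)// oppr_lt0.
have [k1 k2 k3] := cauchy_kernel iy.
have i2 : mu.-integrable setT (EFin \o (fun x => 2 * nc ((x +i* y) - - 'i)^-1 ^+ 2)).
  by have := integrableZl measurableT 2 k2; apply: eq_integrable.
apply: (@le_trans _ _ (\int[mu]_x (2 * nc ((x +i* y) - - 'i)^-1 ^+ 2)%:E)%E).
  apply: ge0_le_integral => //.
  - move=> x _; rewrite lee_fin; apply: mulr_ge0; last exact: sqr_ge0.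
    by rewrite addr_ge0// sqr_ge0.
  - apply/measurable_EFinP; apply: continuous_measurable_fun => x.
    apply: cvgM; last exact: (continuous_sq_nc k1).
    apply: cvgD; last exact: cvg_cst.
    apply: (@continuous_sq_nc _ (fun x => ratio (x +i* y))).
    by apply: ccts_line => z zy; apply/cdiff_ccont/ratio_cdiff; rewrite zy.
  - exact: (measurable_int mu i2).
  move=> x _; rewrite lee_fin; apply: ler_wpM2r; first exact: sqr_ge0.
  rewrite -[leRHS]/(1 + 1) lerD2r expr_le1 ?nc_ge0//.
  exact: ratio_le1.
rewrite EFin_Rintegral// lee_fin RintegralZl// -/(sq_int _) k3 ImN/= opprK.
rewrite ler_pM2l// ger0_norm ?addr_ge0// ler_pdivrMr ?ltr_wpDl//.
by rewrite ler_peMr ?pi_ge0// lerDr.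
Qed.

(** The reflection L of the kernel at w has an apparent pole at w, a point of the
    upper half-plane. There L / e is a multiple of the difference quotient of the ratio of
    the reflection of e to e, so the pole is removable and L / e is in the Hardy space. *)
Lemma kernel_sharp_ex : exists L, [/\ entire L, hardy2 (fun z => L z / e z) &
  forall z, (z - w) * L z = c0^* * (sharp e z * e w - e z * sharp e w)].
Proof.
have [d dB] := ratio_cdiff (ltW w0); have [M hM] := ratio_diff_quot_hardy dB.
have cD := hardy_removable hM w0.
pose N z := c0^* * (sharp e z * e w - e z * sharp e w).
have Nw : N w = 0 by rewrite /N [e w * _]mulrC subrr mulr0.
pose L := diff_quot N w (c0^* * e w * e w * d).
have LD z : 0 <= complex.Im z -> L z = c0^* * e w * (e z * diff_quot ratio w d z).
  move=> z0; rewrite /L /diff_quot; case: eqVneq => [->|zw]; first by rewrite !mulrA.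
  have ez := HB_neq0 z0; have ew := HB_neq0 (ltW w0).
  rewrite Nw subr0 /N /ratio; have := zw; rewrite -subr_eq0 => zw'.
  by field; rewrite zw' ez ew.
have eL : entire L.
  move=> z; apply/cdiffP; have [->|zw] := eqVneq z w; last first.
    apply: diff_quot_cdiff => //; apply: cdiffM; first exact: cdiff_cst.
    by apply: cdiffB; apply: cdiffM => //; exact: cdiff_cst.
  apply: (cdiff_eq (f := fun z => c0^* * e w * (e z * diff_quot ratio w d z)) w0).
    move=> u uw; rewrite LD//; have := le_lt_trans (normIm_nc _) uw.
    by rewrite ImD ImN ltr_norml => /andP[h1 _]; lra.
  by apply: cdiffM; [exact: cdiff_cst|apply: cdiffM].
exists L; split => //; last first.
  move=> z; rewrite /L /diff_quot; case: eqVneq => [->|zw].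
    by rewrite subrr mul0r -/(N w) Nw.
  by rewrite Nw subr0 mulrC divfK ?subr_eq0.
have LE z : 0 <= complex.Im z -> L z / e z = 0 * 0 + c0^* * e w * diff_quot ratio w d z.
  move=> z0; rewrite LD// mul0r add0r; have ez := HB_neq0 z0.
  by field.
have hZ : hardy_bounded [::] (fun=> 0 : R[i]) 0.
  split; [by move=> *; exact: ccont_cst|by move=> *; exact: cdiff_cst|].
  move=> y y0; apply: sq_integrable_le.
    by apply: (@ccts_line _ (fun=> 0) y) => *; exact: ccont_cst.
  by under eq_integral do rewrite nc0 expr0n /=; rewrite integral0.
have [M' h'] := hardy_bounded_add (c0^* * e w) hZ hM.
have [h1 [M2 h2]] : hardy2 (fun z => 0 + c0^* * e w * diff_quot ratio w d z).
  apply: (hardy2_of_bounded _ h') => z z0.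
  apply: cdiffD; [exact: cdiff_cst|apply: cdiffM; first exact: cdiff_cst].
  have [->//|zw] := eqVneq z w.
  by apply: (hb_diff hM); [exact: ltW|rewrite inE].
split.
  move=> z z0; apply/cdiffP/quot_cdiff; first exact: ltW.
  exact: entire_cdiff.
exists M2 => y /[dup] y0 /h2; apply: le_trans.
rewrite le_eqVlt; apply/orP; left; apply/eqP; apply: eq_integral => x _.
by rewrite LE ?mul0r// ltW.
Qed.

(** In the upper half-plane the kernel itself has no pole: divided by e it is a
    bounded function over z - c, with c the conjugate of w in the lower half-plane. *)
Lemma kernel_sharp_hardy L : (forall z, (z - w) * L z =
    c0^* * (sharp e z * e w - e z * sharp e w)) -> entire L ->
  hardy2 (fun z => sharp L z / e z).
Proof.
move=> LE eL; split.
  move=> z z0; apply/cdiffP/quot_cdiff; first exact: ltW.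
  exact: sharp_entire_cdiff.
pose C := nc c0 * (nc (e w) + nc (sharp e w)).
exists (C ^+ 2 * (pi / complex.Im w)) => y y0.
have wJ : complex.Im w^* != y.
  by rewrite ImJ lt_eqF// (lt_trans _ y0)// oppr_lt0.
have [k1 k2 k3] := cauchy_kernel wJ.
have cl : ccts (fun x => sharp L (x +i* y) / e (x +i* y)).
  apply: (@ccts_line _ (fun z => sharp L z / e z)) => z zy.
  apply/cdiff_ccont/quot_cdiff; first by rewrite zy ltW.
  exact: sharp_entire_cdiff.
have dom x : nc (sharp L (x +i* y) / e (x +i* y)) ^+ 2 <=
    C ^+ 2 * nc (x +i* y - w^*)^-1 ^+ 2.
  set z := x +i* y; have z0 : 0 <= complex.Im z by rewrite ltW.
  have ez := HB_neq0 z0.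
  have zw : z - w^* != 0.
    by rewrite subr_eq0; apply: neq_of_Im; rewrite ImJ (lt_trans _ y0)// oppr_lt0.
  have E : sharp L z = c0 * (e z * (e w)^* - sharp e z * (sharp e w)^*) / (z - w^*).
    apply/(mulIf zw); rewrite divfK//; have := congr1 conjc (LE z^*).
    rewrite /sharp !(conjM, conjB) !conjcK => <-.
    by rewrite mulrC.
  rewrite -exprMn ler_sqr ?nnegrE ?mulr_ge0 ?addr_ge0 ?nc_ge0//.
  rewrite E ncM ncM mulrAC ler_wpM2r ?nc_ge0// ncV ler_pdivrMr ?nc_gt0//.
  rewrite ncM /C -mulrA ler_wpM2l ?nc_ge0// (le_trans (ncB _ _))// !ncM (ncJ (e w)) (ncJ (sharp e w)).
  rewrite mulrDl; apply: lerD; first by rewrite mulrC.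
  by rewrite [leRHS]mulrC; apply: ler_wpM2r; [exact: nc_ge0|exact: sharp_le].
have [i le] := sq_integrable_dom cl dom k2.
have -> : (\int[mu]_x ((Normc.normc (sharp L (x +i* y) / e (x +i* y)) ^+ 2)%:E) =
    (sq_int (fun x => sharp L (x +i* y) / e (x +i* y)))%:E)%E.
  by rewrite /sq_int /Rintegral fineK//; exact: integrable_fin_num.
rewrite lee_fin (le_trans le)// k3 ler_wpM2l ?sqr_ge0//.
rewrite ImJ opprK ger0_norm ?addr_ge0 ?(ltW w0) ?(ltW y0)//.
by rewrite ler_wpM2l ?pi_ge0// lef_pV2 ?posrE ?addr_gt0// lerDr ltW.
Qed.

End AtPoint.
End KernelFormula.

(** * The reproducing property *)

Section Reproducing.
Variable R : realType.
Local Notation "x ^*" := (conjc x) : ring_scope.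
Local Notation "''i'" := (Complex 0 1) : ring_scope.
Variable e : R[i] -> R[i].
Hypothesis HBe : hermite_biehler e.
Hypothesis e_real : forall x : R, e x%:C != 0.
Implicit Types (z w v p : R[i]) (a b c x y : R) (f g F : R[i] -> R[i]).
Local Notation mu := (@lebesgue_measure R).
Local Notation CI := (@complex_integral R).

Lemma ip_ofE f g : ip_of e f g =
  CI (fun x => (f x%:C / e x%:C)^* * (g x%:C / e x%:C)).
Proof.
rewrite /ip_of; congr complex_integral; apply/funext => x.
rewrite sqr_normc conjM; have ex := e_real x.
have ex' : (e x%:C)^* != 0 by rewrite conjc_eq0.
rewrite conjV !NconjE; move: (e x%:C) (e x%:C)^* (f x%:C)^* (g x%:C) ex ex'.
by move=> p q r s p0 q0; field; rewrite p0 q0.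
Qed.

Lemma integral_div_e f w : space_of e f -> 0 < complex.Im w ->
  line_integrable (fun x => f x%:C / e x%:C * (x%:C - w)^-1) /\
  CI (fun x => f x%:C / e x%:C * (x%:C - w)^-1) = (2 * pi)%:C * 'i * (f w / e w).
Proof.
move=> fB w0; have [M hM] := space_hardy_bounded HBe e_real fB; split.
  exact: (hardy_kernel_integrable hM).
exact: (hardy_cauchy hM).
Qed.

(** On the real line the conjugate of e is its reflection; conjugating turns the
    integrand into the one of the reflection of f at the conjugate of w, in the lower
    half-plane, where the Cauchy integral is zero. *)
Lemma integral_div_esharp f w : space_of e f -> 0 < complex.Im w ->
  line_integrable (fun x => f x%:C / (e x%:C)^* * (x%:C - w)^-1) /\
  CI (fun x => f x%:C / (e x%:C)^* * (x%:C - w)^-1) = 0.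
Proof.
move=> fB w0; have [M hM] := space_hardy_bounded_sharp HBe e_real fB.
have wJ : complex.Im w^* < 0 by rewrite ImJ oppr_lt0.
have I0 := hardy_cauchy_null hM wJ.
have [l0 _] := hardy_line hM wJ (lexx 0) ltr01.
have [l1 E1] := CI_conj l0.
have E : (fun x => f x%:C / (e x%:C)^* * (x%:C - w)^-1) =
  (fun x => (sharp f (x +i* 0) / e (x +i* 0) * (x +i* 0 - w^*)^-1)^*).
  apply/funext => x; rewrite !conjM -[x +i* 0]/(x%:C) sharp_real conjcK.
  by rewrite !conjV conjB conjcK conjc_real.
by rewrite E; split => //; rewrite E1 I0 conjc0.
Qed.

Definition is_kernel_at w K := forall z,
  (z - w^*) * K z = 'i / (2 * pi)%:C * (e z * (e w)^* - sharp e z * e w^*).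

(** Pairing the kernel with f gives two Cauchy integrals at w: that of f / e, which
    produces f w / e w, and that of f over the reflection of e, which vanishes. *)
Theorem kernel_exists_upper w : 0 < complex.Im w -> exists K,
  [/\ space_of e K, is_kernel_at w K & forall f, space_of e f -> ip_of e K f = f w].
Proof.
move=> w0; have [L [eL hL LE]] := kernel_sharp_ex HBe e_real w0.
have hK := kernel_sharp_hardy HBe e_real w0 LE eL.
exists (sharp L); split.
- split; [|exact: hK|rewrite sharpK; exact: hL].
  by move=> z; apply/cdiffP; exact: sharp_entire_cdiff.
- move=> z; have := congr1 conjc (LE z^*).
  rewrite /sharp !(conjM, conjB) !conjcK => ->.
  by rewrite mulrC.
move=> f fB; have [l1 E1] := integral_div_e fB w0.
have [l2 E2] := integral_div_esharp fB w0.
pose c0 : R[i] := ('i / (2 * pi)%:C)^*.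
have [l3 E3] := CI_scale (c0 * e w) l1.
have [l4 E4] := CI_scale (c0 * sharp e w) l2.
have [l5 E5] := CI_sub l3 l4.
have ew : e w != 0 by apply: (HB_neq0 HBe e_real); exact: ltW.
have pi0 : (2 * pi)%:C != 0 :> R[i].
  by rewrite eq_complex/= eqxx andbT mulf_neq0// gt_eqF// pi_gt0.
rewrite ip_ofE.
have -> : (fun x => (sharp L x%:C / e x%:C)^* * (f x%:C / e x%:C)) =
   (fun x => c0 * e w * (f x%:C / e x%:C * (x%:C - w)^-1) -
     c0 * sharp e w * (f x%:C / (e x%:C)^* * (x%:C - w)^-1)).
  apply/funext => x; have xw : x%:C - w != 0.
    by rewrite subr_eq0 eq_sym; apply: neq_of_Im.
  have ex := e_real x; have ex' : (e x%:C)^* != 0 by rewrite conjc_eq0.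
  have -> : (sharp L x%:C / e x%:C)^* = L x%:C / (e x%:C)^*.
    by rewrite conjM conjV sharp_real conjcK.
  have -> : L x%:C = c0 * ((e x%:C)^* * e w - e x%:C * sharp e w) / (x%:C - w).
    by rewrite -sharp_real -LE mulrAC mulfV// mul1r.
  move: (x%:C - w) (e x%:C) (e x%:C)^* (f x%:C) c0 xw ex ex' {l3 E3 l4 E4 l5 E5} => p q r s c p0 q0 r0.
  by field; rewrite ?p0 ?q0 ?r0.
rewrite E5 E3 E4 E1 E2 mulr0 subr0 /c0.
have -> : ('i / (2 * pi)%:C)^* = - 'i / (2 * pi)%:C :> R[i].
  rewrite conjM; congr (_ * _); first by apply: eqC => /=; rewrite ?oppr0.
  by rewrite conjV conjc_real.
have ii : ('i : R[i]) * 'i = -1 by rewrite -expr2 sqr_i.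
have -> : - 'i / (2 * pi)%:C * e w * ((2 * pi)%:C * 'i * (f w / e w)) =
    - ('i * 'i) * f w.
  by move: (2 * pi)%:C pi0 => p p0; field; rewrite ew p0.
by rewrite ii opprK mul1r.
Qed.

Lemma ip_of_sharp f g : space_of e f -> space_of e g ->
  ip_of e (sharp f) (sharp g) = (ip_of e f g)^*.
Proof.
move=> fB gB; rewrite !ip_ofE.
have [M hf] := space_hardy_bounded HBe e_real fB; have [N hg] := space_hardy_bounded HBe e_real gB.
have line F M' : hardy_bounded [::] F M' ->
    ccts (fun x => F x%:C) /\ sq_integrable (fun x => F x%:C).
  move=> hF; have [i _] := hb_sq hF (lexx 0); split => //.
  by apply: (@ccts_line _ F 0) => z zy; apply: (hb_cont hF); rewrite zy.
have [cf sf] := line _ _ hf; have [cg sg] := line _ _ hg.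
have cfJ : ccts (fun x => (f x%:C / e x%:C)^*).
  have [c1 c2] := cf; split.
    by under eq_fun do rewrite ReJ.
  by under eq_fun do rewrite ImJ; move=> x; apply: cvgN; exact: c2.
have sfJ : sq_integrable (fun x => (f x%:C / e x%:C)^*).
  by rewrite /sq_integrable; under eq_fun do rewrite ncJ.
have [l _] := CI_mul cfJ cg sfJ sg ltr01.
have [_ <-] := CI_conj l; congr complex_integral; apply/funext => x.
rewrite !sharp_real; have ex := e_real x.
have ex' : (e x%:C)^* != 0 by rewrite conjc_eq0.
rewrite !conjM !conjV !conjcK.
move: (e x%:C) (e x%:C)^* ex ex' => p q p0 q0; field; by rewrite p0 q0.
Qed.

Lemma s_0E z : s_ e 0 z = 'i / 2 * (e z - sharp e z).
Proof.
rewrite /s_ oppr0 (_ : expi 0 = 1) ?mul1r//.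
by rewrite /expi cos0 sin0.
Qed.

Lemma s_pihalfE z : s_ e (pi / 2) z = - 2^-1 * (e z + sharp e z).
Proof.
rewrite /s_ /expi cosN sinN cos_pihalf sin_pihalf.
have -> : 0 +i* (- 1) = - 'i :> R[i] by apply: eqC => /=; rewrite ?oppr0.
have ii : ('i : R[i]) * 'i = -1 by rewrite -expr2 sqr_i.
transitivity ('i * 'i / 2 * (e z + sharp e z)); last by rewrite ii mulN1r.
by rewrite -complexiE; ring.
Qed.

(** Orthogonality of s_{pi/2} to the domain of multiplication by z: with
    g = (z - i) f the integral is a combination of Cauchy integrals of g at i, where
    g vanishes. *)
Lemma ip_s_pi2_mult f : space_of e (fun z => (z - 'i) * f z) ->
  CI (fun x => (s_ e (pi / 2) x%:C / e x%:C)^* * (f x%:C / e x%:C)) = 0.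
Proof.
move=> gB; have i0 : 0 < complex.Im ('i : R[i]) by rewrite /= ltr01.
have [l1 E1] := integral_div_e gB i0.
have [l2 E2] := integral_div_esharp gB i0.
have [l3 E3] := CI_add l1 l2.
have [l4 E4] := CI_scale (- (2^-1)) l3.
transitivity (- 2^-1 * CI (fun x => (x%:C - 'i) * f x%:C / e x%:C * (x%:C - 'i)^-1 +
  (x%:C - 'i) * f x%:C / (e x%:C)^* * (x%:C - 'i)^-1)); last first.
  by rewrite E3 E1 E2 subrr mul0r mul0r mulr0 addr0 mulr0.
rewrite -E4; congr complex_integral; apply/funext => x.
have ex := e_real x; have ex' : (e x%:C)^* != 0 by rewrite conjc_eq0.
have xi : x%:C - 'i != 0 :> R[i].
  by rewrite eq_complex /= negb_and sub0r oppr_eq0 oner_eq0 orbT.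
rewrite conjM conjV.
have -> : (s_ e (pi / 2) x%:C)^* = - 2^-1 * (e x%:C + (e x%:C)^*).
  by rewrite s_pihalfE sharp_real conjM conjN conjV conjc_nat conjD conjcK [_^* + _]addrC.
move: (x%:C - 'i) (e x%:C) (e x%:C)^* (f x%:C) xi ex ex' => u p q s u0 p0 q0.
by field; rewrite u0 p0 q0.
Qed.

End Reproducing.

(** * Inner product geometry on the carrier *)

Section Hilbert.
Variable R : realType.
Local Notation "x ^*" := (conjc x) : ring_scope.
Local Notation "''i'" := (Complex 0 1) : ring_scope.
Variables (B : set (R[i] -> R[i])) (ip : (R[i] -> R[i]) -> (R[i] -> R[i]) -> R[i]).
Hypothesis hH : hilbert_space_of_entire_functions B ip.
Implicit Types (f g h : R[i] -> R[i]) (a z : R[i]).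

Lemma B_scale a f : B f -> B (a *: f).
Proof. by move=> Bf; rewrite -[a *: f]addr0; apply: (hs_linear hH) => //; exact: (hs_zero hH). Qed.

Lemma B_add f g : B f -> B g -> B (f + g).
Proof. by move=> Bf Bg; rewrite -[f]scale1r; exact: (hs_linear hH). Qed.

Lemma B_sub f g : B f -> B g -> B (f - g).
Proof. by move=> Bf Bg; rewrite -scaleN1r addrC; exact: (hs_linear hH). Qed.

Lemma ip_0r f : B f -> ip f 0 = 0.
Proof.
move=> Bf; have B0 := hs_zero hH.
have := hs_ip_linear hH 1 Bf B0 B0; rewrite scaler0 addr0 mul1r => E.
by apply: (addrI (ip f 0)); rewrite addr0 -E.
Qed.

Lemma ip_scaler a f g : B f -> B g -> ip f (a *: g) = a * ip f g.
Proof.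
move=> Bf Bg; have := hs_ip_linear hH a Bf Bg (hs_zero hH).
by rewrite addr0 ip_0r// addr0.
Qed.

Lemma ip_addr f g h : B f -> B g -> B h -> ip f (g + h) = ip f g + ip f h.
Proof.
by move=> Bf Bg Bh; have := hs_ip_linear hH 1 Bf Bg Bh; rewrite scale1r mul1r.
Qed.

Lemma ip_subr f g h : B f -> B g -> B h -> ip f (g - h) = ip f g - ip f h.
Proof.
move=> Bf Bg Bh; rewrite -scaleN1r ip_addr//; last exact: B_scale.
by rewrite ip_scaler// mulN1r.
Qed.

Lemma ip_sym f g : B f -> B g -> ip f g = (ip g f)^*.
Proof. exact: (hs_ip_sym hH). Qed.

Lemma ip_scalel a f g : B f -> B g -> ip (a *: f) g = a^* * ip f g.
Proof.
move=> Bf Bg; rewrite ip_sym//; last exact: B_scale.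
by rewrite ip_scaler// conjM -(ip_sym Bf Bg).
Qed.

Lemma ip_addl f g h : B f -> B g -> B h -> ip (f + g) h = ip f h + ip g h.
Proof.
move=> Bf Bg Bh; rewrite ip_sym//; last exact: B_add.
by rewrite ip_addr// conjD -!ip_sym.
Qed.

Lemma ip_subl f g h : B f -> B g -> B h -> ip (f - g) h = ip f h - ip g h.
Proof.
move=> Bf Bg Bh; rewrite ip_sym//; last exact: B_sub.
by rewrite ip_subr// conjB -!ip_sym.
Qed.

Definition nrm f : R := Num.sqrt (complex.Re (ip f f)).

Lemma ip_self f : B f -> ip f f = (nrm f ^+ 2)%:C.
Proof.
move=> Bf; have := hs_ip_ge0 hH Bf; rewrite lecE /= => /andP[/eqP i0 r0].
by rewrite sqr_sqrtr//; apply: eqC.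
Qed.

Lemma nrm_ge0 f : 0 <= nrm f. Proof. exact: sqrtr_ge0. Qed.

Lemma ip_normE f : B f -> ip_norm ip f = (nrm f)%:C.
Proof.
move=> Bf; rewrite /ip_norm ip_self//.
rewrite (_ : (nrm f ^+ 2)%:C = (nrm f)%:C ^+ 2); last by rewrite rmorphXn.
by rewrite sqrCK// ler0c nrm_ge0.
Qed.

Lemma nrm_eq0 f : B f -> nrm f = 0 -> f = 0.
Proof.
by move=> Bf f0; apply: (hs_ip_def hH Bf); rewrite ip_self// f0 expr0n.
Qed.

Lemma mulJ z : z^* * z = (nc z ^+ 2)%:C.
Proof. by rewrite sqr_nc; case: z => p q; apply: eqC => /=; ring. Qed.

Lemma nrm_scale a f : B f -> nrm (a *: f) = nc a * nrm f.
Proof.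
move=> Bf; apply/eqP; rewrite -(eqrXn2 (n := 2))// ?nrm_ge0 ?mulr_ge0 ?nrm_ge0 ?nc_ge0//.
apply/eqP; apply: complexI; rewrite -ip_self; last exact: B_scale.
rewrite ip_scaler//; last exact: B_scale.
rewrite ip_scalel// ip_self// exprMn mulrA [a * _]mulrC mulJ.
by rewrite -rmorphM.
Qed.

Lemma cauchy_schwarz f g : B f -> B g -> nc (ip f g) <= nrm f * nrm g.
Proof.
move=> Bf Bg; have [f0|f0] := eqVneq (nrm f) 0.
  rewrite (nrm_eq0 Bf f0) ip_sym ?ip_0r//; last exact: (hs_zero hH).
  by rewrite conjc0 nc0 mulr_ge0 ?nrm_ge0.
have fp : 0 < nrm f by rewrite lt_neqAle eq_sym f0 nrm_ge0.
pose t : R[i] := ip f g / (nrm f ^+ 2)%:C.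
have n0 : (nrm f ^+ 2)%:C != 0 :> R[i].
  by rewrite eq_complex/= eqxx andbT expf_neq0.
have Bh : B (g - t *: f) by apply: B_sub => //; exact: B_scale.
have Btf := B_scale t Bf.
have fh : ip f (g - t *: f) = 0.
  rewrite ip_subr// ip_scaler// ip_self// /t divfK// subrr//.
have E : ip g g = ip (g - t *: f) (g - t *: f) + t^* * t * (nrm f ^+ 2)%:C.
  rewrite [in RHS]ip_subl// [ip (t *: f) _]ip_scalel// fh mulr0 subr0.
  rewrite ip_subr// ip_scaler// (ip_sym Bg Bf) -addrA -[LHS]addr0; congr (_ + _).
  rewrite -mulrA [t * _]mulrC /t divfK// conjM.
  have -> : (((nrm f ^+ 2)%:C)^-1)^* = ((nrm f ^+ 2)%:C)^-1 :> R[i].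
    by rewrite conjV conjc_real.
  by ring.
move: E; rewrite !ip_self// mulJ -rmorphM -rmorphD => /complexI E.
have tE : nc t = nc (ip f g) / nrm f ^+ 2.
  by rewrite /t ncM ncV nc_real ger0_norm ?sqr_ge0.
rewrite -ler_sqr ?nnegrE ?mulr_ge0 ?nc_ge0 ?nrm_ge0// exprMn E mulrDr tE.
have -> : nrm f ^+ 2 * ((nc (ip f g) / nrm f ^+ 2) ^+ 2 * nrm f ^+ 2) = nc (ip f g) ^+ 2.
  by field.
by rewrite lerDr; apply: mulr_ge0; exact: sqr_ge0.
Qed.

Lemma nrm_triangle f g : B f -> B g -> nrm (f + g) <= nrm f + nrm g.
Proof.
move=> Bf Bg; have Bfg := B_add Bf Bg.
rewrite -ler_sqr ?nnegrE ?addr_ge0 ?nrm_ge0//.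
have := ip_self Bfg; rewrite ip_addl// !ip_addr// !ip_self//.
move=> /(congr1 (@complex.Re _)); rewrite !ReD /= => <-.
have := cauchy_schwarz Bf Bg; have := cauchy_schwarz Bg Bf.
have := normRe_nc (ip f g); have := normRe_nc (ip g f).
rewrite !ler_norml => /andP[_ h1] /andP[_ h2] h3 h4.
rewrite sqrrD; nra.
Qed.

Lemma nrm_sub f g : B f -> B g -> nrm (f - g) <= nrm f + nrm g.
Proof.
move=> Bf Bg; rewrite -scaleN1r (le_trans (nrm_triangle Bf (B_scale _ Bg)))//.
by rewrite nrm_scale// ncN nc1 mul1r.
Qed.

End Hilbert.

(** * Entire functions that agree off a small set *)

Section EntireEq.
Variable R : realType.
Local Notation "x ^*" := (conjc x) : ring_scope.
Local Notation "''i'" := (Complex 0 1) : ring_scope.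
Implicit Types (f g : R[i] -> R[i]) (p w z : R[i]).

Lemma entire_ccont f z : entire f -> ccont f z.
Proof. by move=> ef; apply: cdiff_ccont; exact: entire_cdiff. Qed.

Lemma entire_eq_off f g w : entire f -> entire g ->
  (forall z, z != w -> f z = g z) -> f = g.
Proof.
move=> ef eg fg; apply/funext => z; have [->|/fg//] := eqVneq z w.
apply: ccont_dense_eq; [exact: entire_ccont|exact: entire_ccont|] => del del0.
by have [u ud uw] := punctured_point w del0; exists u => //; exact: fg.
Qed.

Lemma entire_eq_nonreal f g w : entire f -> entire g -> complex.Im w != 0 ->
  (forall z, complex.Im z != 0 -> z != w -> f z = g z) -> f = g.
Proof.
move=> ef eg w0 fg; apply: (entire_eq_off ef eg (w := w)) => z zw.
have [z0|/fg] := eqVneq (complex.Im z) 0; last exact.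
apply: ccont_dense_eq; [exact: entire_ccont|exact: entire_ccont|] => del del0.
pose t := Num.min del `|complex.Im w| / 2.
have m0 : 0 < Num.min del `|complex.Im w| by rewrite lt_min del0 normr_gt0.
have t0 : 0 < t by rewrite divr_gt0.
have : t < Num.min del `|complex.Im w| by rewrite ltr_pdivrMr// ltr_pMr// ltr1n.
rewrite lt_min => /andP[td tw].
have iE : complex.Im (z + 0 +i* t) = t by rewrite ImD z0 add0r.
exists (z + 0 +i* t).
  by rewrite addrAC subrr add0r /nc/= expr0n/= add0r sqrtr_sqr gtr0_norm.
apply: fg; first by rewrite iE gt_eqF.
apply: contraTneq tw => <-; rewrite iE gtr0_norm// ltxx//.
Qed.

End EntireEq.

(** * The kernel identity and the resolvents *)

Section deBranges.
Variable R : realType.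
Local Notation "x ^*" := (conjc x) : ring_scope.
Local Notation "''i'" := (Complex 0 1) : ring_scope.
Variables (e : R[i] -> R[i]) (B : set (R[i] -> R[i])).
Variables (ip : (R[i] -> R[i]) -> (R[i] -> R[i]) -> R[i]) (k : R[i] -> R[i] -> R[i]).
Hypothesis hB : deBranges_space B ip.
Hypothesis HBe : hermite_biehler e.
Hypothesis e_real : forall x : R, e x%:C != 0.
Hypothesis BE : B = space_of e.
Hypothesis ipE : forall f g, B f -> B g -> ip f g = ip_of e f g.
Hypothesis rk : reproducing_kernel B ip k.
Implicit Types (z w v p : R[i]) (f g h : R[i] -> R[i]).

Let hH := dB_hilbert hB.
Local Notation nrm := (nrm ip).

Let Bk w : B (k^~ w) := proj1 (rk w).

Lemma eval_ip f w : B f -> f w = ip (k^~ w) f.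
Proof. by move=> Bf; exact: (proj2 (rk w)). Qed.

Lemma eval_le f w : B f -> nc (f w) <= nrm (k^~ w) * nrm f.
Proof. by move=> Bf; rewrite (eval_ip w Bf); exact: (cauchy_schwarz hH). Qed.

Lemma kernel_unique w f : B f -> (forall g, B g -> ip f g = g w) -> k^~ w = f.
Proof.
move=> Bf Hf; apply/eqP; rewrite -subr_eq0; apply/eqP.
have Bd : B (k^~ w - f) by exact: (B_sub hH).
apply: (hs_ip_def hH Bd).
by rewrite (ip_subl hH)// Hf// -eval_ip// subrr.
Qed.

(** Up to the factor pi (z - u) this is the kernel at the conjugate of u. *)
Definition wedge z u : R[i] :=
  s_ e (pi / 2) z * s_ e 0 u - s_ e 0 z * s_ e (pi / 2) u.

Lemma s_E gamma z : s_ e gamma z =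
  (cos gamma)%:C * s_ e 0 z + (sin gamma)%:C * s_ e (pi / 2) z.
Proof.
rewrite s_0E s_pihalfE /s_ /expi cosN sinN.
have -> (c d : R) : c +i* d = c%:C + 'i * d%:C by apply: eqC => /=; ring.
have -> (c d : R) : c +i* (- d) = c%:C - 'i * d%:C by apply: eqC => /=; ring.
have ii : ('i : R[i]) * 'i = -1 by rewrite -expr2 sqr_i.
rewrite -complexiE.
transitivity ('i / 2 * (cos gamma)%:C * (e z - sharp e z) +
  'i * 'i / 2 * (sin gamma)%:C * (e z + sharp e z)); first by ring.
by rewrite ii; ring.
Qed.

Lemma wedgeE z u : wedge z u = 'i / 2 * (e z * sharp e u - sharp e z * e u).
Proof. by rewrite /wedge !s_0E !s_pihalfE; field. Qed.

Lemma s_conj gamma z : (s_ e gamma z)^* = s_ e gamma z^*.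
Proof.
rewrite /s_ /expi /sharp !cosN !sinN conjcK.
move: (e z) (e z^*) => [p q] [r s].
by apply: eqC; rewrite ?(ReM, ImM, ReD, ImD, ReN, ImN, ReJ, ImJ) /=; field.
Qed.

Lemma nc_e_neq w : complex.Im w != 0 -> nc (e w) != nc (e w^*).
Proof.
case: ltgtP => // [w0|w0] _; last by rewrite gt_eqF// HB_lt.
have := @HB_lt _ _ HBe w^*; rewrite ImJ oppr_gt0 conjcK => /(_ w0) h.
by rewrite lt_eqF.
Qed.

Lemma s_neq0 gamma w : complex.Im w != 0 -> s_ e gamma w != 0.
Proof.
move=> w0; apply: contra (nc_e_neq w0); rewrite /s_ mulf_eq0 => /orP[|].
  by rewrite mulf_eq0 invr_eq0 pnatr_eq0 orbF eq_complex/= oner_eq0 andbF.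
rewrite subr_eq0 => /eqP/(congr1 (@nc R)); rewrite !ncM /sharp ncJ.
have ex t : nc (expi t : R[i]) = 1 by rewrite /nc/= cos2Dsin2 sqrtr1.
by rewrite !ex !mul1r => ->.
Qed.

Lemma pi_neq0 : (pi%:C : R[i]) != 0.
Proof. by rewrite eq_complex/= eqxx andbT gt_eqF// pi_gt0. Qed.

Lemma kernelE_upper w z : 0 < complex.Im w ->
  (z - w^*) * k z w = pi%:C^-1 * wedge z w^*.
Proof.
move=> w0; have [K [KB KE Krep]] := kernel_exists_upper HBe e_real w0.
have BK : B K by rewrite BE.
have -> : k z w = K z.
  rewrite -[k z w]/((k^~ w) z) (kernel_unique BK)// => g Bg.
  by rewrite ipE// Krep// -BE.
rewrite KE wedgeE /sharp conjcK.
have -> : (2 * pi)%:C = 2 * pi%:C :> R[i] by apply: eqC; rewrite ?(ReM, ImM)/=; ring.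
by move: (pi%:C) pi_neq0 => p p0; field.
Qed.

Lemma kernel_sharp w z : k z w^* = (k z^* w)^*.
Proof.
have sw := dB_sharp hB (Bk w); case: sw => Bsk _.
rewrite -[k z w^*]/((k^~ w^*) z) (kernel_unique Bsk)// => g Bg.
have [Bsg _] := dB_sharp hB Bg.
have gE : g = sharp (sharp g) by rewrite sharpK.
rewrite [in LHS]gE ipE//; last by rewrite -gE.
rewrite ip_of_sharp ?BE//; [|by rewrite -BE|by rewrite -BE].
by rewrite -ipE// -eval_ip// /sharp conjcK.
Qed.

Lemma wedge_conj z u : (wedge z u)^* = wedge z^* u^*.
Proof. by rewrite /wedge conjB 2![(s_ _ _ _ * _)^*]conjM !s_conj. Qed.

(** In the upper half-plane the kernel is the candidate constructed from the Hardy
    space; the lower half-plane follows by reflection. *)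
Lemma kernelE w z : complex.Im w != 0 ->
  (z - w^*) * k z w = pi%:C^-1 * wedge z w^*.
Proof.
case: ltgtP => // [w0|w0] _; last exact: kernelE_upper.
have wJ0 : 0 < complex.Im w^* by rewrite ImJ oppr_gt0.
have := congr1 conjc (kernelE_upper z^* wJ0).
rewrite conjM conjB !conjcK -kernel_sharp conjcK conjM wedge_conj !conjcK => ->.
by rewrite conjV conjc_real.
Qed.

Lemma kernel_diag_neq0 w : complex.Im w != 0 -> k w w != 0.
Proof.
move=> w0; apply: contra (nc_e_neq w0) => /eqP kw.
have := kernelE w w0; rewrite kw mulr0 wedgeE /sharp conjcK => /esym/eqP.
rewrite !mulf_eq0 invr_eq0 (negbTE pi_neq0)/=.
rewrite invr_eq0 pnatr_eq0 orbF.
have -> /= : ('i == 0 :> R[i]) = false by rewrite eq_complex/= oner_eq0 andbF.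
rewrite subr_eq0 => /eqP/(congr1 (@nc R)); rewrite !ncM !ncJ -!expr2 => /eqP.
by rewrite eqrXn2 ?nc_ge0.
Qed.

(** The Pluecker relation: three vectors (s_{pi/2}, s_0) in a plane are linearly dependent,
    and s_gamma is a linear form of them. *)
Lemma wedge_pluecker gamma z u v :
  s_ e gamma u * wedge z v = s_ e gamma v * wedge z u + s_ e gamma z * wedge u v.
Proof. by rewrite /wedge !(s_E gamma); ring. Qed.

Lemma coefficient_conj gamma w :
  (- (pi%:C / s_ e gamma w))^* = - (pi%:C / s_ e gamma w^*).
Proof. by rewrite conjN conjM conjc_real conjV s_conj. Qed.

(** The value at f of the resolvent at w, with the quotient by z - w cleared. *)
Definition is_resolvent_value gamma w f g := B g /\
  forall z, (z - w) * g z = f z - s_ e gamma z / s_ e gamma w * f w.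

Definition kernel_resolvent gamma w v : R[i] -> R[i] :=
  (v^* - w)^-1 *: (k^~ v - (s_ e gamma v^* / s_ e gamma w) *: k^~ w^*).

(** Reproducing kernels are eigenvectors of the adjoint of S, so the resolvent maps
    one of them to a combination of itself and the kernel at the conjugate of w. After
    clearing denominators this is the Pluecker relation. *)
Lemma kernel_resolventP gamma w v : complex.Im w != 0 -> complex.Im v != 0 ->
  v^* != w -> is_resolvent_value gamma w (k^~ v) (kernel_resolvent gamma w v).
Proof.
move=> w0 v0 vw; have d0 : v^* - w != 0 by rewrite subr_eq0.
have sw := s_neq0 gamma w0.
have wJ0 : complex.Im w^* != 0 by rewrite ImJ oppr_eq0.
split.
  by apply: (B_scale hH); apply: (B_sub hH) => //; apply: (B_scale hH).
move=> z; rewrite /kernel_resolvent.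
rewrite -[(_ *: _) z]/((v^* - w)^-1 * (k z v - s_ e gamma v^* / s_ e gamma w * k z w^*)).
have K1 := kernelE z v0; have K2 := kernelE z wJ0; have K3 := kernelE w v0.
rewrite conjcK in K2.
have P := wedge_pluecker gamma z w v^*.
apply: (mulfI d0); rewrite [LHS]mulrCA mulVKf//.
apply: (mulfI sw); apply/eqP; rewrite -subr_eq0; apply/eqP.
transitivity (s_ e gamma w * ((z - v^*) * k z v)
  - s_ e gamma v^* * ((z - w) * k z w^*) - s_ e gamma z * ((w - v^*) * k w v)).
  by field.
by rewrite K1 K2 K3; transitivity (pi%:C^-1 * (s_ e gamma w * wedge z v^* -
  (s_ e gamma v^* * wedge z w + s_ e gamma z * wedge w v^*))); [ring|rewrite P subrr mulr0].
Qed.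

Section FixedBasePoint.
Variable w0 : R[i].
Hypothesis w0_nonreal : complex.Im w0 != 0.
Local Notation S_ := (canonical_extension B e w0).

(** The graph is described with the base point w0; the preimage at w0 is
    f + (w - w0) g, whose value at w0 is f w s_gamma w0 / s_gamma w. *)
Lemma is_resolvent_value_graph gamma w f g : complex.Im w != 0 -> B f ->
  is_resolvent_value gamma w f g -> S_ gamma g (f + w *: g).
Proof.
move=> wn Bf [Bg gE]; have sw := s_neq0 gamma wn; have sw0 := s_neq0 gamma w0_nonreal.
pose f1 := f + (w - w0) *: g.
have Bf1 : B f1 by apply: (B_add hH) => //; exact: (B_scale hH).
have E0 : f1 w0 = s_ e gamma w0 / s_ e gamma w * f w.
  rewrite -[f1 w0]/(f w0 + (w - w0) * g w0).
  have -> : (w - w0) * g w0 = - (f w0 - s_ e gamma w0 / s_ e gamma w * f w).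
    by rewrite -gE; ring.
  by ring.
exists f1 => //; split; last first.
  move=> z; rewrite E0 -[(f + w *: g) z]/(f z + w * g z).
  have := gE z; rewrite mulrBl => /eqP; rewrite subr_eq => /eqP ->.
  by field; rewrite sw sw0.
split; first exact: (hs_entire hH).
move=> z; rewrite E0 -[f1 z]/(f z + (w - w0) * g z).
have -> : (z - w0) * g z = (z - w) * g z + (w - w0) * g z by ring.
by rewrite gE; field; rewrite sw sw0.
Qed.

Lemma graph_is_resolvent_value gamma w f g h : complex.Im w != 0 ->
  S_ gamma g h -> f = h - w *: g ->
  forall z, (z - w) * g z = f z - s_ e gamma z / s_ e gamma w * f w.
Proof.
move=> wn [f1 Bf1 [[eg gE] hE]] ->.
have sw := s_neq0 gamma wn; have sw0 := s_neq0 gamma w0_nonreal.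
move=> z; rewrite -[(h - w *: g) z]/(h z - w * g z) -[(h - w *: g) w]/(h w - w * g w).
by rewrite !hE; field; rewrite sw sw0.
Qed.

Lemma graph_entire gamma g h : S_ gamma g h -> entire g.
Proof. by move=> [f _ [[]]]. Qed.

Lemma resolvent_unique gamma w f g1 g2 : complex.Im w != 0 ->
  inverse_op (minus_scalar (S_ gamma) w) f g1 ->
  inverse_op (minus_scalar (S_ gamma) w) f g2 -> g1 = g2.
Proof.
move=> wn [h1 T1 E1] [h2 T2 E2].
apply: (@entire_eq_off _ _ _ w); [exact: graph_entire T1|exact: graph_entire T2|].
move=> z zw; have zw' : z - w != 0 by rewrite subr_eq0.
apply: (mulfI zw').
by rewrite (graph_is_resolvent_value wn T1 E1) (graph_is_resolvent_value wn T2 E2).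
Qed.

Lemma resolventP gamma w f g : complex.Im w != 0 -> B f ->
  is_resolvent_value gamma w f g ->
  inverse_op (minus_scalar (S_ gamma) w) f g /\ resolvent (S_ gamma) w f = g.
Proof.
move=> wn Bf gE; have I : inverse_op (minus_scalar (S_ gamma) w) f g.
  exists (f + w *: g); first exact: is_resolvent_value_graph.
  by rewrite addrK.
split => //; rewrite /resolvent /ap; apply: xget_unique => // g' Ig'.
exact: (resolvent_unique wn Ig' I).
Qed.

(** Subtract from f the multiple of the kernel at w that has the same value at w.
    The rest F vanishes at w, and F / (z - w) is a combination of F and its isometric
    image (z - c) F / (z - w), with c the conjugate of w; the kernel part is explicit.
    This also bounds the resolvent. *)
Lemma resolvent_exists gamma w : complex.Im w != 0 -> exists2 M : R, 0 <= M &
  forall f, B f -> exists2 g, is_resolvent_value gamma w f g & nrm g <= M * nrm f.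
Proof.
move=> wn; have kww := kernel_diag_neq0 wn.
have wJ : w^* != w.
  apply: contra wn => /eqP/(congr1 (@complex.Im R)); rewrite ImJ => E.
  by apply/eqP; lra.
have [BK KE] := kernel_resolventP gamma wn wn wJ.
set K := kernel_resolvent gamma w w in BK KE *.
have d0 : w - w^* != 0 by rewrite subr_eq0 eq_sym.
pose c1 := (nc (k w w))^-1 * nrm (k^~ w).
have c10 : 0 <= c1 by rewrite mulr_ge0 ?invr_ge0 ?nc_ge0 ?nrm_ge0.
pose c2 := 1 + c1 * nrm (k^~ w).
have c20 : 0 <= c2.
  by apply: addr_ge0 => //; apply: mulr_ge0 => //; exact: nrm_ge0.
exists ((nc (w - w^*))^-1 * (c2 + c2) + c1 * nrm K).
  apply: addr_ge0; apply: mulr_ge0 => //; rewrite ?invr_ge0 ?nc_ge0 ?nrm_ge0//.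
  exact: addr_ge0.
move=> f Bf; pose a := f w / k w w.
have Ba : B (a *: k^~ w) by apply: (B_scale hH).
pose F := f - a *: k^~ w; have BF : B F by exact: (B_sub hH).
have Fw : F w = 0 by rewrite -[F w]/(f w - f w / k w w * k w w) divfK// subrr.
have [h [eh hE] [Bh hn]] := dB_division hB BF wn Fw.
have nh : nrm h = nrm F.
  by apply: complexI; rewrite -!(ip_normE hH)// hn.
pose G := (w - w^*)^-1 *: (h - F).
have BG : B G by apply: (B_scale hH); exact: (B_sub hH).
have na : nc a <= c1 * nrm f.
  rewrite /a ncM ncV /c1 mulrC -mulrA ler_wpM2l ?invr_ge0 ?nc_ge0//.
  exact: eval_le.
have nF : nrm F <= c2 * nrm f.
  rewrite (le_trans (nrm_sub hH _ _))// (nrm_scale hH)// mulrDl mul1r lerD2l.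
  by rewrite mulrAC ler_wpM2r// nrm_ge0.
exists (G + a *: K); last first.
  rewrite (le_trans (nrm_triangle hH _ _))//; first exact: (B_scale hH).
  rewrite mulrDl; apply: lerD.
    rewrite (nrm_scale hH)//; last exact: (B_sub hH).
    rewrite ncV -mulrA ler_wpM2l ?invr_ge0 ?nc_ge0//.
    by rewrite (le_trans (nrm_sub hH _ _))// nh mulrDl lerD.
  by rewrite (nrm_scale hH)// mulrAC ler_wpM2r// nrm_ge0.
split; first by apply: (B_add hH) => //; exact: (B_scale hH).
move=> z; rewrite -[(G + a *: K) z]/((w - w^*)^-1 * (h z - F z) + a * K z).
have E1 : (z - w) * ((w - w^*)^-1 * (h z - F z)) = F z.
  apply: (mulfI d0); rewrite mulrCA mulVKf// mulrBr hE NconjE.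
  by ring.
rewrite mulrDr E1 [_ * (a * _)]mulrCA KE -[F z]/(f z - a * k z w).
by rewrite /a; field; rewrite kww s_neq0.
Qed.

Lemma nonreal_resolvent_set gamma w : complex.Im w != 0 ->
  ~ spec B ip (S_ gamma) w.
Proof.
move=> wn; apply; have [M M0 H] := resolvent_exists gamma wn; split.
  move=> f Bf; have [g gE _] := H _ Bf; have [I _] := resolventP wn Bf gE.
  by exists g; split => // g' Ig'; exact: (resolvent_unique wn I Ig').
exists M => f Bf; have [g gE le] := H _ Bf; have [_ ->] := resolventP wn Bf gE.
by rewrite !(ip_normE hH)//; [rewrite -rmorphM lecR|case: gE].
Qed.

Lemma resolvent_value gamma w f : complex.Im w != 0 -> B f ->
  is_resolvent_value gamma w f (resolvent (S_ gamma) w f).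
Proof.
move=> wn Bf; have [M _ H] := resolvent_exists gamma wn.
by have [g gE _] := H _ Bf; have [_ ->] := resolventP wn Bf gE.
Qed.

Lemma resolvent_bounded gamma w : complex.Im w != 0 -> exists2 M : R, 0 <= M &
  forall f, B f -> nrm (resolvent (S_ gamma) w f) <= M * nrm f.
Proof.
move=> wn; have [M M0 H] := resolvent_exists gamma wn; exists M => // f Bf.
by have [g gE le] := H _ Bf; have [_ ->] := resolventP wn Bf gE.
Qed.

Lemma resolvent_linear gamma w a f g : complex.Im w != 0 -> B f -> B g ->
  resolvent (S_ gamma) w (a *: f + g) =
  a *: resolvent (S_ gamma) w f + resolvent (S_ gamma) w g.
Proof.
move=> wn Bf Bg; have [B1 E1] := resolvent_value gamma wn Bf.
have [B2 E2] := resolvent_value gamma wn Bg.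
apply: (proj2 (resolventP wn (hs_linear hH a Bf Bg) _)); split.
  exact: (hs_linear hH).
move=> z; rewrite -[(_ + _) z]/(a * resolvent (S_ gamma) w f z + resolvent (S_ gamma) w g z).
rewrite mulrDr mulrCA E1 E2 -[(_ + _) z]/(a * f z + g z) -[(_ + _) w]/(a * f w + g w).
by ring.
Qed.

Lemma resolvent_scale gamma w a f : complex.Im w != 0 -> B f ->
  resolvent (S_ gamma) w (a *: f) = a *: resolvent (S_ gamma) w f.
Proof.
move=> wn Bf; have [B1 E1] := resolvent_value gamma wn Bf.
apply: (proj2 (resolventP wn (B_scale hH a Bf) _)); split; first exact: (B_scale hH).
move=> z; rewrite -[(_ *: _) z]/(a * resolvent (S_ gamma) w f z) mulrCA E1.
by rewrite -[(a *: f) z]/(a * f z) -[(a *: f) w]/(a * f w); ring.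
Qed.

Lemma resolvent_identity gamma w v f : complex.Im w != 0 -> complex.Im v != 0 -> B f ->
  resolvent (S_ gamma) w f = resolvent (S_ gamma) v f +
    (w - v) *: resolvent (S_ gamma) w (resolvent (S_ gamma) v f).
Proof.
move=> wn vn Bf; have [B1 E1] := resolvent_value gamma vn Bf.
have [B2 E2] := resolvent_value gamma wn B1.
set g := resolvent (S_ gamma) v f in B1 E1 B2 E2 *.
set h := resolvent (S_ gamma) w g in B2 E2 *.
apply: (proj2 (resolventP wn Bf _)); split.
  by apply: (B_add hH) => //; exact: (B_scale hH).
move=> z; rewrite -[(g + _) z]/(g z + (w - v) * h z).
have sw := s_neq0 gamma wn; have sv := s_neq0 gamma vn.
rewrite mulrDr mulrCA E2.
have -> : (z - w) * g z + (w - v) * (g z - s_ e gamma z / s_ e gamma w * g w) =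
  (z - v) * g z - s_ e gamma z / s_ e gamma w * ((w - v) * g w) by ring.
by rewrite !E1; field; rewrite sw sv.
Qed.

Lemma resolvent_kernel gamma w v : complex.Im w != 0 -> complex.Im v != 0 -> v^* != w ->
  resolvent (S_ gamma) w (k^~ v) = kernel_resolvent gamma w v.
Proof.
move=> wn vn vw; apply: (proj2 (resolventP wn (Bk v) _)).
exact: kernel_resolventP.
Qed.

Hypothesis dense_S : densely_defined B ip (mult_op B).

(** If s_{pi/2} were in the space it would be orthogonal to the dense domain of S. *)
Lemma s_pi2_notin : ~ B (s_ e (pi / 2)).
Proof.
move=> Bs; set s := s_ e (pi / 2) in Bs *.
have orth f : dom (mult_op B) f -> ip s f = 0.
  move=> [g [Bf Bg gE]]; rewrite ipE// ip_ofE//; apply: ip_s_pi2_mult => //.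
  rewrite -BE; have -> : (fun z => (z - 'i) * f z) = g - 'i *: f.
    by apply/funext => z; rewrite -[(_ - _) z]/(g z - 'i * f z) gE mulrBl.
  by apply: (B_sub hH) => //; exact: (B_scale hH).
have s0 : nrm s = 0.
  apply/eqP; rewrite -normr_le0 ger0_norm ?nrm_ge0//.
  apply/ler_addgt0Pr => eps eps0; rewrite add0r.
  have [f domf] := dense_S Bs eps0; have [g [Bf Bg _]] := domf.
  rewrite (ip_normE hH) ?ltcR => [lt|]; last exact: (B_sub hH).
  have [//|sn] := leP (nrm s) eps.
  have sp : 0 < nrm s by exact: lt_trans sn.
  have Bsf : B (s - f) by exact: (B_sub hH).
  have := cauchy_schwarz hH Bs Bsf.
  rewrite (ip_subr hH)// (orth f domf) subr0 (ip_self hH)// nc_real ger0_norm ?sqr_ge0//.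
  rewrite expr2 ler_pM2l// => le; by have := le_lt_trans le (lt_trans lt sn); rewrite ltxx.
have := s_neq0 (pi / 2) w0_nonreal.
by rewrite -/s (nrm_eq0 hH Bs s0) eqxx.
Qed.

(** Two images of one function differ by a multiple of s_{pi/2}. *)
Lemma Spi2_single_valued g h h' : S_ (pi / 2) g h -> S_ (pi / 2) g h' -> h = h'.
Proof.
move=> [f Bf [[_ gE] hE]] [f' Bf' [[_ gE'] hE']].
have sn := s_neq0 (pi / 2) w0_nonreal.
have fE z : f z - f' z = s_ e (pi / 2) z / s_ e (pi / 2) w0 * (f w0 - f' w0).
  have := gE z; rewrite gE' => /eqP; rewrite -subr_eq0 => /eqP E.
  by apply/eqP; rewrite -subr_eq0 -oppr_eq0; apply/eqP; rewrite -E; ring.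
have [d0|dn] := eqVneq (f w0 - f' w0) 0.
  by apply/funext => z; rewrite hE hE' (subr0_eq d0).
exfalso; apply: s_pi2_notin.
have -> : s_ e (pi / 2) = (s_ e (pi / 2) w0 / (f w0 - f' w0)) *: (f - f').
  apply/funext => z.
  rewrite -[(_ *: _) z]/(s_ e (pi / 2) w0 / (f w0 - f' w0) * (f z - f' z)) (fE z).
  by field; rewrite sn dn.
by apply: (B_scale hH); exact: (B_sub hH).
Qed.

Lemma ap_Spi2_resolvent w f : complex.Im w != 0 -> B f ->
  let g := resolvent (S_ (pi / 2)) w f in
  S_ (pi / 2) g (f + w *: g) /\ ap (S_ (pi / 2)) g = f + w *: g.
Proof.
move=> wn Bf /=; have T := is_resolvent_value_graph wn Bf (resolvent_value (pi / 2) wn Bf).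
split => //; apply: xget_unique => // h Th.
exact: (Spi2_single_valued Th T).
Qed.

(** The two resolvents divide the same f by z - w after subtracting multiples of
    s_gamma and s_{pi/2}, so their difference is a multiple of the kernel. *)
Lemma krein_difference gamma w f : complex.Im w != 0 -> B f ->
  resolvent (S_ gamma) w f - resolvent (S_ (pi / 2)) w f =
  ((cos gamma)%:C * pi%:C * f w / (s_ e gamma w * s_ e (pi / 2) w)) *: k^~ w^*.
Proof.
move=> wn Bf; have [B1 E1] := resolvent_value gamma wn Bf.
have [B2 E2] := resolvent_value (pi / 2) wn Bf.
set g1 := resolvent (S_ gamma) w f in B1 E1 *.
set g2 := resolvent _ w f in B2 E2 *.
apply: (@entire_eq_off _ _ _ w).
- exact/(hs_entire hH)/(B_sub hH).
- exact/(hs_entire hH)/(B_scale hH).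
move=> z zw; have zw' : z - w != 0 by rewrite subr_eq0.
apply: (mulfI zw'); rewrite -[(g1 - g2) z]/(g1 z - g2 z) mulrBr E1 E2.
set c := (X in (X *: _) z); rewrite -[(c *: _) z]/(c * k z w^*).
have wJ : complex.Im w^* != 0 by rewrite ImJ oppr_eq0.
have K := kernelE z wJ; rewrite conjcK in K.
rewrite mulrCA K /c /wedge.
have sg := s_neq0 gamma wn; have s2 := s_neq0 (pi / 2) wn.
have key : s_ e (pi / 2) z * s_ e gamma w - s_ e gamma z * s_ e (pi / 2) w =
  (cos gamma)%:C * (s_ e (pi / 2) z * s_ e 0 w - s_ e 0 z * s_ e (pi / 2) w).
  by rewrite (s_E gamma z) (s_E gamma w); ring.
have p0 := pi_neq0; move: (pi%:C : R[i]) p0 => p p0.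
transitivity (f w / (s_ e gamma w * s_ e (pi / 2) w) *
  (s_ e (pi / 2) z * s_ e gamma w - s_ e gamma z * s_ e (pi / 2) w)).
  by field; rewrite sg s2.
by rewrite key; field; rewrite sg s2 p0.
Qed.

(** The point i as a constant that simplification leaves alone, so that it is an
    atom of the rational identities below. *)
Definition imag_unit : R[i] := 'i.
Local Notation I := imag_unit.

Lemma I_nonreal : complex.Im I != 0. Proof. exact: oner_neq0. Qed.

Lemma I_conj : I^* = - I. Proof. by apply: eqC => /=; rewrite ?oppr0. Qed.

Lemma NI_nonreal : complex.Im (- I) != 0.
Proof. by rewrite ImN oppr_eq0 I_nonreal. Qed.

Lemma I_sqr : I * I = -1. Proof. by apply: eqC => /=; ring. Qed.

(** Expand S_{pi/2} v = u + w v. The inner product of u with v = R(w) u is known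
    because u is a kernel. The factor 1 + w^2 = - (i - w) (w + i) cancels the
    denominator of R(w) u, and w = i, where the formula for R(w) u fails, is harmless
    because that factor vanishes there. *)
Lemma q_value w (u := - (pi%:C / s_ e (pi / 2) I) *: k^~ (- I))
    (v := resolvent (S_ (pi / 2)) w u) : complex.Im w != 0 ->
  ip u (v + w *: ap (S_ (pi / 2)) v) =
  pi%:C * ((complex.Re (s_ e 0 I / s_ e (pi / 2) I))%:C - s_ e 0 w / s_ e (pi / 2) w).
Proof.
move=> wn.
have Bu : B u by apply: (B_scale hH).
have [_ apE] := ap_Spi2_resolvent wn Bu; rewrite -/v in apE.
have Bv : B v by have [] := resolvent_value (pi / 2) wn Bu.
rewrite apE (ip_addr hH)//; last by apply: (B_scale hH); apply: (B_add hH) => //; exact: (B_scale hH).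
rewrite (ip_scaler hH)//; last by apply: (B_add hH) => //; exact: (B_scale hH).
rewrite (ip_addr hH)//; last exact: (B_scale hH).
rewrite (ip_scaler hH)//.
pose s0 := s_ e 0; pose s2 := s_ e (pi / 2).
have s2i : s2 I != 0 by apply: s_neq0; exact: I_nonreal.
have s2ni : s2 (- I) != 0 by apply: s_neq0; exact: NI_nonreal.
have s2w : s2 w != 0 by exact: s_neq0.
pose b : R[i] := - (pi%:C / s2 I).
have bJ : b^* = - (pi%:C / s2 (- I)).
  by rewrite coefficient_conj I_conj.
have NIJ : (- I)^* = I by rewrite -I_conj conjcK.
have Bki : B (k^~ (- I)) := Bk _.
have uu : ip u u = b^* * b * k (- I) (- I).
  by rewrite (ip_scaler hH)// (ip_scalel hH)// -eval_ip// mulrA [b * _]mulrC.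
have kii : - (I + I) * k (- I) (- I) = pi%:C^-1 * wedge (- I) I.
  by have := kernelE (- I) NI_nonreal; rewrite NIJ -opprD.
have Re : (complex.Re (s0 I / s2 I))%:C = 2^-1 * (s0 I / s2 I + s0 (- I) / s2 (- I)).
  by rewrite ReJ_add conjM conjV !s_conj I_conj mulrC.
have i2 : I + I != 0.
  apply: contra I_nonreal => /eqP/(congr1 (@complex.Im R)); rewrite ImD => E.
  by apply/eqP; move: E; rewrite [complex.Im 0]/=; lra.
have kiiE : k (- I) (- I) = - (pi%:C^-1 * wedge (- I) I) / (I + I).
  by rewrite -kii; field.
have main : (1 + w * w) * ip u v =
    b^* * b * (- (w + I) * k (- I) (- I) - s2 I / s2 w * (pi%:C^-1 * wedge (- I) w)).
  have [wI|wI] := eqVneq w I.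
    rewrite wI I_sqr subrr mul0r divff// mul1r.
    by rewrite -[I + I]opprK opprK kii subrr mulr0.
  have vE : v = b *: kernel_resolvent (pi / 2) w (- I).
    rewrite -(resolvent_kernel (pi / 2) wn NI_nonreal); last by rewrite NIJ eq_sym.
    exact: resolvent_scale.
  have BK : B (kernel_resolvent (pi / 2) w (- I)).
    have [] // := kernel_resolventP (pi / 2) wn NI_nonreal _.
    by rewrite NIJ eq_sym.
  rewrite vE (ip_scaler hH)// (ip_scalel hH)// -eval_ip//.
  rewrite /kernel_resolvent NIJ.
  set t := (_ *: (_ - _)) (- I).
  have -> : t = (I - w)^-1 * (k (- I) (- I) - s2 I / s2 w * k (- I) w^*) by [].
  have wJ : complex.Im w^* != 0 by rewrite ImJ oppr_eq0.
  have := kernelE (- I) wJ; rewrite conjcK => <-.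
  have -> : 1 + w * w = - (I - w) * (w + I).
    transitivity (- (I * I) + w * w); last by ring.
    by rewrite I_sqr opprK.
  have iw : I - w != 0 by rewrite subr_eq0 eq_sym.
  rewrite -[(- (pi%:C / s_ e (pi / 2) I))^*]/(b^*).
  by field; rewrite iw s2w.
transitivity (w * ip u u + (1 + w * w) * ip u v); first by ring.
rewrite main uu Re kiiE bJ /b /wedge -/s0 -/s2.
have p0 := pi_neq0; move: (pi%:C : R[i]) p0 => p p0.
by field; rewrite i2 p0 s2i s2ni s2w.
Qed.

(** * Extensions to the completion and the element s_0 *)

Section Extensions.
Variables (X : completeNormedModType R[i]) (N : (R[i] -> R[i]) -> R[i]).
Variables (iota : (R[i] -> R[i]) -> X) (hat : R[i] -> X -> R[i] -> R[i]).
Hypothesis compl : is_completion B N iota.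
Hypothesis hatP : forall w, complex.Im w != 0 ->
  is_bounded_extension B ip iota (resolvent (S_ (pi / 2)) w) (hat w).

Lemma near_embedded (phi : X) (A : set X) : nbhs phi A -> exists2 f, B f & A (iota f).
Proof.
move=> nA; have [|x [Ax [f Bf fx]]] := compl_dense compl (O := A^°) _ (open_interior A).
  by exists phi.
by exists f => //; rewrite fx; exact: (interior_subset Ax).
Qed.

(** Both sides are bounded in phi and agree on the dense image of the space, where
    this is the resolvent identity. *)
Lemma hat_identity w v phi : complex.Im w != 0 -> complex.Im v != 0 ->
  hat w phi = hat v phi + (w - v) *: resolvent (S_ (pi / 2)) w (hat v phi).
Proof.
move=> wn vn; have hw := hatP wn; have hv := hatP vn.
have [M1 H1] := bext_bounded hw; have [M2 H2] := bext_bounded hv.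
have [M3 M30 H3] := resolvent_bounded (pi / 2) wn.
have Bw (p : X) := bext_mem hw p; have Bv (p : X) := bext_mem hv p.
pose Phi (p : X) := hat w p - (hat v p + (w - v) *: resolvent (S_ (pi / 2)) w (hat v p)).
have BR (p : X) : B (resolvent (S_ (pi / 2)) w (hat v p)).
  by have [] := resolvent_value (pi / 2) wn (Bv p).
have BPhi (p : X) : B (Phi p).
  by apply: (B_sub hH) => //; apply: (B_add hH) => //; exact: (B_scale hH).
have Phi0 f : B f -> Phi (iota f) = 0.
  move=> Bf; rewrite /Phi (bext_extends hw Bf) (bext_extends hv Bf).
  by rewrite -resolvent_identity// subrr.
have PhiD (p q : X) : Phi (p + q) = Phi p + Phi q.
  have hD u (hu : is_bounded_extension B ip iota (resolvent (S_ (pi / 2)) u) (hat u)) :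
      hat u (p + q) = hat u p + hat u q.
    by rewrite -[p]scale1r (bext_linear hu) !scale1r.
  rewrite /Phi (hD _ hw) (hD _ hv).
  have := resolvent_linear (pi / 2) 1 wn (Bv p) (Bv q).
  rewrite !scale1r => ->; rewrite scalerDr.
  by rewrite [X in _ - X]addrACA opprD addrACA.
pose M : R := M1 + (M2 + nc (w - v) * (M3 * M2)).
have bnd (p : X) : (nrm (Phi p))%:C <= M%:C * `|p|.
  have p0 : 0 <= `|p| by exact: normr_ge0.
  have /complex_realP[r pr] : `|p| \is Num.real by exact: normr_real.
  move: p0; rewrite pr ler0c => r0.
  have := H1 p; have := H2 p; rewrite !(ip_normE hH)// pr -!rmorphM !lecR => h2 h1.
  rewrite (le_trans (nrm_sub hH _ _))//.
    by apply: (B_add hH) => //; exact: (B_scale hH).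
  rewrite /M [leRHS]mulrDl; apply: lerD => //.
  rewrite (le_trans (nrm_triangle hH _ _))//; first exact: (B_scale hH).
  rewrite [leRHS]mulrDl; apply: lerD => //.
  rewrite (nrm_scale hH)// -!mulrA ler_wpM2l ?nc_ge0//.
  by rewrite (le_trans (H3 _ (Bv p)))// ler_wpM2l.
apply/eqP; rewrite -subr_eq0 -/(Phi phi); apply/eqP.
apply: (nrm_eq0 hH) => //; apply/eqP; rewrite -normr_le0 ger0_norm ?nrm_ge0//.
apply/ler_addgt0Pr => eps eps0; rewrite add0r.
pose M' := `|M| + 1; have M'0 : 0 < M' by rewrite ltr_wpDl.
have e0 : 0 < (eps / M')%:C :> R[i] by rewrite ltcR divr_gt0.
have [f Bf /= bf] := near_embedded (nbhsx_ballx phi _ e0).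
have E : Phi phi = Phi (phi - iota f).
  by have := PhiD (phi - iota f) (iota f); rewrite subrK (Phi0 f Bf) addr0.
rewrite E -lecR (le_trans (bnd _))//.
move: bf; rewrite -ball_normE /= => bf.
have /complex_realP[r pr] : `|phi - iota f| \is Num.real by exact: normr_real.
have r0 : 0 <= r by rewrite -ler0c -pr normr_ge0.
move: bf; rewrite pr -rmorphM ltcR lecR => bf.
apply: (@le_trans _ _ (M' * (eps / M'))); last by rewrite mulrCA divff ?mulr1// gt_eqF.
apply: (@le_trans _ _ (M' * r)); last by rewrite ler_pM2l// ltW.
by rewrite ler_wpM2r// (le_trans (ler_norm M))// lerDl.
Qed.

End Extensions.

Local Notation Sstar := (adjoint B ip (mult_op B)).

Lemma adjoint_kernel v : Sstar (k^~ v) (v^* *: k^~ v).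
Proof.
split => //; first exact: (B_scale hH).
by move=> f f' [Bf Bf' fE]; rewrite (ip_scalel hH)// -!eval_ip// conjcK fE.
Qed.

Lemma adjoint_linear a g h g' h' : Sstar g h -> Sstar g' h' ->
  Sstar (a *: g + g') (a *: h + h').
Proof.
move=> [Bg Bh E] [Bg' Bh' E']; split; [exact: (hs_linear hH)|exact: (hs_linear hH)|].
move=> f f' Sf; have [Bf Bf' _] := Sf.
rewrite (ip_addl hH)//; last exact: (B_scale hH).
rewrite [in RHS](ip_addl hH)//; last exact: (B_scale hH).
by rewrite !(ip_scalel hH)// (E _ _ Sf) (E' _ _ Sf).
Qed.

(** Linear in the second argument because it is so for the inner product, which
    is dense and continuous in the first one. *)
Lemma pairing_linear (X : completeNormedModType R[i]) N (iota : (R[i] -> R[i]) -> X)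
    (pair : X -> (R[i] -> R[i]) -> R[i]) psi a g h :
  is_completion B N iota -> extends_inner_product B (dom Sstar) ip iota pair ->
  dom Sstar g -> dom Sstar h ->
  pair psi (a *: g + h) = a * pair psi g + pair psi h.
Proof.
move=> compl ext domg domh.
have domL : dom Sstar (a *: g + h).
  have [g' Sg] := domg; have [h' Sh] := domh.
  by exists (a *: g' + h'); exact: adjoint_linear.
have Bdom u : dom Sstar u -> B u by move=> [u' []].
apply/eqP; rewrite -subr_eq0 -nc_eq0 -normr_le0 ger0_norm ?nc_ge0//.
apply/ler_addgt0Pr => eps eps0; rewrite add0r.
pose D := 2 + nc a; have D0 : 0 < D by rewrite ltr_pwDl// nc_ge0.
have d0 : 0 < (eps / D)%:C :> R[i] by rewrite ltcR divr_gt0.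
have close u : dom Sstar u -> \forall phi \near psi, nc (pair psi u - pair phi u) < eps / D.
  move=> domu; have [cu _] := ext u domu.
  have := (@cvgrPdist_lt R[i] R[i]^o X (nbhs psi) (nbhs_filter psi)
      (fun phi => pair phi u) (pair psi u)).1 (cu psi) _ d0.
  by move=> nH; apply: filterS nH => phi /=; rewrite nc_norm ltcR.
have nA := filterI (close _ domL) (filterI (close _ domg) (close _ domh)).
have [f Bf [/= cL [cg ch]]] := near_embedded compl (nA _ _).
have ipL u : dom Sstar u -> pair (iota f) u = ip f u.
  by move=> domu; exact: (proj2 (ext u domu)).
move: cL cg ch; rewrite !ipL// (hs_ip_linear hH)//; try exact: Bdom.
move=> cL cg ch.
have -> : pair psi (a *: g + h) - (a * pair psi g + pair psi h) =
  (pair psi (a *: g + h) - (a * ip f g + ip f h)) - (pair psi h - ip f h)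
   - a * (pair psi g - ip f g) by ring.
rewrite (le_trans (ncB _ _))// (le_trans (lerD (ncB _ _) (lexx _)))// ncM.
apply: (@le_trans _ _ (eps / D + eps / D + nc a * (eps / D))).
  by apply: lerD; [apply: lerD; exact: ltW|rewrite ler_wpM2l ?nc_ge0// ltW].
have -> : eps / D + eps / D + nc a * (eps / D) = eps / D * D by rewrite /D; ring.
by rewrite divfK// gt_eqF.
Qed.

Section Sigma.
Variables (X : completeNormedModType R[i]) (N : (R[i] -> R[i]) -> R[i]).
Variables (iota : (R[i] -> R[i]) -> X) (hat : R[i] -> X -> R[i] -> R[i]).
Hypothesis compl : is_completion B N iota.
Hypothesis hatP : forall w, complex.Im w != 0 ->
  is_bounded_extension B ip iota (resolvent (S_ (pi / 2)) w) (hat w).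
Variables (XF : completeNormedModType R[i]) (NF : (R[i] -> R[i]) -> R[i]).
Variables (iotaF : (R[i] -> R[i]) -> XF) (pairF : XF -> (R[i] -> R[i]) -> R[i]).
Hypothesis complF : is_completion B NF iotaF.
Hypothesis extF : extends_inner_product B (dom Sstar) ip iotaF pairF.
Variables (psi : XF) (sigma0 : X).
Hypothesis psiE : forall z, s_ e 0 z = (pairF psi (k^~ z))^*.
Hypothesis sigma0E : forall h, dom (S_ (pi / 2)) h ->
  ip (hat (- I) sigma0) (ap (S_ (pi / 2)) h - I *: h) = pairF psi h.

(** Test with the kernels: the pairing of s_0 with R(i) k_v is known, since R(i) k_v
    is a combination of kernels and s_0 pairs with a kernel to its value. This gives the
    left side at every non-real v other than - i, and continuity does the rest. *)
Lemma hat_sigma_base : hat (- I) sigma0 = - (pi%:C / s_ e (pi / 2) (- I)) *: k^~ I.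
Proof.
have BN := bext_mem (hatP NI_nonreal) sigma0.
pose s0 := s_ e 0; pose s2 := s_ e (pi / 2).
have s2i : s2 I != 0 by apply: s_neq0; exact: I_nonreal.
have s2ni : s2 (- I) != 0 by apply: s_neq0; exact: NI_nonreal.
apply: (entire_eq_nonreal (w := - I)); [exact: (hs_entire hH)| |exact: NI_nonreal|].
  exact/(hs_entire hH)/(B_scale hH).
move=> v vn vI; rewrite -[RHS]/(- (pi%:C / s2 (- I)) * k v I).
have vJI : v^* != I.
  by apply: contra vI => /eqP vJ; rewrite -I_conj -vJ conjcK.
have NIJ : (- I)^* = I by rewrite -I_conj conjcK.
pose h := resolvent (S_ (pi / 2)) I (k^~ v).
have [T apE] := ap_Spi2_resolvent I_nonreal (Bk v).
have domh : dom (S_ (pi / 2)) h by exists (k^~ v + I *: h).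
have := sigma0E domh; rewrite apE addrK.
have -> : ip (hat (- I) sigma0) (k^~ v) = (hat (- I) sigma0 v)^*.
  by rewrite (ip_sym hH)// -eval_ip.
have domk u : dom Sstar (k^~ u) by exists (u^* *: k^~ u); exact: adjoint_kernel.
have hE : h = (v^* - I)^-1 *: k^~ v +
    ((- ((v^* - I)^-1 * (s2 v^* / s2 I))) *: k^~ (- I) + 0).
  rewrite /h (resolvent_kernel (pi / 2) I_nonreal vn vJI) /kernel_resolvent I_conj.
  by rewrite addr0 scalerBr scalerA scaleNr.
have dom0 : dom Sstar 0.
  exists 0; split; [exact: (hs_zero hH)|exact: (hs_zero hH)|].
  by move=> f f' [Bf Bf' _]; rewrite !(ip_sym hH (hs_zero hH))// !(ip_0r hH).
have dom1 : dom Sstar (- ((v^* - I)^-1 * (s2 v^* / s2 I)) *: k^~ (- I) + 0).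
  have [g1 S1] := domk (- I); have [g2 S2] := dom0.
  by eexists; exact: (adjoint_linear _ S1 S2).
have pair0 : pairF psi 0 = 0.
  have := pairing_linear psi 1 complF extF dom0 dom0.
  rewrite scale1r addr0 mul1r => /eqP.
  by rewrite -subr_eq subrr => /eqP/esym.
rewrite hE (pairing_linear _ _ complF extF)// (pairing_linear _ _ complF extF)// pair0 addr0.
move=> /(congr1 conjc); rewrite conjcK => ->.
have c1 : ((v^* - I)^-1)^* = (v + I)^-1 by rewrite conjV conjB conjcK I_conj opprK.
have c2 : (s2 v^* / s2 I)^* = s2 v / s2 (- I).
  by rewrite [LHS]conjM conjV !s_conj conjcK I_conj.
rewrite conjD 2!conjM -!psiE conjN [((v^* - I)^-1 * _)^*]conjM c1 c2.
have vI0 : v + I != 0 by rewrite -[I]opprK subr_eq0.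
have K := kernelE v I_nonreal; rewrite I_conj opprK in K.
have -> : k v I = (pi%:C^-1 * wedge v (- I)) / (v + I) by rewrite -K mulrAC mulfV// mul1r.
rewrite /wedge -/s0 -/s2.
have p0 := pi_neq0; move: (pi%:C : R[i]) p0 => p p0.
by field; rewrite p0 vI0 s2ni.
Qed.

(** The resolvent identity moves the base point - i to w. *)
Lemma hat_sigma w : complex.Im w != 0 ->
  hat w sigma0 = - (pi%:C / s_ e (pi / 2) w) *: k^~ w^*.
Proof.
move=> wn.
have s2w : s_ e (pi / 2) w != 0 by exact: s_neq0.
have s2ni : s_ e (pi / 2) (- I) != 0 by apply: s_neq0; exact: NI_nonreal.
have [->|wI] := eqVneq w (- I).
  by rewrite hat_sigma_base -[(- I)^*]/((- I)^*) -I_conj conjcK I_conj.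
rewrite (hat_identity compl hatP sigma0 wn NI_nonreal) hat_sigma_base.
set a := - (pi%:C / s_ e (pi / 2) (- I)).
have IJw : I^* != w by rewrite I_conj eq_sym.
rewrite (resolvent_scale _ _ wn (Bk I)) (resolvent_kernel _ wn I_nonreal IJw).
rewrite /kernel_resolvent I_conj.
apply/funext => z; set g := k^~ w^*.
rewrite -[LHS]/(a * k z I + (w - - I) * (a * ((- I - w)^-1 *
  (k z I - s_ e (pi / 2) (- I) / s_ e (pi / 2) w * g z)))).
rewrite -[RHS]/(- (pi%:C / s_ e (pi / 2) w) * g z) /a.
have wI0 : - I - w != 0 by rewrite subr_eq0 eq_sym.
have p0 := pi_neq0; move: (pi%:C : R[i]) p0 => p p0.
by field; rewrite s2w s2ni wI0.
Qed.

End Sigma.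
End FixedBasePoint.
End deBranges.

(** * The difference of the resolvents *)

Theorem proposition4p6 (R : realType)
    (e : R[i] -> R[i]) (B : set (R[i] -> R[i]))
    (ip : (R[i] -> R[i]) -> (R[i] -> R[i]) -> R[i])
    (k : R[i] -> R[i] -> R[i])
    (w0 : R[i])
    (Bm2 : completeNormedModType R[i]) (iota2 : (R[i] -> R[i]) -> Bm2)
    (hatR : R[i] -> Bm2 -> (R[i] -> R[i]))
    (Fm1 : completeNormedModType R[i]) (iotaF : (R[i] -> R[i]) -> Fm1)
    (pairF : Fm1 -> (R[i] -> R[i]) -> R[i])
    (psi : Fm1) (sigma0 : Bm2) (gamma : R) :
  let S_ := canonical_extension B e w0 in
  let Spi2 := S_ (pi / 2) in
  let Sstar := adjoint B ip (mult_op B) in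
  let pair2 (phi : Bm2) (g : R[i] -> R[i]) :=
    ip (hatR (- 'i) phi) (ap Spi2 g - 'i *: g) in
  let R_ (t : R) (w : R[i]) := resolvent (S_ t) w in
  let q (w : R[i]) :=
    let u := hatR 'i sigma0 in
    let v := R_ (pi / 2) w u in
    ip u (v + w *: ap Spi2 v) in
  let lambda : R := pi * tan gamma + pi * complex.Re (s_ e 0 'i / s_ e (pi / 2) 'i) in
  deBranges_space B ip ->
  (exists2 f, B f & f <> 0) ->
  hermite_biehler e ->
  (forall x : R, e x%:C != 0) ->
  B = space_of e ->
  (forall f g, B f -> B g -> ip f g = ip_of e f g) ->
  reproducing_kernel B ip k ->
  densely_defined B ip (mult_op B) ->
  complex.Im w0 != 0 ->
  is_completion B (ip_norm (minus2_ip ip Spi2)) iota2 ->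
  (forall w, ~ spec B ip Spi2 w ->
     is_bounded_extension B ip iota2 (R_ (pi / 2) w) (hatR w)) ->
  is_completion B (dual_graph_norm ip Sstar) iotaF ->
  extends_inner_product B (dom Sstar) ip iotaF pairF ->
  (forall z, s_ e 0 z = (pairF psi (k^~ z))^*) ->
  (forall h, dom Spi2 h -> pair2 sigma0 h = pairF psi h) ->
  0 <= gamma < pi -> gamma != pi / 2 ->
  (forall w : R[i], complex.Im w != 0 -> forall f, B f ->
     R_ gamma w f - R_ (pi / 2) w f =
     (1 / ((pi * tan gamma)%:C + pi%:C * (s_ e 0 w / s_ e (pi / 2) w)) *
      ip (hatR w^* sigma0) f) *: hatR w sigma0) /\
  (forall w : R[i], complex.Im w != 0 -> forall f, B f ->
     R_ gamma w f - R_ (pi / 2) w f =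
     (1 / (lambda%:C - q w) * ip (hatR w^* sigma0) f) *: hatR w sigma0).
Proof.
move=> S_ Spi2 Sstar pair2 R_ q lambda hB _ HBe e_real BE ipE rk dense_S w0n compl2 ext2
  complF extF psiE sigma0E /andP[g0 gpi] gpi2.
have hatP w : complex.Im w != 0 -> is_bounded_extension B ip iota2 (R_ (pi / 2) w) (hatR w).
  move=> wn; apply: ext2; exact: (nonreal_resolvent_set hB HBe e_real BE ipE rk w0n).
have hatE w : complex.Im w != 0 ->
    hatR w sigma0 = - (pi%:C / s_ e (pi / 2) w) *: k^~ w^*.
  exact: (hat_sigma hB HBe e_real BE ipE rk w0n dense_S compl2 hatP complF extF psiE sigma0E).
have pi0 : pi%:C != 0 :> R[i] by rewrite eq_complex/= eqxx andbT gt_eqF// pi_gt0.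
have Bk v : B (k^~ v) := proj1 (rk v).
have hH := dB_hilbert hB.
(* gamma lies in [0, pi), where the cosine is injective *)
have cg0 : cos gamma != 0.
  apply: contra gpi2 => /eqP cg; apply/eqP; apply: cos_inj.
  - by rewrite in_itv/= g0 ltW.
  - by rewrite in_itv/= divr_ge0 ?pi_ge0//= ler_pdivrMr// ler_peMr ?pi_ge0// ler1n.
  - by rewrite cg cos_pihalf.
have cgC : (cos gamma)%:C != 0 :> R[i] by rewrite eq_complex/= eqxx andbT.
have tanE w : complex.Im w != 0 -> (pi * tan gamma)%:C + pi%:C * (s_ e 0 w / s_ e (pi / 2) w) =
    pi%:C * (s_ e gamma w / ((cos gamma)%:C * s_ e (pi / 2) w)).
  move=> wn; have s2 := s_neq0 HBe (pi / 2) wn.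
  rewrite (s_E e gamma) /tan.
  have -> : (pi * (sin gamma / cos gamma))%:C = pi%:C * ((sin gamma)%:C / (cos gamma)%:C) :> R[i].
    by rewrite rmorphM fmorph_div.
  by move: (pi%:C : R[i]) => p; field; rewrite cgC s2.
have krein w f : complex.Im w != 0 -> B f ->
    R_ gamma w f - R_ (pi / 2) w f =
    (1 / ((pi * tan gamma)%:C + pi%:C * (s_ e 0 w / s_ e (pi / 2) w)) *
      ip (hatR (conjc w) sigma0) f) *: hatR w sigma0.
  move=> wn Bf; have wJ : complex.Im (conjc w) != 0 by rewrite ImJ oppr_eq0.
  rewrite (krein_difference hB HBe e_real BE ipE rk w0n gamma wn Bf) !hatE// conjcK.
  rewrite (ip_scalel hH)// -(eval_ip rk w Bf) tanE// scalerA; congr (_ *: _).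
  rewrite coefficient_conj conjcK.
  have sg := s_neq0 HBe gamma wn; have s2 := s_neq0 HBe (pi / 2) wn.
  move: (pi%:C : R[i]) pi0 => p p0.
  by field; rewrite sg s2 cgC p0.
split => w wn f Bf; first exact: krein.
rewrite krein//; congr ((1 / _ * _) *: _).
have iE := hatE _ (@I_nonreal R).
have qE : q w = pi%:C * ((complex.Re (s_ e 0 (imag_unit R) / s_ e (pi / 2) (imag_unit R)))%:C -
    s_ e 0 w / s_ e (pi / 2) w).
  rewrite I_conj in iE; rewrite -(q_value hB HBe e_real BE ipE rk w0n dense_S wn).
  by rewrite /q [hatR _ _]iE.
have lE : lambda%:C = (pi * tan gamma)%:C +
    pi%:C * (complex.Re (s_ e 0 (imag_unit R) / s_ e (pi / 2) (imag_unit R)))%:C.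
  by rewrite /lambda rmorphD; congr (_ + _); exact: rmorphM.
rewrite qE lE; move: (pi%:C : R[i]) => p; ring.
Qed.
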